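(* Let $\gamma\in[0,\tfrac12]$, $\beta>1-2\gamma$ (with $\beta>0$), $u\in(0,1)$ and $\theta\in(-\infty,2]$. For each $N$, let $G_N$ be the Simplified Norros–Reittu graph on $[N]$ with parameters $\beta,\gamma$, and consider on $G_N$ the discursive voter model with temperature parameter $\theta$ started from initial opinions distributed as $\mu_u$. Then \[ \mathbb{E}^{\theta}_{\mu_u}\left(\tau_{\mathrm{cons}}\,\middle|\,G_N\right)=\Theta_{\mathbb{P}}^{\log N}(N). \]
   Context: **Graph.** $[N]=\{1,\dots,N\}$. The Simplified Norros–Reittu (SNR) graph $G_N$ with parameters $\beta>0$, $\gamma\in[0,1)$ is the random simple graph on $[N]$ in which each edge $\{i,j\}$, $i\ne j$, is present independently with probability $p_{ij}=1-\exp(-\beta N^{2\gamma-1}i^{-\gamma}j^{-\gamma})$. **Voter model.** Let $\mathrm{d}(i)$ be the degree of $i$ and $i\sim j$ denote adjacency. For $\eta\in\{0,1\}^N$ and $i\neq j$, let $\eta^{i\leftarrow j}(k)=\eta(j)$ if $k=i$ and $\eta^{i\leftarrow j}(k)=\eta(k)$ otherwise. The discursive voter model with temperature parameter $\theta\in\mathbb{R}$ on a graph with vertex set $[N]$ is the continuous-time Markov process $(\eta_t)_{t\ge0}$ on $\{0,1\}^N$ with generator \[ \mathcal{L}f(\eta)=\sum_{i=1}^N \mathrm{d}(i)^{\theta}\sum_{j\sim i}\frac{1}{\mathrm{d}(i)}\left(\tfrac12 f(\eta^{j\leftarrow i})+\tfrac12 f(\eta^{i\leftarrow j})-f(\eta)\right)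 \] (vertices of degree $0$ contribute nothing). **Initial law.** $\mu_u$ is the product measure on $\{0,1\}^{[N]}$ under which the opinions are i.i.d. Bernoulli$(u)$. **Consensus time.** If $C_1,\dots,C_\ell$ are the connected components of $G_N$, then $\tau_{\mathrm{cons}}=\inf\{t\ge 0: \eta_t|_{C_i}\text{ is constant for each } i\in[\ell]\}$. $\mathbb{E}^\theta_{\mu_u}(\cdot\,|\,G_N)$ is expectation over the initial opinions and the voter dynamics given the graph $G_N$; it is a random variable depending on $G_N$. **Asymptotic notation.** For (random) $f(N)$ and $g(N)$, $f(N)=\Theta_{\mathbb{P}}^{\log N}(g(N))$ means that there is a constant $C>0$ such that $\mathbb{P}\left(\frac{g(N)}{\log^{2C}N}<\frac{f(N)}{\log^C N}<g(N)\right)\to1$ as $N\to\infty$. *)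

(* Defs.v *)
From HB Require Import structures.
From mathcomp Require Import all_boot all_order all_algebra.
From mathcomp Require Import all_classical all_reals all_analysis.

Set Implicit Arguments.
Unset Strict Implicit.
Unset Printing Implicit Defensive.

Import Order.TTheory GRing.Theory Num.Theory.
Import numFieldNormedType.Exports.

Local Open Scope classical_set_scope.
Local Open Scope ring_scope.

Record sgraph (V : finType) := SGraph {
  adj : {ffun V * V -> bool};
  adjP : [forall i, ~~ adj (i, i)] &&
         [forall i, forall j, adj (i, j) == adj (j, i)] }.

HB.instance Definition _ (V : finType) := [isSub for @adj V].
HB.instance Definition _ (V : finType) := [Finite of sgraph V by <:].

Definition adjrel (V : finType) (g : sgraph V) : rel V :=
  fun i j => adj g (i, j).

Definition degree (V : finType) (g : sgraph V) (i : V) : nat :=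
  #|[pred j | adjrel g i j]|.

Definition components (V : finType) (g : sgraph V) : {set {set V}} :=
  equivalence_partition (connect (adjrel g)) [set: V].

Definition mutually_independent (R : realType) (d : measure_display)
    (T : measurableType d) (P : probability T R) (I : finType) (D : {set I})
    (E : I -> set T) : Prop :=
  forall S : {set I}, S \subset D ->
    P (\bigcap_(i in [set` S]) E i) = (\prod_(i in S) P (E i))%E.

(* The vertex k of 'I_N stands for the integer k + 1 of {1, ..., N}. *)
Definition snr_prob (R : realType) (beta gamma : R) (N : nat)
    (i j : 'I_N) : R :=
  1 - expR (- (beta * N%:R `^ (2 * gamma - 1)
                 * i.+1%:R `^ (- gamma) * j.+1%:R `^ (- gamma))).

Definition edge_event (T : Type) (V : finType) (G : T -> sgraph V) (e : V * V) :
    set T :=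
  [set w | adjrel (G w) e.1 e.2].

(* An unordered pair {i, j} with i <> j is represented by (i, j) with i < j. *)
Definition is_snr_graph (R : realType) (beta gamma : R) (N : nat)
    (d : measure_display) (T : measurableType d) (P : probability T R)
    (G : T -> sgraph 'I_N) : Prop :=
  [/\ forall i j : 'I_N, measurable (edge_event G (i, j)),
      forall i j : 'I_N, (i < j)%N ->
        P (edge_event G (i, j)) = (snr_prob beta gamma i j)%:E
    & mutually_independent P [set e : 'I_N * 'I_N | (e.1 < e.2)%N]
        (edge_event G)].

Definition config (V : finType) := {ffun V -> bool}.

(* [copy eta i j] is the configuration in which i has adopted the opinion of
   j. *)
Definition copy (V : finType) (eta : config V) (i j : V) : config V :=
  [ffun k => if k == i then eta j else eta k].

(* When i has degree 0 the inner sum is empty, whatever the values of the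
   powers of 0. *)
Definition voter_generator (R : realType) (V : finType) (theta : R)
    (g : sgraph V) (f : config V -> R) (eta : config V) : R :=
  \sum_(i : V) ((degree g i)%:R `^ theta *
    \sum_(j : V | adjrel g i j)
      ((degree g i)%:R^-1 *
       (2^-1 * f (copy eta j i) + 2^-1 * f (copy eta i j) - f eta))).

(* [Q t x y] is the probability of going from x to y in time t. *)
Definition markov_semigroup (R : realType) (S : finType) (Q : R -> S -> S -> R)
    : Prop :=
  [/\ forall (t : R) x y, 0 <= t -> 0 <= Q t x y,
      forall (t : R) x, 0 <= t -> \sum_(y : S) Q t x y = 1,
      forall x y, Q 0 x y = (x == y)%:R
    & forall (s t : R) x y, 0 <= s -> 0 <= t ->
        Q (s + t) x y = \sum_(z : S) Q s x z * Q t z y].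

Definition has_generator (R : realType) (S : finType) (Q : R -> S -> S -> R)
    (L : (S -> R) -> S -> R) : Prop :=
  forall (f : S -> R) (x : S),
    (\sum_(y : S) Q t x y * f y - f x) / t @[t --> 0^'+] --> L f x.

(* The sigma-algebra generated by X r for 0 <= r <= s. *)
Definition past (R : realType) (S T : Type) (X : R -> T -> S) (s : R) :
    set (set T) :=
  <<s [set B | exists (r : R) (x : S), 0 <= r <= s /\ B = X r @^-1` [set x]] >>.

Definition cadlag (R : realType) (S : Type) (x : R -> S) : Prop :=
  (forall t : R, 0 <= t -> \forall s \near t^'+, x s = x t) /\
  (forall t : R, 0 < t -> exists a, \forall s \near t^'-, x s = a).

(* Only the values X t with 0 <= t are relevant. *)
Definition is_markov_process (R : realType) (S : finType) (mu : S -> R)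
    (L : (S -> R) -> S -> R) (d : measure_display) (T : measurableType d)
    (P : probability T R) (X : R -> T -> S) : Prop :=
  [/\ forall (t : R) x, 0 <= t -> measurable (X t @^-1` [set x]),
      forall w, cadlag (fun t => X t w),
      forall x, P (X 0 @^-1` [set x]) = (mu x)%:E
    & exists Q : R -> S -> S -> R,
      [/\ markov_semigroup Q, has_generator Q L
        & forall (s t : R) (y : S) (A : set T),
            0 <= s -> 0 <= t -> past X s A ->
            P (A `&` X (s + t) @^-1` [set y]) =
            (\int[P]_(w in A) (Q t (X s w) y)%:E)%E]].

Definition bernoulli_product (R : realType) (V : finType) (u : R)
    (x : config V) : R :=
  \prod_(i : V) (if x i then u else 1 - u).

Definition is_voter_model (R : realType) (V : finType) (theta u : R)
    (g : sgraph V) (d : measure_display) (T : measurableType d)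
    (P : probability T R) (eta : R -> T -> config V) : Prop :=
  is_markov_process (@bernoulli_product R V u) (voter_generator theta g) P eta.

Definition consensus (V : finType) (g : sgraph V) (x : config V) : Prop :=
  forall A : {set V}, A \in components g -> {in A &, forall i j, x i = x j}.

Definition tau_cons (R : realType) (T : Type) (V : finType) (g : sgraph V)
    (eta : R -> T -> config V) (w : T) : \bar R :=
  ereal_inf [set t%:E | t in [set t : R | 0 <= t /\ consensus g (eta t w)]].

Definition ThetaP_log (R : realType) (d : nat -> measure_display)
    (T : forall N, measurableType (d N)) (P : forall N, probability (T N) R)
    (f g : forall N, T N -> \bar R) : Prop :=
  exists2 C : R, 0 < C &
    P N [set w | (g N w * ((ln N%:R `^ (2 * C))^-1)%:E
                    < f N w * ((ln N%:R `^ C)^-1)%:E < g N w)%E]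
      @[N --> \oo] --> 1%E.

(* Main.v *)
(** Write G for the random graph. On each edge {i, j} the two flips occur at the
    same rate q_ij = (d(i)^(theta-1) + d(j)^(theta-1)) / 2.

    Upper bound. Let h_t(a, b) be the probability that a and b disagree at time t.
    It evolves by the generator of two independent walks, killed when they meet,
    so the sum of h_t(a, b)^2 over connected pairs decreases at a rate equal, up to
    a constant, to the sum over b of the Dirichlet energies of h_t(., b). As
    h_t(., b) vanishes at b, its energy dominates its sum of squares up to the
    factor N times the squared length of the connecting paths divided by the
    smallest rate along them. If any two
    connected vertices are joined by a path of polylogarithmic length along edges
    of rate at least 1 / polylog, disagreements die out in time N polylog.

    Lower bound. The number F of disagreeing connected pairs satisfies
    L F >= - 2 sum d(i)^theta >= - 2 sum d(i)^2, which is -N polylog because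
    2 gamma <= 1, while F is initially of order N^2 / polylog as soon as some
    component has N / polylog vertices.

    Graph estimates. Give i the weight W_i = (N / i)^gamma. Breadth-first search
    multiplies the weight of its levels, restricted to vertices of bounded weight,
    by a factor > 1 on average (this is beta > 1 - 2 gamma). An exponential
    supermartingale then shows that, with high probability, each exploration
    within O(log N) levels either dies or reaches weight of order N; from a vertex
    of weight >> log N, or from >> log N starting points, it cannot die. Two large
    explorations are joined by an edge between two of their levels. All this
    survives the removal of the edges between two vertices of weight >> log N
    (hubs), and every remaining edge has an endpoint of polylogarithmic degree. *)
Require Import Defs.
From HB Require Import structures.
From mathcomp Require Import all_boot all_order all_algebra.
From mathcomp Require Import all_classical all_reals all_analysis.
From mathcomp Require Import measurable_realfun.
From mathcomp Require Import ring lra.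

Set Implicit Arguments.
Unset Strict Implicit.
Unset Printing Implicit Defensive.

Import Order.TTheory GRing.Theory Num.Theory.
Import numFieldNormedType.Exports.

Local Open Scope ring_scope.

(** * Bernoulli product measures *)

(** The graph is a function of finitely many independent bits, one per pair of vertices, so its
    probabilities are finite sums and conditional expectations become sums over the states of an
    exploration. The voter side treats one deterministic graph at a time. No meeting time is
    estimated there: since q_ij is symmetric, the square sum of h_t dissipates one Dirichlet form
    for each fixed second vertex, and the condition h_t(b, b) = 0 replaces a spectral gap. Passing
    from square sums to the probability of disagreement costs a power of N, hence only one logarithm
    in time. The semigroup is only known to be right-differentiable at 0, so differential
    inequalities are replaced by Euler steps with a uniform error. On the graph side the growth
    factor exceeds 1 only while the unexplored part is almost everything. Each exploration is
    therefore followed until its bounded-weight part reaches a small constant times N; below that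
    threshold the loss of mass is absorbed by the margin in beta > 1 - 2 gamma. *)

Section BernoulliProduct.
Variables (R : realType) (E : finType) (p : E -> R).

Definition bweight (w : {ffun E -> bool}) : R :=
  \prod_e (if w e then p e else 1 - p e).

Definition bmean (f : {ffun E -> bool} -> R) : R := \sum_w bweight w * f w.

Definition depends (T : Type) (f : {ffun E -> bool} -> T) (S : {set E}) :=
  forall w w' : {ffun E -> bool}, {in S, w =1 w'} -> f w = f w'.

Lemma bmean_prod (g : E -> bool -> R) :
  bmean (fun w => \prod_e g e (w e)) =
  \prod_e (p e * g e true + (1 - p e) * g e false).
Proof.
rewrite /bmean /bweight.
pose F e (b : bool) := (if b then p e else 1 - p e) * g e b.
rewrite (eq_bigr (fun w : {ffun E -> bool} => \prod_e F e (w e))); last first.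
  by move=> w _; rewrite -big_split.
rewrite -(bigA_distr_bigA F); apply: eq_bigr => e _.
by rewrite big_bool.
Qed.

Lemma bmean1 : bmean (fun=> 1) = 1.
Proof.
have H : bmean (fun w => \prod_(e : E) 1) = 1.
  rewrite (bmean_prod (fun _ _ => 1)) big1 // => e _.
  by rewrite !mulr1 addrC subrK.
by rewrite -[RHS]H /bmean; apply: eq_bigr => w _; rewrite big1_eq.
Qed.

Lemma bmeanZl a f : bmean (fun w => a * f w) = a * bmean f.
Proof. by rewrite /bmean mulr_sumr; apply: eq_bigr => w _; rewrite mulrCA. Qed.

Lemma bmean_sum (I : Type) (s : seq I) (P : pred I) (F : I -> {ffun E -> bool} -> R) :
  bmean (fun w => \sum_(i <- s | P i) F i w) = \sum_(i <- s | P i) bmean (F i).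
Proof.
rewrite /bmean exchange_big /=; apply: eq_bigr => w _.
by rewrite mulr_sumr.
Qed.

Lemma bmeanD f g : bmean (fun w => f w + g w) = bmean f + bmean g.
Proof. by rewrite /bmean -big_split /=; apply: eq_bigr => w _; rewrite mulrDr. Qed.

Lemma eq_bmean f g : f =1 g -> bmean f = bmean g.
Proof. by move=> fg; rewrite /bmean; apply: eq_bigr => w _; rewrite fg. Qed.

(* [bmean_indep] rests on the fact that two independent samples may exchange
   their coordinates outside [S] without changing their joint weight. *)
Definition mix (S : {set E}) (w w' : {ffun E -> bool}) : {ffun E -> bool} :=
  [ffun e => if e \in S then w e else w' e].

Lemma bweight_mix S w w' :
  bweight (mix S w w') * bweight (mix S w' w) = bweight w * bweight w'.
Proof.
rewrite /bweight -[LHS]big_split -[RHS]big_split /=; apply: eq_bigr => e _; rewrite !ffunE.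
by case: (e \in S); rewrite // mulrC.
Qed.

Lemma bmean_indep (S S' : {set E}) (f g : {ffun E -> bool} -> R) :
  [disjoint S & S'] -> depends f S -> depends g S' ->
  bmean (fun w => f w * g w) = bmean f * bmean g.
Proof.
move=> dSS df dg.
have mixE w w' : f (mix S w w') * g (mix S w w') = f w * g w'.
  congr (_ * _); [apply: df | apply: dg] => e eS; rewrite ffunE ?eS //.
  by rewrite (disjointFl dSS eS).
(* The factor 1 is written as a second mean, so that both sides become sums over pairs of samples,
   to which the exchange [h] applies. *)
rewrite -[LHS]mulr1 -bmean1 /bmean !big_distrlr /=.
rewrite !pair_big /=.
pose h (q : {ffun E -> bool} * {ffun E -> bool}) := (mix S q.1 q.2, mix S q.2 q.1).
have hh : involutive h.
  move=> [w w']; rewrite /h /=; congr (_, _); apply/ffunP => e;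
  by rewrite !ffunE; case: (e \in S).
rewrite (reindex_inj (inv_inj hh)) /=; apply: eq_bigr => -[w w'] _ /=.
by rewrite mulr1 mulrAC bweight_mix mixE mulrACA.
Qed.

Lemma bmean_prod_indep (I : finType) (P : pred I)
  (F : I -> {ffun E -> bool} -> R) (S : I -> {set E}) :
  (forall i, P i -> depends (F i) (S i)) ->
  (forall i j, P i -> P j -> i != j -> [disjoint S i & S j]) ->
  bmean (fun w => \prod_(i | P i) F i w) = \prod_(i | P i) bmean (F i).
Proof.
move=> dF dS.
have : uniq (index_enum I) by exact: index_enum_uniq.
elim: (index_enum I) => [_|i s IH /= /andP[si us]].
  by rewrite big_nil (eq_bmean (g := fun=> 1)) ?bmean1 // => w; rewrite big_nil.
rewrite big_cons; case: ifP => Pi; last first.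
  by rewrite -IH //; apply: eq_bmean => w; rewrite big_cons Pi.
rewrite -IH // -(@bmean_indep (S i) (\bigcup_(j <- s | P j) S j)).
- by apply: eq_bmean => w; rewrite big_cons Pi.
- rewrite -setI_eq0 big_distrr /= big_seq_cond big1 // => j /andP[js Pj].
  apply/eqP; rewrite setI_eq0; apply: dS => //.
  by apply: contraNneq si => ->.
- exact: dF.
- elim: s {IH si us} => [|j s IH] w w' ww'; first by rewrite !big_nil.
  move: ww'; rewrite !big_cons; case: ifP => Pj ww'; last exact: IH.
  congr (_ * _).
    by apply: (dF _ Pj) => e eS; apply: ww'; rewrite finset.in_setU eS.
  by apply: IH => e eS; apply: ww'; rewrite finset.in_setU eS orbT.
Qed.

Hypothesis p01 : forall e, 0 <= p e <= 1.

Lemma bweight_ge0 w : 0 <= bweight w.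
Proof.
rewrite /bweight; apply: prodr_ge0 => e _; case/andP: (p01 e) => p0 p1.
by case: ifP => // _; rewrite subr_ge0.
Qed.

Lemma le_bmean f g : (forall w, f w <= g w) -> bmean f <= bmean g.
Proof. by move=> fg; rewrite /bmean; apply: ler_sum => w _; rewrite ler_wpM2l ?bweight_ge0. Qed.

Lemma bmean_ge0 f : (forall w, 0 <= f w) -> 0 <= bmean f.
Proof. by move=> f0; rewrite /bmean; apply: sumr_ge0 => w _; rewrite mulr_ge0 ?bweight_ge0. Qed.

End BernoulliProduct.

(** * Exploration of a random graph *)

Section BreadthFirstSearch.
Variable V : finType.
Implicit Types (e : rel V) (S D A : {set V}).

(* The state is (vertices already explored, current level). *)
Definition bstep e (q : {set V} * {set V}) : {set V} * {set V} :=
  (q.1 :|: q.2, [set j | (j \notin q.1 :|: q.2) && [exists x in q.2, e x j]]).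

Definition bfs e S r := iter r (bstep e) (finset.set0, S).

Definition bball e S r := (bfs e S r).1 :|: (bfs e S r).2.

Lemma bfs_disj e S r : [disjoint (bfs e S r).1 & (bfs e S r).2].
Proof.
rewrite -setI_eq0; case: r => [|r]; first by rewrite finset.set0I.
apply/eqP/setP => x; rewrite !finset.inE /=.
by case: (_ || _).
Qed.

Lemma bfs_inner e S r : (bfs e S r.+1).1 = bball e S r.
Proof. by []. Qed.

Lemma bballS e S r : bball e S r \subset bball e S r.+1.
Proof. by rewrite {2}/bball bfs_inner finset.subsetUl. Qed.

Lemma bball_mono e S r s : (r <= s)%N -> bball e S r \subset bball e S s.
Proof.
move=> /subnK <-; elim: (s - r)%N => [|k IH]; first by rewrite add0n.
exact: fintype.subset_trans IH (bballS _ _ _).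
Qed.

Lemma bfs_alive e S r : (bfs e S r.+1).2 != finset.set0 -> (bfs e S r).2 != finset.set0.
Proof.
apply: contra_neq => A0; apply/setP => j; rewrite !finset.inE /= A0.
rewrite [X in _ && X](_ : _ = false) ?andbF //.
by apply/existsP => -[x]; rewrite finset.inE.
Qed.

Lemma bball_level e S R x : x \in bball e S R -> exists2 r, (r <= R)%N & x \in (bfs e S r).2.
Proof.
elim: R => [|R IH]; first by rewrite /bball /= finset.set0U => xS; exists 0%N.
rewrite {1}/bball finset.in_setU => /orP[/IH[r rR xr]|xR]; last by exists R.+1.
by exists r => //; apply: leqW.
Qed.

Lemma bfs_closed e S r x y : x \in (bfs e S r).1 -> e x y -> y \in bball e S r.
Proof.
elim: r => [|r IH] in x y *; first by rewrite finset.inE.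
rewrite bfs_inner {1}/bball finset.in_setU => /orP[xD|xA] exy.
  exact: (fintype.subsetP (bballS _ _ _)) (IH _ _ xD exy).
rewrite /bball bfs_inner finset.in_setU; case: (boolP (y \in bball e S r)) => //= yN.
by rewrite finset.inE yN /=; apply/existsP; exists x; rewrite xA.
Qed.

(** Computing the state (D, A) queries only pairs with an endpoint in D: the edges leaving the
    current level A are still unread. All independence arguments on explorations rest on this. *)
Lemma bfs_determined e e' S r D A :
  bfs e S r = (D, A) -> (forall x y, x \in D -> e x y = e' x y) ->
  bfs e' S r = (D, A).
Proof.
elim: r => [|r IH] in D A *; first by [].
rewrite /bfs !iterS -/(bfs e S r) -/(bfs e' S r).
case E : (bfs e S r) => [D0 A0] [<- <-] ee'.
rewrite (IH _ _ E) => [|x y xD]; last by apply: ee'; rewrite finset.in_setU xD.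
congr pair; apply/setP => j; rewrite !finset.inE; congr (_ && _).
apply: eq_existsb => x; case: (boolP (x \in A0)) => //= xA.
by rewrite ee' // finset.in_setU xA orbT.
Qed.

Lemma bfs_walk e S r x : x \in (bfs e S r).2 ->
  exists2 s, s \in S & exists q : seq V, [/\ path e s q, size q = r & last s q = x].
Proof.
elim: r => [|r IH] in x *.
  by move=> xS; exists x => //; exists [::].
rewrite /bfs iterS -/(bfs e S r) finset.inE => /andP[_ /existsP[y /andP[yA eyx]]].
have [s sS [q [pq sq lq]]] := IH _ yA.
exists s => //; exists (rcons q x); rewrite rcons_path last_rcons size_rcons sq lq.
by split => //; rewrite pq.
Qed.

Lemma bball_walk e S R x : x \in bball e S R ->
  exists2 s, s \in S &
    exists q : seq V, [/\ path e s q, (size q <= R)%N & last s q = x].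
Proof.
move=> /bball_level[r rR /bfs_walk[s sS [q [pq sq lq]]]].
by exists s => //; exists q; rewrite sq.
Qed.

Lemma bball_dead_closed e S R x y : (bfs e S R).2 = finset.set0 ->
  x \in bball e S R -> e x y -> y \in bball e S R.
Proof.
by move=> A0; rewrite {1}/bball A0 finset.setU0; apply: bfs_closed.
Qed.

End BreadthFirstSearch.

(** * Explorations of a random graph with independent edges, by deferred decisions *)

Section RandomExploration.
Variables (R : realType) (V E : finType) (p : E -> R) (cd : V -> V -> E).
Variable hub : pred V.
Hypothesis p01 : forall e, 0 <= p e <= 1.
Hypothesis cd_inj : forall i j k l, cd i j = cd k l ->
  (i = k /\ j = l) \/ (i = l /\ j = k).

Local Notation EE := (bmean p).
Local Notation sample := {ffun E -> bool}.

(* Edges between two hubs are dropped: their flip rate can be polynomially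
   small when [theta < 1], and components stay connected without them. *)
Definition redge (w : sample) : rel V :=
  fun i j => [&& i != j, w (cd i j) & ~~ (hub i && hub j)].

Definition seg (A B : {set V}) : {set E} := [set cd x y | x in A, y in B].

(** A coordinate stands for an unordered pair, so A' has to avoid both sides of the first
    segment. *)
Lemma seg_disj (A B A' B' : {set V}) :
  [disjoint A' & A] -> [disjoint A' & B] -> [disjoint seg A B & seg A' B'].
Proof.
move=> dA dB; rewrite -setI_eq0; apply/eqP/setP => e; rewrite !finset.inE.
apply/negP => /andP[/imset2P[x y xA yB ->] /imset2P[x' y' xA' yB']].
case/cd_inj => -[? ?]; subst x' y'.
  by rewrite (disjointFr dA xA') in xA.
by rewrite (disjointFr dB xA') in yB.
Qed.

Lemma redge_depends x y : depends (fun w => redge w x y) [set cd x y].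
Proof. by move=> w w' ww'; rewrite /redge ww' // finset.inE. Qed.

Lemma bfs_depends (S D A : {set V}) r :
  depends (fun w => ((bfs (redge w) S r == (D, A))%:R : R)) (seg D [set: V]%SET).
Proof.
suff H (w w' : sample) : {in seg D [set: V]%SET, w =1 w'} ->
    bfs (redge w) S r = (D, A) -> bfs (redge w') S r = (D, A).
  move=> w w' ww'; congr (_%:R); congr (nat_of_bool _); apply/eqP/eqP; first exact: H.
  by apply: H => e eS; rewrite ww'.
move=> ww' h; apply: (bfs_determined h) => x y xD.
by rewrite /redge ww' //; apply/imset2P; exists x y => //; rewrite finset.inE.
Qed.

Definition newset (w : sample) (A X : {set V}) : {set V} :=
  [set j | (j \notin X) && [exists x in A, redge w x j]].

Lemma bstep_newset w q : (bstep (redge w) q).2 = newset w q.2 (q.1 :|: q.2).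
Proof. by []. Qed.

Lemma bmean_coord (e : E) (g : bool -> R) :
  EE (fun w => g (w e)) = p e * g true + (1 - p e) * g false.
Proof.
pose G e' b : R := if e' == e then g b else 1.
rewrite (eq_bmean p (g := fun w => \prod_e' G e' (w e'))) => [|w]; last first.
  rewrite (bigD1 e) //= big1 => [|i /negbTE ne]; last by rewrite /G ne.
  by rewrite /G eqxx mulr1.
rewrite bmean_prod (bigD1 e) //= big1 => [|i /negbTE ne].
  by rewrite /G eqxx mulr1.
by rewrite /G ne !mulr1 addrC subrK.
Qed.

Variables (W : V -> R) (c : R) (low : pred V).
Hypothesis W_ge1 : forall i, 1 <= W i.
Hypothesis c0 : 0 < c.
Hypothesis pE : forall i j, i != j -> p (cd i j) = 1 - expR (- (c * W i * W j)).
Hypothesis low_hub : forall i, low i -> ~~ hub i.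

Let W_ge0 i : 0 <= W i. Proof. exact: le_trans ler01 (W_ge1 i). Qed.

(** The truncation bounds each contribution by [phim], which keeps the exponents small enough to be
    linearised. The full weight [wt] of a level still governs how many edges leave it. *)
Definition lw (j : V) : R := if low j then W j else 0.
Definition lwt (A : {set V}) : R := \sum_(j in A) lw j.
Definition wt (A : {set V}) : R := \sum_(j in A) W j.

Lemma lw_ge0 j : 0 <= lw j. Proof. by rewrite /lw; case: ifP. Qed.
Lemma lwt_ge0 A : 0 <= lwt A. Proof. by apply: sumr_ge0 => j _; exact: lw_ge0. Qed.

Lemma lw_le j : lw j <= W j. Proof. by rewrite /lw; case: ifP. Qed.

Lemma lwt_le A : lwt A <= wt A.
Proof. by apply: ler_sum => j _; exact: lw_le. Qed.

Lemma wt_ge1 A : A != finset.set0 -> 1 <= wt A.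
Proof.
case/set0Pn => x xA; rewrite /wt (bigD1 x) //=.
by rewrite -[1]addr0 lerD ?W_ge1 // sumr_ge0.
Qed.

Lemma lwtS (A B : {set V}) : A \subset B -> lwt A <= lwt B.
Proof.
move=> AB; rewrite /lwt [leRHS](big_setID A) /= (finset.setIidPr AB) lerDl.
by apply: sumr_ge0 => j _; exact: lw_ge0.
Qed.

(** Absence probabilities are exponentials of products of weights, so their product over A depends
    on A only through [wt A]. No edge at a non-hub j is dropped, so j can be reached from every
    vertex of A. *)
Lemma missed (A X : {set V}) (j : V) : j \notin X -> A \subset X -> ~~ hub j ->
  EE (fun w => (~~ [exists x in A, redge w x j])%:R) = expR (- (c * W j * wt A)).
Proof.
move=> jX AX hj.
have jA : j \notin A by apply: contra jX; apply/fintype.subsetP.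
rewrite (eq_bmean p (g := fun w => \prod_(x in A) (~~ redge w x j)%:R)) => [|w]; last first.
  case: (boolP [exists x in A, redge w x j]) => [/existsP[x /andP[xA exj]]|].
    by rewrite (bigD1 x) //= exj mul0r.
  rewrite negb_exists => /forallP h; rewrite big1 // => x xA.
  by have := h x; rewrite xA /= => ->.
rewrite (bmean_prod_indep p (S := fun x => [set cd x j]%SET)).
- rewrite /wt mulr_sumr -sumrN expR_sum; apply: eq_bigr => x xA.
  have xj : x != j by apply: contraNneq jA => <-.
  rewrite (eq_bmean p (g := fun w => (~~ w (cd x j))%:R)) => [|w].
    by rewrite (bmean_coord _ (fun b => (~~ b)%:R)) mulr0 add0r mulr1 pE // subKr mulrAC.
  by rewrite /redge xj (negbTE hj) andbF andbT.
- by move=> x _ w w' ww'; rewrite (redge_depends ww').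
- move=> x y xA yA xy; rewrite disjoints1 finset.inE.
  apply/negP => /eqP/cd_inj[[]|[]] h h'; first by rewrite h eqxx in xy.
  by rewrite -h xA in jA.
Qed.

(** Distinct outside vertices j read disjoint sets of pairs, so they join the next level
    independently. Writing [lw j] in both exponents makes the factor 1 when j is not low. *)
Lemma newset_mean (A X : {set V}) (a : R) : A \subset X ->
  EE (fun w => expR (- (a * lwt (newset w A X)))) =
  \prod_(j in ~: X) (1 - (1 - expR (- (c * lw j * wt A))) * (1 - expR (- (a * lw j)))).
Proof.
move=> AX.
pose F j (w : sample) := if [exists x in A, redge w x j] then expR (- (a * lw j)) else 1.
rewrite (eq_bmean p (g := fun w => \prod_(j in ~: X) F j w)) => [|w]; last first.
  rewrite /lwt mulr_sumr -sumrN expR_sum /F -big_mkcondr /=; apply: eq_bigl => j.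
  by rewrite !finset.inE.
rewrite (bmean_prod_indep p (S := fun j => seg A [set j])); last 2 first.
- move=> j _ w w' ww'; rewrite /F; congr (if _ then _ else _).
  apply: eq_existsb => x; case: (boolP (x \in A)) => //= xA.
  apply: redge_depends => e; rewrite finset.inE => /eqP ->; apply: ww'.
  by apply/imset2P; exists x j => //; rewrite finset.inE.
- move=> i j; rewrite !finset.in_setC => iX jX ij.
  rewrite -setI_eq0; apply/eqP/setP => e; rewrite !finset.inE.
  apply/negP => /andP[/imset2P[x y xA + ->] /imset2P[x' y' xA' +]].
  rewrite !finset.inE => /eqP -> /eqP -> /cd_inj[[_ h]|[_ h]]; first by rewrite h eqxx in ij.
  by move: iX; rewrite h (fintype.subsetP AX).
apply: eq_bigr => j; rewrite finset.in_setC => jX.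
rewrite /lw; case: ifP => lj; last first.
  rewrite !(mulr0, oppr0, expR0, subrr, subr0) -(bmean1 p).
  by apply: eq_bmean => w; rewrite /F /lw lj mulr0 oppr0 expR0 if_same.
rewrite -(missed jX AX (low_hub lj)).
rewrite (eq_bmean p (g := fun w => expR (- (a * W j)) * 1 + (1 - expR (- (a * W j))) *
    (~~ [exists x in A, redge w x j])%:R)) => [|w].
  by rewrite bmeanD !bmeanZl bmean1; ring.
by rewrite /F /lw lj; case: [exists x in A, _] => /=; rewrite ?mulr0 ?mulr1 ?addr0 // addrC subrK.
Qed.

Lemma expRN_le_quad (x : R) : 0 <= x -> expR (- x) <= 1 - x + x ^+ 2.
Proof.
move=> x0; have q0 : 0 < 1 - x + x ^+ 2 by nra.
have := expR_ge1Dx x => ex.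
rewrite expRN -[leLHS]mul1r ler_pdivrMr ?expR_gt0 //.
apply: (@le_trans _ _ ((1 - x + x ^+ 2) * (1 + x))); last by rewrite ler_wpM2l // ltW.
have -> : (1 - x + x ^+ 2) * (1 + x) = 1 + x ^+ 3 by ring.
by rewrite lerDl exprn_ge0.
Qed.

Lemma onem_expRN_ge (t x : R) : 0 <= x <= t -> x * (1 - t) <= 1 - expR (- x).
Proof.
by move=> /andP[x0 xt]; have := expRN_le_quad x0; nra.
Qed.

(** [t] bounds the two arguments at which 1 - exp(-x) is replaced by a multiple of x, each time at
    the cost of a factor 1 - t. [M] caps the explored low weight and so costs at most [phim * M] in
    the sum of squares. [K] is the growth factor that remains. *)
Variables (t M phim K : R).
Hypothesis low_le : forall j, low j -> W j <= phim.
Hypothesis phim0 : 0 <= phim.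
Hypothesis cM : c * phim * M <= t.
Hypothesis t1 : 0 <= t <= 1.
Hypothesis HK : K <= (1 - t) ^+ 2 * (c * (\sum_(j | low j) W j ^+ 2 - phim * M)).

Lemma low_mass (X : {set V}) : lwt X <= M ->
  \sum_(j | low j) W j ^+ 2 - phim * M <= \sum_(j in ~: X) lw j ^+ 2.
Proof.
move=> XM.
have -> : \sum_(j | low j) W j ^+ 2 = \sum_j lw j ^+ 2.
  by rewrite big_mkcond /=; apply: eq_bigr => j _; rewrite /lw; case: ifP; rewrite // expr0n.
rewrite (bigID (mem X)) /=.
rewrite [X in _ <= X](eq_bigl (fun j => j \notin X)); last by move=> j; rewrite finset.in_setC.
rewrite lerBlDr addrC lerD2l.
apply: (@le_trans _ _ (phim * lwt X)); last by rewrite ler_wpM2l.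
rewrite /lwt mulr_sumr; apply: ler_sum => j _; rewrite expr2 ler_wpM2r ?lw_ge0 //.
by rewrite /lw; case: ifP => // /low_le.
Qed.

(* With [K > 1] this is the supercritical growth of the level weights: only the
   unexplored vertices of [low], whose mass barely changes, are counted. *)
Lemma step_bound (A X : {set V}) (a w : R) : A \subset X -> lwt X <= M ->
  0 <= a -> a * phim <= t -> 0 <= w <= M -> w <= wt A ->
  EE (fun s => expR (- (a * lwt (newset s A X)))) <= expR (- (K * a * w)).
Proof.
move=> AX XM a0 aphi /andP[w0 wM] wA; rewrite newset_mean //.
case/andP: t1 => t0 t1'.
have lwphi j : lw j <= phim by rewrite /lw; case: ifP => // /low_le.
apply: (@le_trans _ _ (\prod_(j in ~: X) expR (- ((1 - t) ^+ 2 * (c * w * a) * lw j ^+ 2)))).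
  apply: ler_prod => j _; have l0 := lw_ge0 j; have lp := lwphi j.
  have c0' := ltW c0.
  have clw : 0 <= c * lw j by rewrite mulr_ge0.
  have wtA0 : 0 <= wt A by exact: le_trans wA.
  have e1 : 0 <= 1 - expR (- (a * lw j)).
    by rewrite subr_ge0 -expR0 ler_expR oppr_le0 mulr_ge0.
  have e1' : 1 - expR (- (a * lw j)) <= 1 by rewrite lerBlDr lerDl expR_ge0.
  have e2 : 0 <= 1 - expR (- (c * lw j * wt A)).
    by rewrite subr_ge0 -expR0 ler_expR oppr_le0 mulr_ge0.
  have e2' : 1 - expR (- (c * lw j * wt A)) <= 1 by rewrite lerBlDr lerDl expR_ge0.
  apply/andP; split; first by rewrite subr_ge0; apply: mulr_ile1.
  apply: le_trans (_ : expR (- ((1 - expR (- (c * lw j * wt A))) * (1 - expR (- (a * lw j))))) <= _).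
    exact: expR_ge1Dx.
  rewrite ler_expR lerN2.
  have -> : (1 - t) ^+ 2 * (c * w * a) * lw j ^+ 2 =
     (c * lw j * w * (1 - t)) * (a * lw j * (1 - t)) by ring.
  have h1 : a * lw j * (1 - t) <= 1 - expR (- (a * lw j)).
    apply: onem_expRN_ge; rewrite mulr_ge0 //=.
    by apply: (le_trans _ aphi); rewrite ler_wpM2l.
  (* Linearising at [w <= M] keeps the argument below [t]; [wt A], which also counts hubs, could be
     too large for this. *)
  have h2 : c * lw j * w * (1 - t) <= 1 - expR (- (c * lw j * wt A)).
    apply: (@le_trans _ _ (1 - expR (- (c * lw j * w)))).
      apply: onem_expRN_ge; rewrite mulr_ge0 //=.
      by apply: (le_trans _ cM); apply: ler_pM => //; rewrite ler_wpM2l.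
    by rewrite lerB // ler_expR lerN2 ler_wpM2l.
  by apply: ler_pM => //; rewrite !mulr_ge0 // subr_ge0.
rewrite -expR_sum ler_expR sumrN lerN2 -mulr_sumr.
apply: (@le_trans _ _ ((1 - t) ^+ 2 * (c * w * a) *
    (\sum_(j | low j) W j ^+ 2 - phim * M))).
  have -> : (1 - t) ^+ 2 * (c * w * a) * (\sum_(j | low j) W j ^+ 2 - phim * M) =
    (1 - t) ^+ 2 * (c * (\sum_(j | low j) W j ^+ 2 - phim * M)) * (w * a) by ring.
  by rewrite -mulrA [a * w]mulrC ler_wpM2r // mulr_ge0.
have c0' := ltW c0.
by rewrite ler_wpM2l ?low_mass // mulr_ge0 ?exprn_ge0 ?subr_ge0 // !mulr_ge0.
Qed.

(* Exponential supermartingale along the levels; the flag [b] restricts it to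
   explorations that are still alive. *)
Definition Psi (b : bool) (S : {set V}) (r : nat) (a : R) : R :=
  EE (fun s => ((lwt (bball (redge s) S r) < M) &&
                (b ==> ((bfs (redge s) S r).2 != finset.set0)))%:R *
     expR (- (a * lwt (bfs (redge s) S r).2))).

Lemma bool_sum_pair (T : finType) (P : pred T) (x : T) (f : T -> R) :
  \sum_(y | P y) (x == y)%:R * f y = if P x then f x else 0.
Proof.
case: ifP => Px.
  rewrite (bigD1 x) //= eqxx mul1r big1 ?addr0 // => y /andP[_].
  by rewrite eq_sym => /negbTE ->; rewrite mul0r.
rewrite big1 // => y Py; case: eqP => [xy|]; last by rewrite mul0r.
by rewrite xy Py in Px.
Qed.

(** Given the state (D, A), only pairs meeting D have been read, while the next level reads pairs
    between A and the outside. These coordinates are disjoint, so summing over all states plays the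
    role of conditioning. A small ball, or a nonempty level, at r + 1 implies the same at r, so the
    indicator can be relaxed. *)
Lemma Psi_step (b : bool) (S : {set V}) (r : nat) (a a' g : R) :
  (forall D A : {set V}, [disjoint D & A] -> lwt (D :|: A) < M ->
    (b -> A != finset.set0) ->
    EE (fun s => expR (- (a' * lwt (newset s A (D :|: A))))) <= g * expR (- (a * lwt A))) ->
  Psi b S r.+1 a' <= g * Psi b S r a.
Proof.
move=> step.
pose P (q : {set V} * {set V}) := [&& [disjoint q.1 & q.2], lwt (q.1 :|: q.2) < M &
  b ==> (q.2 != finset.set0)].
apply: (@le_trans _ _ (EE (fun s => \sum_(q | P q) (bfs (redge s) S r == q)%:R *
   expR (- (a' * lwt (newset s q.2 (q.1 :|: q.2))))))).
  apply: le_bmean => // s; rewrite bool_sum_pair /P bfs_disj /=.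
  case: (boolP (_ && _)) => [/andP[h1 h2]|_]; last first.
    by rewrite mul0r; case: ifP => // _; exact: expR_ge0.
  rewrite (le_lt_trans _ h1) ?lwtS ?bballS //= mul1r.
  suff -> : b ==> ((bfs (redge s) S r).2 != finset.set0) by [].
  by apply/implyP => bb; apply: (bfs_alive (e := redge s)); apply: (implyP h2).
rewrite bmean_sum.
apply: (@le_trans _ _ (\sum_(q | P q) EE (fun s => (bfs (redge s) S r == q)%:R) *
   (g * expR (- (a * lwt q.2))))).
  apply: ler_sum => -[D A] /and3P[/= dDA DM bA].
  rewrite (bmean_indep p (S := seg D [set: V]%SET) (S' := seg A (~: (D :|: A)))).
  - rewrite ler_wpM2l ?bmean_ge0 //.
    by apply: step => // bb; apply: (implyP bA).
  - rewrite disjoint_sym; apply: seg_disj => //.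
    rewrite finset.disjoints_subset finset.setCK; exact: finset.subsetUl.
  - exact: bfs_depends.
  - move=> s s' ss'; rewrite (_ : newset s A (D :|: A) = newset s' A (D :|: A)) //.
    apply/setP => j; rewrite !finset.inE; case: (boolP (_ || _)) => //= jDA.
    apply: eq_existsb => x; case: (boolP (x \in A)) => //= xA.
    rewrite /redge ss' //; apply/imset2P; exists x j => //.
    by rewrite !finset.inE.
rewrite /Psi -bmeanZl -(eq_bigr _ (fun q _ => mulrC _ _)).
rewrite -(eq_bigr _ (fun q _ => bmeanZl _ _ _)) -bmean_sum.
apply: le_bmean => // s.
rewrite (eq_bigr (fun q => (bfs (redge s) S r == q)%:R * (g * expR (- (a * lwt q.2))))).
  2: by move=> q _; rewrite mulrC.
rewrite bool_sum_pair /P bfs_disj /= -/(bball _ _ _).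
by case: (_ && _); rewrite ?mul1r ?mul0r ?mulr0.
Qed.

(** A nonempty level has weight at least 1, so (1 + d) max(1, weight) is at least the weight plus d:
    every level survived with a small ball gains a factor exp(-a d). *)
Lemma phase_alive (S : {set V}) (a d : R) (r : nat) : K = 1 + d -> 0 <= d -> 1 <= M ->
  0 <= a -> a * phim <= t -> Psi true S r a <= expR (- (a * d * r%:R)).
Proof.
move=> Kd d0 M1 a0 aphi; elim: r => [|r IH].
  rewrite mulr0 oppr0 expR0 -(bmean1 p); apply: le_bmean => // s.
  case: (_ && _); rewrite ?mul0r // mul1r -expR0 ler_expR oppr_le0 mulr_ge0 ?lwt_ge0 //.
apply: (@le_trans _ _ (expR (- (a * d)) * Psi true S r a)); last first.
  by rewrite -natr1 mulrDr mulr1 opprD addrC expRD ler_wpM2l ?expR_ge0.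
apply: Psi_step => D A dDA DAM /(_ isT) A0.
have AM : lwt A <= M.
  by rewrite (le_trans _ (ltW DAM)) // lwtS // finset.subsetUr.
(* The value 1 matters when the level contains no low vertex: [lwt A] is then 0, but [wt A] is still
   at least 1. *)
have w1 : 1 <= Num.max 1 (lwt A) by rewrite le_max lexx.
apply: (le_trans (step_bound (w := Num.max 1 (lwt A)) _ _ a0 aphi _ _)).
- exact: finset.subsetUr.
- exact: ltW.
- by rewrite (le_trans ler01) //= ge_max M1.
- by rewrite ge_max wt_ge1 //= lwt_le.
rewrite -expRD ler_expR Kd -opprD lerN2 mulrDl mul1r mulrDl addrC lerD //.
  by rewrite ler_wpM2l // le_max lexx orbT.
by rewrite [a * d]mulrC -[leLHS]mulr1 ler_wpM2l ?mulr_ge0.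
Qed.

(* Dividing the exponent by [K] at each level turns the factor gained in
   [step_bound] into growth of the weight by [K] per level. *)
Lemma phase_growth (b : bool) (S : {set V}) (a : R) (r s : nat) : 1 <= K ->
  0 <= a -> a * phim <= t -> Psi b S (s + r) (a / K ^+ s) <= Psi b S r a.
Proof.
move=> K1 a0 aphi; elim: s => [|s IH]; first by rewrite add0n expr0 divr1.
have K0 : 0 < K by exact: lt_le_trans K1.
apply: le_trans IH; rewrite -[leRHS]mul1r addSn; apply: Psi_step => D A dDA DAM _.
have AM : lwt A <= M.
  by rewrite (le_trans _ (ltW DAM)) // lwtS // finset.subsetUr.
apply: (le_trans (step_bound (w := lwt A) _ _ _ _ _ _)).
- exact: finset.subsetUr.
- exact: ltW.
- by rewrite divr_ge0 // exprn_ge0 // ltW.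
- rewrite (le_trans _ aphi) // ler_wpM2r // ler_pdivrMr ?exprn_gt0 //.
  by rewrite ler_peMr // exprn_ege1.
- by rewrite lwt_ge0.
- exact: lwt_le.
rewrite mul1r ler_expR lerN2.
suff -> : K * (a / K ^+ s.+1) = a / K ^+ s by [].
have Kn : K != 0 by rewrite gt_eqF.
have Ksn : K ^+ s != 0 by rewrite expf_neq0.
by rewrite exprS; field; rewrite Kn Ksn.
Qed.

(** Markov's inequality: a ball of low weight below M has a last level of low weight below M, where
    the exponential is at least 1/e once a M <= 1. *)
Lemma Psi_finish (b : bool) (S : {set V}) (r : nat) (a : R) : 0 <= a -> a * M <= 1 ->
  EE (fun s => ((lwt (bball (redge s) S r) < M) &&
                (b ==> ((bfs (redge s) S r).2 != finset.set0)))%:R) <=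
  expR 1 * Psi b S r a.
Proof.
move=> a0 aM; rewrite /Psi -bmeanZl; apply: le_bmean => // s.
case: (boolP (lwt _ < M)) => //= bM; last by rewrite mul0r mulr0.
case: (b ==> _); last by rewrite mul0r mulr0.
rewrite mul1r -expRD -[leLHS]expR0 ler_expR subr_ge0.
apply: (le_trans _ aM); rewrite ler_wpM2l // (le_trans _ (ltW bM)) //.
by rewrite lwtS // finset.subsetUr.
Qed.

(** The first r levels, at the fixed parameter a, make survival with a small ball exponentially
    unlikely. The next s levels preserve this bound while they lower the parameter to a / K^s, small
    enough for [Psi_finish]. *)
Lemma exploration_alive (S : {set V}) (a d : R) (r s : nat) :
  K = 1 + d -> 0 <= d -> 1 <= M -> 0 <= a -> a * phim <= t -> a * M <= K ^+ s ->
  EE (fun w => ((lwt (bball (redge w) S (s + r)) < M) &&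
                ((bfs (redge w) S (s + r)).2 != finset.set0))%:R) <=
  expR (1 - a * d * r%:R).
Proof.
move=> Kd d0 M1 a0 aphi aM.
have K1 : 1 <= K by rewrite Kd lerDl.
have Ks : 0 < K ^+ s by rewrite exprn_gt0 // (lt_le_trans ltr01).
apply: (le_trans (@Psi_finish true _ _ (a / K ^+ s) _ _)).
- by rewrite divr_ge0 // ltW.
- by rewrite mulrAC ler_pdivrMr // mul1r.
rewrite expRD ler_wpM2l ?expR_ge0 //.
exact: le_trans (phase_growth _ _ _ _ _ _ _) (phase_alive _ _ _ _ _ _ _).
Qed.

(** The starting weight w already gives exp(-a w) after one level, so survival need not be assumed:
    a start that heavy cannot die out unnoticed. *)
Lemma exploration_heavy (S : {set V}) (a w : R) (s : nat) :
  1 <= K -> 0 <= a -> a * phim <= t -> a * M <= K ^+ s -> 0 <= w <= M ->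
  lwt S <= M -> w <= wt S ->
  EE (fun g => (lwt (bball (redge g) S s.+1) < M)%R%:R) <= expR (1 - a * w).
Proof.
move=> K1 a0 aphi aM w0M SM wS.
have Ks : 0 < K ^+ s by rewrite exprn_gt0 // (lt_le_trans ltr01).
have := @Psi_finish false S (s + 1) (a / K ^+ s).
rewrite addn1 => h; apply: (le_trans (le_trans _ (h _ _))).
- by apply: le_bmean => // g; rewrite andbT.
- by rewrite divr_ge0 // ltW.
- by rewrite mulrAC ler_pdivrMr // mul1r.
rewrite expRD ler_wpM2l ?expR_ge0 // -addn1.
apply: (le_trans (phase_growth _ _ _ _ _ _ _)) => //.
(* Level 1 is estimated from the full weight of S; at level 0 only [lwt S] would be visible, and it
   is 0 when S is a single hub. *)
apply: (@le_trans _ _ (EE (fun g => expR (- (a * lwt (newset g S S)))))).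
  apply: le_bmean => // g; rewrite bstep_newset /= finset.set0U.
  by case: (_ && _); rewrite ?mul1r // mul0r expR_ge0.
apply: (le_trans (step_bound (w := w) _ _ _ _ _ _)) => //.
rewrite ler_expR lerN2 -mulrA ler_peMl // mulr_ge0 //.
by case/andP: w0M.
Qed.

(* Given two explorations with disjoint balls, the edges between their current
   levels have not been revealed yet. *)
Lemma no_bridge (S1 S2 : {set V}) (r1 r2 : nat) (m : R) : 0 <= m ->
  EE (fun w => [&& [disjoint bball (redge w) S1 r1 & bball (redge w) S2 r2],
     m <= lwt (bfs (redge w) S1 r1).2, m <= lwt (bfs (redge w) S2 r2).2 &
     ~~ [exists x in (bfs (redge w) S1 r1).2, exists y in (bfs (redge w) S2 r2).2,
          redge w x y]]%:R) <= expR (- (c * m ^+ 2)).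
Proof.
move=> m0.
pose P (q : ({set V} * {set V}) * ({set V} * {set V})) :=
  [&& [disjoint q.1.1 & q.1.2], [disjoint q.2.1 & q.2.2],
   [disjoint q.1.1 :|: q.1.2 & q.2.1 :|: q.2.2], m <= lwt q.1.2 & m <= lwt q.2.2].
pose I (q : ({set V} * {set V}) * ({set V} * {set V})) w : R :=
  (bfs (redge w) S1 r1 == q.1)%:R * (bfs (redge w) S2 r2 == q.2)%:R.
have sumI w (f : ({set V} * {set V}) * ({set V} * {set V}) -> R) :
    \sum_(q | P q) I q w * f q =
    if P (bfs (redge w) S1 r1, bfs (redge w) S2 r2)
    then f (bfs (redge w) S1 r1, bfs (redge w) S2 r2) else 0.
  rewrite -bool_sum_pair; apply: eq_bigr => -[q1 q2] _; congr (_ * _).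
  by rewrite /I /= xpair_eqE; case: eqP; case: eqP; rewrite /= ?mul0r ?mulr0 ?mul1r.
(* Only low y are tested: they are not hubs, as [missed] requires, and they carry all of the weight
   [lwt] of the second level. *)
pose N (q : ({set V} * {set V}) * ({set V} * {set V})) w : R :=
  \prod_(y in [set y in q.2.2 | low y]) (~~ [exists x in q.1.2, redge w x y])%:R.
apply: (@le_trans _ _ (EE (fun w => \sum_(q | P q) I q w * N q w))).
  apply: le_bmean => // w; rewrite sumI /P !bfs_disj /= -/(bball _ _ _) -/(bball _ _ _).
  rewrite andbA andbA -[[disjoint _ & _] && _ && _]andbA; case: (boolP (_ && (_ && _))) => //= _.
  case: (boolP (~~ _)) => [ne|_]; last by rewrite prodr_ge0.
  rewrite /N big1 // => y; rewrite finset.inE => /andP[yA _].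
  case: (boolP [exists x in _, _]) => // /existsP[x /andP[xA exy]].
  case/negP: ne; apply/existsP; exists x; rewrite xA /=.
  by apply/existsP; exists y; rewrite yA.
rewrite bmean_sum.
apply: (@le_trans _ _ (\sum_(q | P q) expR (- (c * m ^+ 2)) * EE (I q))); last first.
  rewrite -mulr_sumr -[leRHS]mulr1 ler_wpM2l ?expR_ge0 // -bmean_sum -(bmean1 p).
  apply: le_bmean => // w.
  rewrite (eq_bigr (fun q => I q w * 1)) => [|q _]; last by rewrite mulr1.
  by rewrite sumI; case: ifP.
apply: ler_sum => -[[D1 A1] [D2 A2]] /and5P[/= d1 d2 d12 m1 m2].
have dW (X X' Y Y' : {set V}) : X \subset X' -> Y \subset Y' ->
    [disjoint X' & Y'] -> [disjoint X & Y].
  by move=> XX YY /(fintype.disjointWl XX); apply: fintype.disjointWr.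
have dAA : [disjoint A1 & A2].
  by apply: dW d12; exact: finset.subsetUr.
have dD1A2 : [disjoint D1 & A2].
  by apply: dW d12; [exact: finset.subsetUl|exact: finset.subsetUr].
have dD2A1 : [disjoint D2 & A1].
  rewrite disjoint_sym.
  by apply: dW d12; [exact: finset.subsetUr|exact: finset.subsetUl].
rewrite (bmean_indep p (S := seg (D1 :|: D2) [set: V]%SET) (S' := seg A1 A2)).
- rewrite mulrC ler_wpM2r ?bmean_ge0 //; first by move=> w; rewrite /I mulr_ge0.
  rewrite /N /=.
  rewrite (bmean_prod_indep p (S := fun y => seg A1 [set y])).
  + rewrite (eq_bigr (fun y => expR (- (c * lw y * wt A1)))) => [|y]; last first.
      rewrite finset.inE => /andP[yA ly].
      rewrite (@missed _ A1 y) ?low_hub //; first by rewrite /lw ly.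
      by rewrite (disjointFl dAA yA).
    rewrite -expR_sum sumrN ler_expR lerN2 expr2 -mulr_suml -mulr_sumr -mulrA.
    rewrite ler_wpM2l ?(ltW c0) // ler_pM //; last exact: le_trans (lwt_le _).
    apply: (le_trans m2); rewrite /lwt big_mkcond [leRHS]big_mkcond /=.
    apply: ler_sum => y _; rewrite finset.inE; case: (y \in A2) => //=.
    by rewrite /lw; case: ifP.
  + move=> y _ w w' ww'; congr ((nat_of_bool (~~ _))%:R); apply: eq_existsb => x.
    case: (boolP (x \in A1)) => //= xA; apply: redge_depends => e.
    rewrite finset.inE => /eqP ->; apply: ww'.
    by apply/imset2P; exists x y => //; rewrite finset.inE.
  + move=> i j; rewrite !finset.inE => /andP[iA _] /andP[jA _] ij.
    rewrite -setI_eq0; apply/eqP/setP => e; rewrite !finset.inE.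
    apply/negP => /andP[/imset2P[x y xA + ->] /imset2P[x' y' xA' +]].
    rewrite !finset.inE => /eqP -> /eqP -> /cd_inj[[_ h]|[_ h]]; first by rewrite h eqxx in ij.
    by rewrite h (disjointFr dAA xA') in iA.
- rewrite disjoint_sym; apply: seg_disj.
    by rewrite -setI_eq0 finset.setIUl finset.setU_eq0 !setI_eq0 d1 dD2A1.
  by rewrite -setI_eq0 finset.setIUl finset.setU_eq0 !setI_eq0 dD1A2 d2.
- move=> w w' ww'; rewrite /I; congr (_ * _); apply: bfs_depends => e eS; apply: ww'.
    by case/imset2P: eS => x y xD _ ->; apply/imset2P; exists x y; rewrite // finset.inE xD.
  by case/imset2P: eS => x y xD _ ->; apply/imset2P; exists x y; rewrite // finset.inE xD orbT.
- move=> w w' ww'; apply: eq_bigr => y; rewrite finset.inE => /andP[yA _].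
  congr ((nat_of_bool (~~ _))%:R); apply: eq_existsb => x.
  case: (boolP (x \in A1)) => //= xA; apply: redge_depends => e.
  by rewrite finset.inE => /eqP ->; apply: ww'; apply/imset2P; exists x y.
Qed.

End RandomExploration.

(** * Finite Markov semigroups *)

Section FiniteSemigroup.
Variables (R : realType) (S : finType) (Q : R -> S -> S -> R).
Variable L : (S -> R) -> S -> R.
Hypothesis Qsemi : markov_semigroup Q.
Hypothesis Qgen : has_generator Q L.

Definition act (f : S -> R) (t : R) (x : S) : R := \sum_y Q t x y * f y.

Lemma act0 f x : act f 0 x = f x.
Proof.
case: Qsemi => _ _ Q0 _; rewrite /act (bigD1 x) //= Q0 eqxx mul1r big1 ?addr0 // => y yx.
by rewrite Q0 eq_sym (negbTE yx) mul0r.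
Qed.

Lemma actD f s t x : 0 <= s -> 0 <= t -> act f (s + t) x = act (act f t) s x.
Proof.
case: Qsemi => _ _ _ Qs s0 t0; rewrite /act.
under eq_bigr do rewrite Qs // mulr_suml.
rewrite exchange_big; apply: eq_bigr => z _; rewrite mulr_sumr.
by apply: eq_bigr => y _; rewrite mulrA.
Qed.

Lemma act_lin (I : finType) (c : I -> R) (F : I -> S -> R) t x :
  act (fun y => \sum_i c i * F i y) t x = \sum_i c i * act (F i) t x.
Proof.
rewrite /act; under eq_bigr do rewrite mulr_sumr.
rewrite exchange_big; apply: eq_bigr => i _; rewrite mulr_sumr.
by apply: eq_bigr => y _; rewrite mulrCA.
Qed.

Lemma le_act f f' t x : 0 <= t -> (forall y, f y <= f' y) -> act f t x <= act f' t x.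
Proof.
case: Qsemi => Q0 _ _ _ t0 ff; rewrite /act; apply: ler_sum => y _.
by rewrite ler_wpM2l ?Q0.
Qed.

Lemma act_cst k t x : 0 <= t -> act (fun=> k) t x = k.
Proof. by case: Qsemi => _ Q1 _ _ t0; rewrite /act -mulr_suml Q1 // mul1r. Qed.

(** There are finitely many functions and states, so the derivative at 0 is uniform over them. *)
Lemma generator_approx (I : finType) (F : I -> S -> R) (e : R) : 0 < e ->
  exists2 d : R, 0 < d & forall s i x, 0 < s <= d ->
    `|act (F i) s x - F i x - s * L (F i) x| <= e * s.
Proof.
move=> e0.
have H : (\forall s \near 0^'+, forall ix : I * S,
    `|act (F ix.1) s ix.2 - F ix.1 ix.2 - s * L (F ix.1) ix.2| <= e * s)%classic.
  apply: filter_forall => -[i x] /=; set f := F i.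
  have /cvgrPdist_le /(_ e e0) := @Qgen f x.
  apply: filter_app; near=> s => h.
  have s0 : 0 < s by near: s; exact: nbhs_right_gt.
  have -> : act f s x - f x - s * L f x = - (s * (L f x - (act f s x - f x) / s)).
    by field; rewrite gt_eqF.
  by rewrite normrN normrM gtr0_norm // mulrC ler_pM2r.
case: H => d d0 h; exists (d / 2); first by rewrite divr_gt0.
move=> s i x /andP[s0 sd]; apply: (h s _ _ (i, x)) => //=.
rewrite sub0r normrN gtr0_norm //; apply: le_lt_trans sd _.
by rewrite ltr_pdivrMr // ltr_pMr // ltr1n.
Unshelve. all: by end_near.
Qed.

(** The second hypothesis holds when F is nonnegative and also when c = 0. The latter case, with F
    of any sign, is the one needed in [act_ge]. *)
Lemma discrete_gronwall (F : R -> R) (c : R) : 0 <= c ->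
  (forall s t, 0 <= s -> 0 <= t -> (1 - c * s) * F t <= expR (- (c * s)) * F t) ->
  (forall e, 0 < e -> exists2 d, 0 < d &
     forall s t, 0 < s <= d -> 0 <= t -> F (t + s) <= (1 - c * s) * F t + e * s) ->
  forall t, 0 <= t -> F t <= expR (- (c * t)) * F 0.
Proof.
move=> c0 F0 HF t t0; apply/ler_addgt0Pr => e e0.
move: t0; rewrite le_eqVlt => /predU1P[<-|t0].
  by rewrite mulr0 oppr0 expR0 mul1r lerDl ltW.
have et0 : 0 < e / t by rewrite divr_gt0.
have [d d0 {}HF] := HF _ et0.
pose n := (Num.trunc (t / d)).+1.
(* The mesh is at most d, and the n errors (e / t) s add up to e. *)
pose s := t / n%:R.
have n0 : 0 < n%:R :> R by rewrite ltr0n.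
have s0 : 0 < s by rewrite divr_gt0.
have sd : s <= d.
  by rewrite /s ler_pdivrMr // mulrC -ler_pdivrMr //; apply/ltW/truncnS_gt.
suff H k : (k <= n)%N ->
    F (k%:R * s) <= expR (- (c * (k%:R * s))) * F 0 + (e / t) * (k%:R * s).
  have := H _ (leqnn n); have -> : n%:R * s = t by rewrite /s mulrC divfK // gt_eqF.
  by rewrite divfK // gt_eqF.
elim: k => [_|k IH kn].
  by rewrite mul0r !mulr0 oppr0 expR0 mul1r addr0.
have ks : 0 <= k%:R * s by rewrite mulr_ge0 // ltW.
have -> : k.+1%:R * s = k%:R * s + s by rewrite -natr1 mulrDl mul1r.
apply: le_trans (HF s _ _ ks) _; first by rewrite s0 sd.
rewrite [e / t * (_ + _)]mulrDr addrA lerD2r.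
apply: le_trans (F0 _ _ (ltW s0) ks) _.
apply: (le_trans (ler_wpM2l (expR_ge0 _) (IH (ltnW kn)))).
rewrite mulrDr mulrA -expRD -opprD -mulrDr [s + _]addrC lerD2l.
have h0 : 0 <= e / t * (k%:R * s) by apply: mulr_ge0 => //; exact: ltW.
by rewrite ler_piMl // -[leRHS]expR0 ler_expR oppr_le0 mulr_ge0 // ltW.
Qed.

(** The estimate at time 0 is transported to time t by the semigroup, which averages and so
    preserves a uniform error. *)
Lemma act_step (I : finType) (F : I -> S -> R) (e : R) : 0 < e ->
  exists2 d : R, 0 < d & forall s t i x, 0 < s <= d -> 0 <= t ->
    `|act (F i) (t + s) x - act (F i) t x - s * act (L (F i)) t x| <= e * s.
Proof.
move=> e0; have [d d0 H] := generator_approx F e0; exists d => // s t i x sd t0.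
have /andP[/ltW s0 _] := sd.
have -> : act (F i) (t + s) x - act (F i) t x - s * act (L (F i)) t x =
    act (fun y => act (F i) s y - F i y - s * L (F i) y) t x.
  rewrite actD // /act mulr_sumr -!sumrB; apply: eq_bigr => y _.
  by rewrite !mulrBr; congr (_ - _); rewrite mulrCA.
rewrite ler_norml -{1}(act_cst (- (e * s)) x t0) -[X in _ && (_ <= X)](act_cst (e * s) x t0).
by apply/andP; split; apply: le_act => // y; have := H s i y sd; rewrite ler_norml => /andP[].
Qed.

(** One half of Dynkin's formula, from [discrete_gronwall] with rate 0 applied to the negative of
    [act f t x + c * t]. *)
Lemma act_ge (f : S -> R) (c : R) : (forall x, - c <= L f x) ->
  forall t x, 0 <= t -> f x - c * t <= act f t x.
Proof.
move=> Lc t x t0.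
pose F (t : R) := - (act f t x + c * t).
suff : F t <= expR (- (0 * t)) * F 0.
  by rewrite /F mul0r oppr0 expR0 mul1r act0 mulr0 addr0 lerN2 lerBlDr.
apply: discrete_gronwall t t0 => // [s t _ _|e e0].
  by rewrite !mul0r subr0 oppr0 expR0.
have [d d0 H] := generator_approx (fun _ : unit => f) e0; exists d => // s t /andP[s0 sd] t0.
have s0' := ltW s0; rewrite mul0r subr0 mul1r /F actD //.
suff : act f t x - c * s - e * s <= act (act f s) t x by lra.
have -> : act f t x - c * s - e * s = act (fun y => f y - c * s - e * s) t x.
  have := act_lin (fun b : bool => if b then 1 else - (c * s + e * s))
     (fun b => if b then f else fun=> 1) t x.
  rewrite big_bool /= mul1r act_cst // mulr1 => h.
  rewrite -addrA -opprD -h /act; apply: eq_bigr => y _.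
  by rewrite big_bool /= mul1r mulr1 -addrA opprD.
apply: le_act => // y.
have := H s tt y; rewrite s0 sd => /(_ isT); rewrite ler_norml => /andP[h _].
have := ler_wpM2l (ltW s0) (Lc y); lra.
Qed.

End FiniteSemigroup.

(** * Contraction of the voter model *)

Section VoterRates.
Variables (R : realType) (V : finType) (theta : R) (g : sgraph V).

Lemma adjrel_sym i j : adjrel g i j = adjrel g j i.
Proof. by have /andP[_ /'forall_forallP/(_ i j)/eqP] := adjP g. Qed.

Definition half_rate (i j : V) : R :=
  if adjrel g i j then 2^-1 * ((degree g i)%:R `^ theta * (degree g i)%:R^-1) else 0.

(** The rate at which i adopts the opinion of j. An activated pair is resolved in either direction
    with probability 1/2, which makes the total symmetric although [half_rate] is not. *)
Definition rate (i j : V) : R := half_rate i j + half_rate j i.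

Lemma half_rate_ge0 i j : 0 <= half_rate i j.
Proof.
by rewrite /half_rate; case: ifP.
Qed.

Lemma rate_ge0 i j : 0 <= rate i j.
Proof. by rewrite addr_ge0 ?half_rate_ge0. Qed.

Lemma rateC i j : rate i j = rate j i.
Proof. by rewrite /rate addrC. Qed.

Lemma rate_nadj i j : ~~ adjrel g i j -> rate i j = 0.
Proof.
by move=> h; rewrite /rate /half_rate (adjrel_sym j i) (negbTE h) addr0.
Qed.

Lemma voter_generatorE (f : config V -> R) (x : config V) :
  voter_generator theta g f x = \sum_i \sum_j rate i j * (f (copy x i j) - f x).
Proof.
have -> : \sum_i \sum_j rate i j * (f (copy x i j) - f x) =
  \sum_i \sum_j half_rate i j * ((f (copy x j i) - f x) + (f (copy x i j) - f x)).
  under eq_bigr do under eq_bigr do rewrite mulrDl.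
  under eq_bigr do rewrite big_split /=.
  rewrite big_split /= [X in _ + X]exchange_big /= addrC -big_split; apply: eq_bigr => i _ /=.
  by rewrite -[LHS]big_split; apply: eq_bigr => j _ /=; rewrite -mulrDr.
rewrite /voter_generator; apply: eq_bigr => i _; rewrite mulr_sumr big_mkcond /=.
apply: eq_bigr => j _; rewrite /half_rate; case: ifP; rewrite ?mul0r // => _.
by lra.
Qed.

Definition disagree (a b : V) (x : config V) : R := (x a != x b)%:R.

Lemma disagreeC a b x : disagree a b x = disagree b a x.
Proof. by rewrite /disagree eq_sym. Qed.

(** An update changes one vertex only, so for a <> b the pair evolves like two independent walks. At
    a = b the left side is 0 while the right side need not be: this is the killing on the
    diagonal. *)
Lemma disagree_gen (a b : V) (x : config V) : a != b ->
  voter_generator theta g (disagree a b) x =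
  \sum_j rate a j * (disagree j b x - disagree a b x) +
  \sum_j rate b j * (disagree a j x - disagree a b x).
Proof.
move=> ab; rewrite voter_generatorE (bigD1 a) //= [X in _ + X](bigD1 b) 1?eq_sym //=.
rewrite [X in _ + (_ + X)]big1 ?addr0 => [|i /andP[ia ib]]; last first.
  apply: big1 => j _; rewrite /disagree /copy !ffunE.
  by rewrite [a == i]eq_sym [b == i]eq_sym (negbTE ia) (negbTE ib) subrr mulr0.
congr (_ + _); apply: eq_bigr => j _; rewrite /disagree /copy !ffunE eqxx.
  by rewrite [b == a]eq_sym (negbTE ab).
by rewrite (negbTE ab).
Qed.

Lemma disagree_same a x : disagree a a x = 0.
Proof. by rewrite /disagree eqxx. Qed.

Lemma voter_gen_sum (I : finType) (P : pred I) (F : I -> config V -> R) x :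
  voter_generator theta g (fun y => \sum_(i | P i) F i y) x =
  \sum_(i | P i) voter_generator theta g (F i) x.
Proof.
under [RHS]eq_bigr do rewrite voter_generatorE.
rewrite voter_generatorE [RHS]exchange_big; apply: eq_bigr => i _ /=.
rewrite [RHS]exchange_big; apply: eq_bigr => j _ /=.
by rewrite -sumrB mulr_sumr.
Qed.

Definition conn (a b : V) : bool := connect (adjrel g) a b.

Lemma conn_sym a b : conn a b = conn b a.
Proof. exact: (sym_connect_sym adjrel_sym). Qed.

Lemma conn_trans a b c : conn a b -> conn b c -> conn a c.
Proof. exact: connect_trans. Qed.

Lemma consensusP (x : config V) :
  consensus g x <-> forall a b, conn a b -> x a = x b.
Proof.
have eqv : {in [set: V]%SET & &, equivalence_rel conn}.
  move=> a b c _ _ _; split; first exact: connect0.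
  by move=> ab; apply/idP/idP; apply: conn_trans => //; rewrite conn_sym.
have /and3P[/eqP cov triv _] := equivalence_partitionP eqv.
split=> [cons a b ab|h A Acomp a b aA bA].
  apply: (cons (finset.pblock (components g) a) _ a b).
  - by apply: finset.pblock_mem; rewrite cov finset.inE.
  - by rewrite finset.mem_pblock cov finset.inE.
  - by rewrite pblock_equivalence_partition ?finset.inE.
apply: h; rewrite -(pblock_equivalence_partition eqv) ?finset.inE //.
by rewrite (finset.def_pblock triv Acomp aA).
Qed.

(** This one observable serves both bounds: it is at least 1 before consensus, so its mean dominates
    the probability of no consensus; it is 0 at consensus and at most the number of ordered pairs,
    so a large mean forces that probability up. *)
Definition noncons (x : config V) : R := \sum_(q : V * V | conn q.1 q.2) disagree q.1 q.2 x.

Lemma noncons_ge1 x : ~ consensus g x -> 1 <= noncons x.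
Proof.
move=> nc; have [[a b] /= ab xab] : exists2 q : V * V, conn q.1 q.2 & x q.1 != x q.2.
  apply: contrapT => h; apply: nc; apply/consensusP => a b ab.
  by apply/eqP; apply: contrapT => /negP xab; apply: h; exists (a, b).
rewrite /noncons (bigD1 (a, b)) //= /disagree xab lerDl sumr_ge0 //.
Qed.

Lemma noncons_eq0 x : consensus g x -> noncons x = 0.
Proof.
by move/consensusP => h; rewrite /noncons big1 // => -[a b] /= /h; rewrite /disagree => ->; rewrite eqxx.
Qed.

Lemma noncons_ge0 x : 0 <= noncons x.
Proof. by apply: sumr_ge0 => q _; rewrite /disagree. Qed.

End VoterRates.

Section Contraction.
Variables (R : realType) (V : finType).

Lemma path_increment (e : rel V) (f : V -> R) (D : R) (a : V) (q : seq V) :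
  (forall i j, e i j -> `|f j - f i| <= D) -> path e a q ->
  `|f (last a q) - f a| <= (size q)%:R * D.
Proof.
move=> eD; elim: q a => [|b q IH] a /=; first by rewrite subrr normr0 mul0r.
case/andP => /eD ab /IH bq.
rewrite -natr1 mulrDl mul1r (_ : f (last b q) - f a = (f (last b q) - f b) + (f b - f a)).
  exact: le_trans (ler_normD _ _) (lerD _ _).
by ring.
Qed.

Lemma dirichlet_form (r : V -> V -> R) (u : V -> R) : (forall i j, r i j = r j i) ->
  \sum_i u i * (\sum_j r i j * (u j - u i)) =
  - (2^-1 * \sum_i \sum_j r i j * (u j - u i) ^+ 2).
Proof.
move=> rC.
have E1 : \sum_i u i * (\sum_j r i j * (u j - u i)) = \sum_i \sum_j r i j * (u i * (u j - u i)).
  by apply: eq_bigr => i _; rewrite mulr_sumr; apply: eq_bigr => j _; rewrite mulrCA.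
have E2 : \sum_i \sum_j r i j * (u i * (u j - u i)) = \sum_i \sum_j r i j * (u j * (u i - u j)).
  by rewrite exchange_big; apply: eq_bigr => i _; apply: eq_bigr => j _; rewrite rC.
have E3 : \sum_i \sum_j r i j * (u j - u i) ^+ 2 =
    - (\sum_i \sum_j r i j * (u i * (u j - u i))) - (\sum_i \sum_j r i j * (u j * (u i - u j))).
  rewrite -opprD -[X in - X]big_split -sumrN; apply: eq_bigr => i _ /=.
  rewrite -big_split -sumrN; apply: eq_bigr => j _ /=; ring.
by rewrite E3 -E2 E1; lra.
Qed.

Variables (theta : R) (g : sgraph V) (kappa : R) (e : rel V) (k : nat).
Hypothesis kappa0 : 0 < kappa.
Hypothesis e_rate : forall i j, e i j -> kappa <= rate theta g i j.
Hypothesis e_walk : forall a b, conn g a b ->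
  exists q : seq V, [/\ path e a q, (size q <= k)%N & last a q = b].

Local Notation r := (rate theta g).

Definition energy (f : V -> R) := \sum_i \sum_j r i j * (f j - f i) ^+ 2.

Lemma energy_ge0 f : 0 <= energy f.
Proof.
by apply: sumr_ge0 => i _; apply: sumr_ge0 => j _; rewrite mulr_ge0 ?rate_ge0 ?sqr_ge0.
Qed.

Lemma energy_edge f i j : r i j * (f j - f i) ^+ 2 <= energy f.
Proof.
have P i' j' : 0 <= r i' j' * (f j' - f i') ^+ 2 by rewrite mulr_ge0 ?rate_ge0 ?sqr_ge0.
rewrite /energy (bigD1 i) //= (bigD1 j) //= -addrA lerDl addr_ge0 //.
  exact: sumr_ge0.
by apply: sumr_ge0 => i' _; apply: sumr_ge0.
Qed.

(** The values of f are telescoped along a walk from a to the zero b. Bounding each increment by the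
    total energy costs a factor k compared with Cauchy-Schwarz, but lets the walk repeat edges. *)
Lemma poincare_point (f : V -> R) a b : f b = 0 -> conn g a b ->
  kappa * f a ^+ 2 <= k%:R ^+ 2 * energy f.
Proof.
move=> fb /e_walk[q [pq qk lq]].
have D0 : 0 <= energy f / kappa by rewrite divr_ge0 ?energy_ge0 // ltW.
have {}H : `|f a| <= (size q)%:R * Num.sqrt (energy f / kappa).
  have := @path_increment e f (Num.sqrt (energy f / kappa)) a q _ pq.
  rewrite lq fb sub0r normrN; apply => i j eij.
  rewrite -sqrtr_sqr ler_sqrt // ler_pdivlMr // mulrC.
  apply: (le_trans _ (energy_edge f i j)).
  by rewrite ler_wpM2r ?sqr_ge0 // e_rate.
have {}H : `|f a| <= k%:R * Num.sqrt (energy f / kappa).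
  by apply: le_trans H _; rewrite ler_wpM2r ?sqrtr_ge0 // ler_nat.
have := @lerXn2r R 2 `|f a| (k%:R * Num.sqrt (energy f / kappa)).
rewrite !nnegrE normr_ge0 mulr_ge0 ?sqrtr_ge0 // => /(_ isT isT H).
rewrite real_normK ?num_real // exprMn sqr_sqrtr // mulrA ler_pdivlMr //.
by rewrite mulrC.
Qed.

Variables (Q : R -> config V -> config V -> R).
Hypothesis Qsemi : markov_semigroup Q.
Hypothesis Qgen : has_generator Q (voter_generator theta g).
Variable x : config V.

Local Notation n := (#|V|%:R : R).

(** The value 0 for unconnected pairs lets all sums run over V; no rate joins two components, so the
    evolution is unaffected. *)
Definition disc (t : R) (a b : V) : R := if conn g a b then act Q (disagree R a b) t x else 0.

Lemma disc01 t a b : 0 <= t -> 0 <= disc t a b <= 1.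
Proof.
move=> t0; rewrite /disc; case: ifP => _; last by rewrite lexx ler01.
rewrite -{1}(act_cst Qsemi 0 x t0) -[X in _ && (_ <= X)](act_cst Qsemi 1 x t0).
by apply/andP; split; apply: (le_act Qsemi) => // y; rewrite /disagree; case: (_ != _).
Qed.

Lemma disc_same t a : disc t a a = 0.
Proof.
rewrite /disc; case: ifP => // _; rewrite /act big1 // => y _.
by rewrite disagree_same mulr0.
Qed.

Lemma discC t a b : disc t a b = disc t b a.
Proof.
rewrite /disc conn_sym; case: ifP => // _; apply: eq_bigr => y _.
by rewrite disagreeC.
Qed.

(** On the diagonal this is not the derivative of [disc], which stays 0 there, but only products of
    [flow] with [disc] are used. *)
Definition flow (t : R) (a b : V) : R :=
  \sum_j r a j * (disc t j b - disc t a b) + \sum_j r b j * (disc t a j - disc t a b).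

Lemma flow_gen t a b : conn g a b -> a != b ->
  act Q (voter_generator theta g (disagree R a b)) t x = flow t a b.
Proof.
move=> ab nab.
have -> : voter_generator theta g (disagree R a b) =
  fun y => \sum_j r a j * (disagree R j b y - disagree R a b y) +
           \sum_j r b j * (disagree R a j y - disagree R a b y).
  by apply/funext => y; rewrite disagree_gen.
have A1 i (F : V -> config V -> R) :
    act Q (fun y => \sum_j r i j * (F j y - disagree R a b y)) t x =
    \sum_j r i j * (act Q (F j) t x - disc t a b).
  rewrite (act_lin Q (r i) (fun j y => F j y - disagree R a b y)); apply: eq_bigr => j _.
  congr (_ * _); rewrite /disc ab /act -sumrB; apply: eq_bigr => y _.
  by rewrite mulrBr.
transitivity (\sum_j r a j * (act Q (disagree R j b) t x - disc t a b) +
  \sum_j r b j * (act Q (disagree R a j) t x - disc t a b)).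
  rewrite -!A1 /act -big_split; apply: eq_bigr => y _ /=.
  by rewrite mulrDr.
rewrite /flow; congr (_ + _); apply: eq_bigr => j _.
  case: (boolP (adjrel g a j)) => [aj|/(rate_nadj theta) ->]; last by rewrite !mul0r.
  rewrite /disc (@conn_trans _ g j a b) // conn_sym; exact: connect1.
case: (boolP (adjrel g b j)) => [bj|/(rate_nadj theta) ->]; last by rewrite !mul0r.
rewrite /disc (@conn_trans _ g a b j) //; exact: connect1.
Qed.

(* For fixed [b], [disc t ^~ b] vanishes at [b], so the resistance bound
   [poincare_point] controls its square sum by its Dirichlet energy, and the
   latter is the dissipation of [disc2]. *)
Definition disc2 (t : R) : R := \sum_a \sum_b disc t a b ^+ 2.

Lemma disc2_ge0 t : 0 <= disc2 t.
Proof. by apply: sumr_ge0 => a _; apply: sumr_ge0 => b _; exact: sqr_ge0. Qed.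

(** By symmetry of [disc] the two sums of [flow] dissipate the same amount, half of the total energy
    each. Applying the pointwise bound at every a gives the factor n. *)
Lemma flow_dissipation t : kappa * disc2 t <=
  - (n * k%:R ^+ 2) * \sum_a \sum_b disc t a b * flow t a b.
Proof.
have D b : \sum_a disc t a b * (\sum_j r a j * (disc t j b - disc t a b)) =
    - (2^-1 * energy (fun a => disc t a b)).
  by rewrite dirichlet_form // => i j; exact: rateC.
have E : \sum_a \sum_b disc t a b * flow t a b = - \sum_b energy (fun a => disc t a b).
  have -> : \sum_a \sum_b disc t a b * flow t a b =
    \sum_b \sum_a disc t a b * (\sum_j r a j * (disc t j b - disc t a b)) +
    \sum_a \sum_b disc t a b * (\sum_j r b j * (disc t a j - disc t a b)).
    rewrite [X in X + _]exchange_big -big_split; apply: eq_bigr => a _ /=.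
    rewrite -big_split; apply: eq_bigr => b _ /=.
    by rewrite /flow mulrDr.
  have -> : \sum_a \sum_b disc t a b * (\sum_j r b j * (disc t a j - disc t a b)) =
    \sum_b \sum_a disc t a b * (\sum_j r a j * (disc t j b - disc t a b)).
    apply: eq_bigr => a _; apply: eq_bigr => b _; rewrite discC; congr (_ * _).
    by apply: eq_bigr => j _; rewrite [disc t a j]discC.
  rewrite (eq_bigr _ (fun b _ => D b)) sumrN -mulr_sumr; lra.
rewrite E mulrNN.
have -> : n * k%:R ^+ 2 * (\sum_b energy (fun a => disc t a b)) =
    \sum_b \sum_(a : V) k%:R ^+ 2 * energy (fun a => disc t a b).
  rewrite mulr_sumr; apply: eq_bigr => b _; rewrite sumr_const -[RHS]mulr_natl.
  by rewrite -mulrA.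
have -> : kappa * disc2 t = \sum_b \sum_a kappa * disc t a b ^+ 2.
  rewrite /disc2 exchange_big mulr_sumr; apply: eq_bigr => b _ /=.
  by rewrite mulr_sumr.
apply: ler_sum => b _; apply: ler_sum => a _.
case: (boolP (conn g a b)) => ab.
  exact: (poincare_point (f := fun a => disc t a b) (disc_same _ _) ab).
rewrite [X in kappa * X ^+ 2]/disc (negbTE ab) expr0n mulr0 mulr_ge0 ?energy_ge0 //.
Qed.

Definition rate_sum : R := \sum_i \sum_j r i j.

Lemma flow_bound t a b : 0 <= t -> `|flow t a b| <= 2 * rate_sum.
Proof.
move=> t0.
have B i (d : V -> R) : (forall j, `|d j| <= 1) -> `|\sum_j r i j * d j| <= rate_sum.
  move=> d1; apply: (le_trans (ler_norm_sum _ _ _)).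
  apply: (@le_trans _ _ (\sum_j r i j)).
    apply: ler_sum => j _; rewrite normrM ger0_norm ?rate_ge0 //.
    by rewrite ler_piMr ?rate_ge0.
  rewrite /rate_sum [leRHS](bigD1 i) //= lerDl sumr_ge0 // => i' _.
  by apply: sumr_ge0 => j _; exact: rate_ge0.
have D1 a' b' c d : `|disc t a' b' - disc t c d| <= 1.
  have /andP[h1 h2] := disc01 a' b' t0; have /andP[h3 h4] := disc01 c d t0.
  by rewrite ler_norml; apply/andP; split; lra.
rewrite /flow (le_trans (ler_normD _ _)) // mulr_natl mulr2n.
by apply: lerD; apply: B.
Qed.

Lemma disc_step (e0 : R) : 0 < e0 -> exists2 d, 0 < d & forall s t a b,
  0 < s <= d -> 0 <= t ->
  disc (t + s) a b ^+ 2 <= disc t a b ^+ 2 + s * (2 * (disc t a b * flow t a b)) + e0 * s.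
Proof.
move=> e00.
have rs0 : 0 <= rate_sum by apply: sumr_ge0 => i _; apply: sumr_ge0 => j _; exact: rate_ge0.
set B := 2 * rate_sum; have B0 : 0 <= B by rewrite mulr_ge0.
(* With z = h + s F, the difference of squares y^2 - z^2 costs e1 s times |y + z| <= 2 + B, and the
   square of s F costs another e1 s. *)
pose e1 := e0 / (3 + B).
have e10 : 0 < e1 by rewrite divr_gt0 // ltr_wpDr.
have [d d0 H] := act_step Qsemi Qgen (fun q : V * V => disagree R q.1 q.2) e10.
pose d' := Num.min d (Num.min 1 (e1 / (1 + B ^+ 2))).
have d'0 : 0 < d'.
  by rewrite !lt_min d0 ltr01 divr_gt0 // ltr_wpDr // sqr_ge0.
exists d' => // s t a b /andP[s0 sd'] t0.
have : s <= d /\ s <= 1 /\ s * B ^+ 2 <= e1.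
  move: sd'; rewrite !le_min => /and3P[-> -> h]; do 2 split => //.
  move: h; rewrite ler_pdivlMr ?ltr_wpDr ?sqr_ge0 // => h; apply: le_trans h.
  by rewrite ler_wpM2l ?(ltW s0) // lerDr.
case=> sd [s1 sB].
have [/andP[ab nab]|] := boolP (conn g a b && (a != b)); last first.
  rewrite negb_and negbK => h.
  have z t' : disc t' a b = 0.
    by case/orP: h => [h|/eqP ->]; [rewrite /disc (negbTE h)|exact: disc_same].
  by rewrite !z mul0r !mulr0 expr0n !add0r mulr_ge0 // ltW.
have ts0 : 0 <= t + s by rewrite addr_ge0 // ltW.
have /andP[y0 y1] := disc01 a b ts0.
have /andP[h0 h1] := disc01 a b t0.
have FB := flow_bound a b t0.
have sd2 : 0 < s <= d by rewrite s0 sd.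
have := H s t (a, b) x sd2 t0; rewrite /= flow_gen //.
have discE t' : act Q (disagree R a b) t' x = disc t' a b by rewrite /disc ab.
rewrite !discE.
move: FB y0 y1 h0 h1; set y := disc (t + s) a b; set h := disc t a b; set F := flow t a b.
rewrite -/B !ler_norml => /andP[F1 F2] y0 y1 h0 h1 /andP[k1 k2].
have -> : e0 = e1 * (3 + B) by rewrite /e1 divfK // gt_eqF // ltr_wpDr.
pose z := h + s * F.
have yz : y ^+ 2 - z ^+ 2 <= e1 * s * (2 + B).
  rewrite subr_sqr; apply: (le_trans (ler_norm _)); rewrite normrM.
  apply: ler_pM => //.
    by rewrite ler_norml; apply/andP; split; rewrite /z; lra.
  have sF : `|s * F| <= B.
    rewrite normrM gtr0_norm //.
    apply: le_trans (_ : 1 * B <= _); last by rewrite mul1r.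
    by apply: ler_pM => //; [exact: ltW | rewrite ler_norml F1 F2].
  move: sF; rewrite !ler_norml /z => /andP[? ?]; apply/andP; split; lra.
have sF2 : s ^+ 2 * F ^+ 2 <= e1 * s.
  have F2B : F ^+ 2 <= B ^+ 2 by rewrite -real_normK ?num_real // lerXn2r ?nnegrE // ler_norml F1.
  have -> : s ^+ 2 * F ^+ 2 = s * (s * F ^+ 2) by ring.
  rewrite mulrC ler_wpM2r ?(ltW s0) //; apply: le_trans sB.
  by rewrite ler_wpM2l // ltW.
move: yz; rewrite /z sqrrD exprMn; move: sF2.
have -> : h * (s * F) *+ 2 = s * (2 * (h * F)) by rewrite -mulr_natl; ring.
nra.
Qed.

Lemma disc2_decay t : (0 < #|V|)%N -> (0 < k)%N -> 0 <= t ->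
  disc2 t <= expR (- (2 * kappa / (n * k%:R ^+ 2) * t)) * disc2 0.
Proof.
move=> n0 k0 t0.
have nk0 : 0 < n * k%:R ^+ 2 by rewrite mulr_gt0 ?exprn_gt0 ?ltr0n.
have c0 : 0 <= 2 * kappa / (n * k%:R ^+ 2) by rewrite divr_ge0 ?mulr_ge0 // ltW.
apply: discrete_gronwall => // [s t' s0 t'0|e0 e00].
  by rewrite ler_wpM2r ?disc2_ge0 // expR_ge1Dx.
have n2 : 0 < n ^+ 2 by rewrite exprn_gt0 // ltr0n.
have [d d0 H] := disc_step (divr_gt0 e00 n2).
exists d => // s t' sd t'0; have /andP[s0 _] := sd.
apply: (@le_trans _ _ (\sum_a \sum_b
  (disc t' a b ^+ 2 + s * (2 * (disc t' a b * flow t' a b)) + e0 / n ^+ 2 * s))).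
  by apply: ler_sum => a _; apply: ler_sum => b _; apply: H.
have -> : \sum_a \sum_b (disc t' a b ^+ 2 + s * (2 * (disc t' a b * flow t' a b)) +
    e0 / n ^+ 2 * s) =
  disc2 t' + s * 2 * (\sum_a \sum_b disc t' a b * flow t' a b) + e0 * s.
  under eq_bigr do rewrite !big_split /=.
  rewrite !big_split /=; congr (_ + _ + _).
    rewrite mulr_sumr; apply: eq_bigr => a _; rewrite mulr_sumr.
    by apply: eq_bigr => b _; ring.
  have cst (z : R) : \sum_(a : V) z = n * z by rewrite sumr_const mulr_natl.
  rewrite !cst; have : n != 0 by rewrite pnatr_eq0 -lt0n.
  by move: n => m m0; field.
rewrite lerD2r mulrBl mul1r lerD2l.
have := flow_dissipation t'; set X := \sum_a _ => h.
have {}h : X <= - (kappa / (n * k%:R ^+ 2) * disc2 t').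
  rewrite mulrAC lerNr ler_pdivrMr //; apply: (le_trans h).
  by rewrite mulNr mulNr mulrC.
have s2 : 0 <= s * 2 by rewrite mulr_ge0 // ltW.
apply: (le_trans (ler_wpM2l s2 h)); rewrite mulrN lerN2.
rewrite (_ : s * 2 * _ = 2 * kappa / (n * k%:R ^+ 2) * s * disc2 t') //.
by ring.
Qed.

Lemma noncons_act t : 0 <= t -> act Q (@noncons R V g) t x = \sum_a \sum_b disc t a b.
Proof.
move=> t0; rewrite pair_big /= /noncons.
transitivity (\sum_(q : V * V | conn g q.1 q.2) act Q (disagree R q.1 q.2) t x).
  rewrite /act exchange_big; apply: eq_bigr => y _ /=.
  by rewrite mulr_sumr.
by rewrite big_mkcond; apply: eq_bigr => -[a b] _.
Qed.

(** Each [disc t a b] is at most the square root of [disc2 t], which halves the rate of decay and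
    gives a factor n; summing over pairs gives the other n^2. *)
Lemma noncons_decay t : (0 < #|V|)%N -> (0 < k)%N -> 0 <= t ->
  act Q (@noncons R V g) t x <= n ^+ 3 * expR (- (kappa / (n * k%:R ^+ 2) * t)).
Proof.
move=> n0 k0 t0; rewrite noncons_act //.
have cst (z : R) : \sum_(a : V) z = n * z by rewrite sumr_const mulr_natl.
have d0 : disc2 0 <= n ^+ 2.
  rewrite expr2 -cst /disc2; apply: ler_sum => a _.
  rewrite -[leRHS]mulr1 -cst; apply: ler_sum => b _.
  by have /andP[h0 h1] := disc01 a b (lexx 0); rewrite exprn_ile1.
have D := disc2_decay n0 k0 t0.
set E := expR (- (kappa / (n * k%:R ^+ 2) * t)).
have EE : expR (- (2 * kappa / (n * k%:R ^+ 2) * t)) = E ^+ 2.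
  by rewrite [RHS]expr2 -expRD; congr expR; ring.
have H a b : disc t a b <= n * E.
  have /andP[h0 _] := disc01 a b t0.
  have nE0 : 0 <= n * E by rewrite mulr_ge0 ?expR_ge0.
  rewrite -(ler_pXn2r (n := 2)) ?nnegrE // exprMn -EE mulrC.
  apply: (le_trans (le_trans _ D)); last by rewrite ler_wpM2l ?expR_ge0.
  rewrite /disc2 (bigD1 a) //= (bigD1 b) //= -addrA lerDl addr_ge0 ?sumr_ge0 // => [i _|i _].
    exact: sqr_ge0.
  by apply: sumr_ge0 => j _; exact: sqr_ge0.
apply: (@le_trans _ _ (\sum_(a : V) \sum_(b : V) n * E)).
  by apply: ler_sum => a _; apply: ler_sum => b _; exact: H.
by rewrite !cst !exprS expr0 mulr1 !mulrA.
Qed.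

(** At consensus [disc2] vanishes at time 0, and the contraction estimate then keeps it at 0. *)
Lemma consensus_absorbing t : (0 < #|V|)%N -> (0 < k)%N -> 0 <= t -> consensus g x ->
  act Q (@noncons R V g) t x = 0.
Proof.
move=> n0 k0 t0 /consensusP cx.
have D0 : disc2 0 = 0.
  rewrite /disc2 big1 // => a _; rewrite big1 // => b _.
  rewrite /disc; case: ifP => [/cx xab|]; last by rewrite expr0n.
  by rewrite (act0 Qsemi) /disagree xab eqxx expr0n.
have := disc2_decay n0 k0 t0; rewrite D0 mulr0 => h.
have {}h : disc2 t = 0 by apply/eqP; rewrite eq_le h disc2_ge0.
rewrite noncons_act // big1 // => a _; rewrite big1 // => b _.
move/eqP: h; rewrite psumr_eq0 => [/allP/(_ a)|a' _]; last first.
  by apply: sumr_ge0 => j _; exact: sqr_ge0.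
rewrite mem_index_enum => /(_ isT); rewrite psumr_eq0 => [/allP/(_ b)|j _]; last exact: sqr_ge0.
by rewrite mem_index_enum => /(_ isT); rewrite sqrf_eq0 => /eqP.
Qed.

End Contraction.

(** * Consensus time *)

Section FinitePartition.
Local Open Scope classical_set_scope.
Context d (T : measurableType d) (R : realType) (P : probability T R) (S : finType).

Lemma fibers_measurable (f : T -> S) (A : set S) :
  (forall x, measurable (f @^-1` [set x])) -> measurable [set w | A (f w)].
Proof.
move=> mf.
have -> : [set w | A (f w)] = \big[setU/set0]_(y <- index_enum S | `[< A y >]) (f @^-1` [set y]).
  apply/seteqP; split => w /=.
    move=> Aw; rewrite -bigcup_seq_cond; exists (f w) => //=.
    by rewrite mem_index_enum; apply/asboolP.
  by rewrite -bigcup_seq_cond => -[y /= /andP[_ /asboolP Ay]] ->.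
by apply: bigsetU_measurable => y _; exact: mf.
Qed.

Lemma measure_partition (f : T -> S) (B : set T) : measurable B ->
  (forall x, measurable (f @^-1` [set x])) ->
  P B = (\sum_x P (f @^-1` [set x] `&` B))%E.
Proof.
move=> mB mf.
have H (s : seq S) : uniq s -> measurable [set w | f w \in s] /\
    P ([set w | f w \in s] `&` B) = (\sum_(x <- s) P (f @^-1` [set x] `&` B))%E.
  elim: s => [_|x s IH /= /andP[xs us]].
    have -> : [set w | f w \in [::]] = set0 by apply/seteqP; split.
    by rewrite set0I measure0 big_nil.
  have [ms Ps] := IH us.
  have -> : [set w | f w \in x :: s] = f @^-1` [set x] `|` [set w | f w \in s].
    apply/seteqP; split => w /=; rewrite in_cons.
      by case/orP => [/eqP|]; [left|right].
    by case=> [->|->]; rewrite ?eqxx ?orbT.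
  split; first exact: measurableU.
  rewrite setIUl measureU; last 3 first.
  - exact: measurableI.
  - exact: measurableI.
  - apply/seteqP; split => w //= [[-> _] [wS _]].
    by rewrite wS in xs.
  by rewrite big_cons; congr (_ + _)%E; exact: Ps.
have [_ <-] := H (index_enum S) (index_enum_uniq _).
congr (P _); apply/seteqP; split => w /=; last by case.
by move=> Bw; rewrite mem_index_enum.
Qed.

End FinitePartition.

Section ConsensusTime.
Local Open Scope classical_set_scope.
Context (R : realType) (V : finType) (theta u : R) (g : sgraph V).
Context d (T : measurableType d) (P : probability T R) (X : R -> T -> config V).
Hypothesis mX : forall (t : R) x, 0 <= t -> measurable (X t @^-1` [set x]).
Hypothesis cX : forall w, cadlag (fun t => X t w).
Hypothesis iX : forall x, P (X 0 @^-1` [set x]) = (bernoulli_product u x)%:E.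
Variable Q : R -> config V -> config V -> R.
Hypothesis Qsemi : markov_semigroup Q.
Hypothesis Qgen : has_generator Q (voter_generator theta g).
Hypothesis Qmarkov : forall (s t : R) (y : config V) (A : set T),
  0 <= s -> 0 <= t -> past X s A ->
  P (A `&` X (s + t) @^-1` [set y]) = (\int[P]_(w in A) (Q t (X s w) y)%:E)%E.

Lemma markov_point s t x y : 0 <= s -> 0 <= t ->
  P (X s @^-1` [set x] `&` X (s + t) @^-1` [set y]) = ((Q t x y)%:E * P (X s @^-1` [set x]))%E.
Proof.
move=> s0 t0; rewrite Qmarkov //; last first.
  apply: sub_sigma_algebra; exists s, x; split => //.
  by rewrite s0 lexx.
rewrite (eq_integral (cst (Q t x y)%:E)) => [|w]; last by rewrite inE /= => ->.
by rewrite integral_cst //; exact: mX.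
Qed.

Definition law (t : R) (y : config V) : R := \sum_x bernoulli_product u x * Q t x y.

Lemma lawE t y : 0 <= t -> P (X t @^-1` [set y]) = (law t y)%:E.
Proof.
move=> t0; rewrite (measure_partition P (mX y t0) (fun x => mX x (lexx 0))).
rewrite /law -sumEFin; apply: eq_bigr => x _.
by rewrite -{1}[t]add0r markov_point // iX -EFinM mulrC.
Qed.

Definition unsettled (t : R) : set T := [set w | ~ consensus g (X t w)].

Lemma config_set_measurable t (A : set (config V)) : 0 <= t -> measurable [set w | A (X t w)].
Proof. by move=> t0; apply: fibers_measurable => x; exact: mX. Qed.

Lemma unsettled_measurable t : 0 <= t -> measurable (unsettled t).
Proof. by move=> t0; apply: (config_set_measurable (fun x => ~ consensus g x)). Qed.

Lemma unsettledE t : 0 <= t ->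
  P (unsettled t) = (\sum_(y | `[< ~ consensus g y >]) law t y)%:E.
Proof.
move=> t0; rewrite (@measure_partition _ _ _ P _ (X t)); last 2 first.
- exact: unsettled_measurable.
- by move=> x; exact: mX.
rewrite -sumEFin [RHS]big_mkcond /=; apply: eq_bigr => y _.
case: asboolP => ny.
  rewrite -lawE //; congr (P _); apply/seteqP; split => w /=; first by case.
  by move=> wy; split => //; rewrite /unsettled /= wy.
rewrite (_ : _ `&` _ = set0) ?measure0 //; apply/seteqP; split => w //= [wy].
by rewrite /unsettled /= wy.
Qed.

Lemma law_ge0 t y : 0 <= t -> 0 <= law t y.
Proof. by move=> t0; rewrite -lee_fin -lawE. Qed.

Lemma bernoulli_product_ge0 (x : config V) : 0 <= bernoulli_product u x.
Proof. by rewrite -lee_fin -iX. Qed.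

Lemma sum_bernoulli_product : \sum_(x : config V) bernoulli_product u x = 1.
Proof.
have := @measure_partition _ _ _ P _ (X 0) setT measurableT (fun x => mX x (lexx 0)).
rewrite probability_setT => /esym; under eq_bigr do rewrite setIT iX.
by rewrite sumEFin => -[].
Qed.

Lemma law_act (f : config V -> R) t :
  \sum_y law t y * f y = \sum_x bernoulli_product u x * act Q f t x.
Proof.
rewrite /law /act; under eq_bigr do rewrite mulr_suml.
rewrite exchange_big; apply: eq_bigr => x _ /=; rewrite mulr_sumr.
by apply: eq_bigr => y _; rewrite mulrA.
Qed.

Lemma unsettled_le t (B : R) : 0 <= t ->
  (forall x, act Q (@noncons R V g) t x <= B) -> (P (unsettled t) <= B%:E)%E.
Proof.
move=> t0 HB; rewrite unsettledE // lee_fin.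
apply: (@le_trans _ _ (\sum_y law t y * noncons R g y)).
  rewrite big_mkcond; apply: ler_sum => y _; case: asboolP => ny.
    by rewrite ler_peMr ?law_ge0 // noncons_ge1.
  by rewrite mulr_ge0 ?law_ge0 // noncons_ge0.
rewrite law_act -[leRHS]mul1r -sum_bernoulli_product mulr_suml; apply: ler_sum => x _.
by rewrite ler_wpM2l // bernoulli_product_ge0.
Qed.

Lemma unsettled_ge t (f : config V -> R) (b m : R) : 0 <= t -> 0 <= b ->
  (forall x, f x <= b) -> (forall x, consensus g x -> f x <= 0) ->
  (m <= \sum_x bernoulli_product u x * act Q f t x) -> (m%:E <= b%:E * P (unsettled t))%E.
Proof.
move=> t0 b0 fb f0 Hm; rewrite unsettledE // -EFinM lee_fin; apply: (le_trans Hm).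
rewrite -law_act mulr_sumr [leRHS]big_mkcond; apply: ler_sum => y _; case: asboolP => ny.
  by rewrite mulrC ler_wpM2r // law_ge0.
have cy : consensus g y by exact: contrapT.
by rewrite mulr_ge0_le0 ?law_ge0 // f0.
Qed.

Local Notation tau := (tau_cons g X).

Lemma tau_ge0 w : (0 <= tau w)%E.
Proof. by apply: le_ereal_inf_tmp => _ [t [t0 _] <-]; rewrite lee_fin. Qed.

Lemma tau_le w t : 0 <= t -> consensus g (X t w) -> (tau w <= t%:E)%E.
Proof. by move=> t0 c; apply: ereal_inf_lbound; exists t. Qed.

(** By right-continuity a consensus state persists for a while, and that interval contains a
    rational time. This makes the event that [tau] is below r a countable union, hence
    measurable. *)
Lemma tau_lt_rat w (r : \bar R) : (tau w < r)%E ->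
  exists q : rat, [/\ 0 <= (ratr q : R), ((ratr q : R)%:E < r)%E & consensus g (X (ratr q) w)].
Proof.
case/ereal_inf_lt => _ [s [s0 cs] <-] sr.
have [cr _] := cX w.
have /nbhs_ballP[e /= e0 H] := cr s s0.
have [m sm mr] : exists2 m : R, s < m & (m%:E <= r)%E.
  case: r sr => [r| |] //=; first by rewrite lte_fin => ?; exists r.
  by move=> _; exists (s + 1); rewrite ?ltrDl // leey.
have smin : s < Num.min m (s + e) by rewrite lt_min sm ltrDl.
have [q] := rat_in_itvoo smin; rewrite in_itv /= lt_min => /andP[sq /andP[qm qe]].
exists q; split; first by rewrite (le_trans s0) // ltW.
  by apply: lt_le_trans mr; rewrite lte_fin.
suff -> : X (ratr q) w = X s w by [].
apply: H => //; rewrite -ball_normE /= ltr0_norm ?subr_lt0 // opprB.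
by rewrite ltrBlDl.
Qed.

Lemma tau_lt_bigcup (r : R) : [set w | (tau w < r%:E)%E] =
  \bigcup_(q : rat) [set w | (0 <= (ratr q : R) < r)%R /\ consensus g (X (ratr q) w)].
Proof.
apply/seteqP; split => w /=.
  case/tau_lt_rat => q [q0 qr cq]; exists q => //=; split => //.
  by rewrite q0 -lte_fin.
case=> q _ /= [/andP[q0 qr] cq].
by apply: (le_lt_trans (tau_le q0 cq)); rewrite lte_fin.
Qed.

Lemma tau_measurable : measurable_fun [set: T] (fun w => tau w : \bar R).
Proof.
apply: (measurability _ (ErealGenInftyO.measurableE R)) => _ /= -[_ [r ->] <-].
rewrite setTI (_ : _ @^-1` _ = [set w | (tau w < r%:E)%E]); last first.
  by apply/seteqP; split => w /=; rewrite in_itv.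
rewrite tau_lt_bigcup; apply: bigcupT_measurable_rat => q.
case: (boolP (0 <= (ratr q : R) < r)) => [/andP[q0 qr]|h].
  rewrite (_ : [set w | _ ] = [set w | consensus g (X (ratr q) w)]).
    exact: (config_set_measurable (consensus g)).
  by apply/seteqP; split => w /=; [case|split].
by rewrite (_ : [set w | _ ] = set0) //; apply/seteqP; split => w //= [].
Qed.

Lemma consensus_absorbed q t : 0 <= q -> q <= t ->
  (forall s x, 0 <= s -> consensus g x -> act Q (@noncons R V g) s x = 0) ->
  P ([set w | consensus g (X q w)] `&` unsettled t) = 0%E.
Proof.
move=> q0 qt Habs; have t0 := le_trans q0 qt.
have mqt : measurable ([set w | consensus g (X q w)] `&` unsettled t).
  by apply: measurableI; [exact: config_set_measurable|exact: unsettled_measurable].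
rewrite (measure_partition P mqt (fun x => mX x q0)) big1 // => x _.
have mx : measurable (X q @^-1` [set x] `&` ([set w | consensus g (X q w)] `&` unsettled t)).
  by apply: measurableI => //; exact: mX.
rewrite (measure_partition P mx (fun y => mX y t0)) big1 // => y _.
have [cx|ncx] := pselect (consensus g x); last first.
  rewrite [X in P X](_ : _ = set0) ?measure0 //; apply/seteqP; split => w //=.
  by move=> [_ [-> [/ncx]]].
have [cy|ncy] := pselect (consensus g y).
  rewrite [X in P X](_ : _ = set0) ?measure0 //; apply/seteqP; split => w //=.
  by rewrite /unsettled /= => -[-> [_ [_]]].
apply: (@subset_measure0 _ _ _ _ _ (X q @^-1` [set x] `&` X t @^-1` [set y])).
- by apply: measurableI => //; exact: mX.
- by apply: measurableI; exact: mX.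
- by move=> w /= [-> [-> _]].
have tq : 0 <= t - q by rewrite subr_ge0.
suff Q0 : Q (t - q) x y = 0.
  have := markov_point x y q0 tq; rewrite Q0 mul0e subrKC; exact.
have [Q0 _ _ _] := Qsemi.
have := Habs _ _ tq cx; rewrite /act => /eqP; rewrite psumr_eq0; last first.
  by move=> z _; rewrite mulr_ge0 ?Q0 ?noncons_ge0.
move=> /allP/(_ y); rewrite mem_index_enum => /(_ isT) /=.
rewrite mulf_eq0 => /orP[/eqP //|/eqP h].
by have := noncons_ge1 R ncy; rewrite h ler10.
Qed.

(** [tau] is the first time of consensus, so being unsettled at t gives tau >= t only if consensus
    is never lost. This holds almost surely, by [consensus_absorbed] over the countably many
    rational times before t. *)
Lemma tau_lower t : 0 <= t ->
  (forall s x, 0 <= s -> consensus g x -> act Q (@noncons R V g) s x = 0) ->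
  (t%:E * P (unsettled t) <= \int[P]_w tau w)%E.
Proof.
move=> t0 Habs.
pose A := [set w | (tau w < t%:E)%E].
have mA : measurable A.
  rewrite /A -[X in measurable X]setTI.
  exact: (emeasurable_fun_infty_o measurableT tau_measurable).
have mU := unsettled_measurable t0.
have PA : P (unsettled t `&` A) = 0%E.
  have [pk [upk pkK]] : exists (pk : rat -> nat) (upk : nat -> option rat), pcancel pk upk.
    by exists pickle, unpickle; exact: pickleK.
  have neg : P.-negligible (unsettled t `&` A).
    apply: (@negligibleS _ _ _ P (\bigcup_n (if upk n is Some q then
        (if 0 <= (ratr q : R) < t then [set w | consensus g (X (ratr q) w)] `&` unsettled t
         else set0) else set0))).
      move=> w [uw]; rewrite /A tau_lt_bigcup => -[q _ /= [qt cq]].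
      by exists (pk q) => //=; rewrite pkK qt.
    apply: negligible_bigcup => n; case: (upk n) => [q|]; last exact: negligible_set0.
    case: ifP => [/andP[q0 qt]|_]; last exact: negligible_set0.
    apply/negligibleP; last by apply: consensus_absorbed => //; exact: ltW.
    by apply: measurableI => //; exact: (config_set_measurable (consensus g)).
  by apply/negligibleP => //; exact: measurableI.
have PD : P (unsettled t) = P (unsettled t `\` A).
  apply: (etrans (measureDI P mU mA)); rewrite -[RHS]adde0.
  by congr (_ + _)%E; exact: PA.
have mD : measurable (unsettled t `\` A) by exact: measurableD.
rewrite PD -integral_cst //.
apply: (@le_trans _ _ (\int[P]_(w in unsettled t `\` A) tau w)%E).
  apply: ge0_le_integral => //.
  - exact: measurable_funTS tau_measurable.
  - by move=> w [_ /= /negP]; rewrite /A /= -leNgt.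
apply: ge0_subset_integral => //; first exact: tau_measurable.
by move=> w _; exact: tau_ge0.
Qed.

(* On the grid of mesh [D], [tau] is at most [D] times the number of grid
   times at which consensus has not been reached. *)
Lemma tau_upper D : 0 < D ->
  (forall k : nat, (P (unsettled (k%:R * D)) <= (2^-1 ^+ k)%:E)%E) ->
  (\int[P]_w tau w <= (2 * D)%:E)%E.
Proof.
move=> D0 H.
have kD0 k : 0 <= k%:R * D by rewrite mulr_ge0 // ltW.
pose f k w := (D * \1_(unsettled (k%:R * D)) w)%:E : \bar R.
have f0 k w : (0 <= f k w)%E by rewrite lee_fin mulr_ge0 // ltW.
have mf k : measurable_fun setT (f k).
  apply/measurable_EFinP; apply: measurable_funM; first exact: measurable_cst.
  exact/measurable_indicP/unsettled_measurable.
apply: (@le_trans _ _ (\int[P]_w \sum_(0 <= k <oo) f k w)%E).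
  apply: ge0_le_integral => //.
  - by move=> w _; exact: tau_ge0.
  - exact: tau_measurable.
  - by apply: ge0_emeasurable_sum => // k w _ _; exact: f0.
  move=> w _.
  have [[k ck]|nk] := pselect (exists k : nat, consensus g (X (k%:R * D) w)).
    have [m cm mmin] : exists2 m : nat, consensus g (X (m%:R * D) w) &
        forall j, (j < m)%N -> ~ consensus g (X (j%:R * D) w).
      have ex : exists k, `[< consensus g (X (k%:R * D) w) >] by exists k; apply/asboolP.
      exists (ex_minn ex); case: ex_minnP => m /asboolP // _ hm j jm cj.
      by move/asboolP : cj => /hm; rewrite leqNgt jm.
    apply: (le_trans (tau_le (kD0 m) cm)).
    apply: (@le_trans _ _ (\sum_(0 <= k < m) f k w)%E); last exact: nneseries_lim_ge.
    rewrite (eq_big_nat _ _ (F2 := fun=> D%:E)) => [|j /andP[_ jm]]; last first.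
      by rewrite /f indicE mem_set ?mulr1 //; exact: mmin.
    by rewrite sumEFin big_const_nat subn0 iter_addr addr0 mulr_natl.
  (* Without consensus on the grid the series exceeds every multiple of D, so it is infinite and
     dominates [tau]. *)
  have Sge m : ((m%:R * D)%:E <= \sum_(0 <= k <oo) f k w)%E.
    apply: (@le_trans _ _ (\sum_(0 <= k < m) f k w)%E); last exact: nneseries_lim_ge.
    rewrite (eq_big_nat _ _ (F2 := fun=> D%:E)) => [|j _]; last first.
      by rewrite /f indicE mem_set ?mulr1 // => cj; apply: nk; exists j.
    by rewrite sumEFin big_const_nat subn0 iter_addr addr0 mulr_natl.
  case: (\sum_(0 <= k <oo) f k w)%E Sge => [r| |] Sge; last 2 first.
  - by rewrite leey.
  - by have := Sge 0%N.
  have := Sge (Num.trunc (r / D)).+1; rewrite lee_fin leNgt -ltr_pdivrMr //.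
  by rewrite truncnS_gt.
rewrite integral_nneseries //.
(* D / 2^k is written as 2 D / 2^(k+1), the form summed by [epsilon_trick0]. *)
apply: (@le_trans _ _ (\sum_(k <oo) (2 * D / (2 ^ k.+1)%:R)%:E)%E); last first.
  by apply: epsilon_trick0; rewrite mulr_ge0 // ltW.
apply: lee_nneseries => [k _ _|k _]; first by apply: integral_ge0 => w _; exact: f0.
have -> : (\int[P]_w f k w)%E = (D%:E * P (unsettled (k%:R * D)))%E.
  rewrite /f; under eq_integral do rewrite EFinM.
  rewrite ge0_integralZl_EFin ?ltW //.
    by rewrite integral_indic // ?setIT //; exact: unsettled_measurable.
  exact/measurable_EFinP/measurable_indicP/unsettled_measurable.
apply: (le_trans (lee_wpmul2l _ (H k))); first by rewrite lee_fin ltW.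
rewrite -EFinM lee_fin natrX exprS exprVn invfM.
rewrite mulrACA mulfV ?mul1r //.
Qed.

End ConsensusTime.

(** * Mean consensus time on a fixed graph *)

Section ConsensusBounds.
Context (R : realType) (V : finType) (theta u : R) (g : sgraph V).

(** If the off-diagonal drift formula held for all pairs, the total drift would be 0, since a
    symmetric Laplacian sums to 0 over each component. What remains is the correction on the
    diagonal, where the true drift is 0, and it is bounded by the total rate. *)
Lemma noncons_gen_ge (x : config V) :
  - (2 * rate_sum theta g) <= voter_generator theta g (@noncons R V g) x.
Proof.
pose f a b : R := disagree R a b x.
pose A a b : R := \sum_j rate theta g a j * (f j b - f a b).
have gen a b : voter_generator theta g (disagree R a b) x =
    A a b + A b a - (a == b)%:R * (2 * A a a).
  case: eqVneq => [<-|ab]; last first.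
    rewrite disagree_gen // mul0r subr0; congr (_ + _); apply: eq_bigr => j _.
    by rewrite /f ![disagree R a _ x]disagreeC.
  rewrite mul1r (_ : A a a + A a a - 2 * A a a = 0); last by ring.
  rewrite voter_generatorE big1 // => i _; rewrite big1 // => j _.
  by rewrite !disagree_same subrr mulr0.
have A0 b : \sum_(a | conn g a b) A a b = 0.
  pose v a := if conn g a b then f a b else 0.
  have -> : \sum_(a | conn g a b) A a b = \sum_a \sum_j rate theta g a j * (v j - v a).
    rewrite big_mkcond; apply: eq_bigr => a _; case: ifP => ab; last first.
      rewrite big1 // => j _.
      have [aj|/(rate_nadj theta) ->] := boolP (adjrel g a j); last by rewrite mul0r.
      rewrite /v ab; case: ifP => [jb|]; last by rewrite subrr mulr0.
      by rewrite (conn_trans (connect1 aj) jb) in ab.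
    apply: eq_bigr => j _.
    have [aj|/(rate_nadj theta) ->] := boolP (adjrel g a j); last by rewrite !mul0r.
    rewrite /v ab (conn_trans _ ab) // conn_sym; exact: connect1.
  set Y := \sum_a _; suff : Y = - Y by lra.
  rewrite {1}/Y exchange_big -sumrN; apply: eq_bigr => a _; rewrite -sumrN.
  by apply: eq_bigr => j _; rewrite rateC; ring.
have -> : voter_generator theta g (@noncons R V g) x = - (2 * \sum_a A a a).
  rewrite /noncons voter_gen_sum (eq_bigr _ (fun q _ => gen q.1 q.2)).
  rewrite -(pair_big_dep xpredT (conn g) (fun a b => A a b + A b a - (a == b)%:R * (2 * A a a))) /=.
  rewrite (eq_bigr (fun a => \sum_(b | conn g a b) A a b + \sum_(b | conn g a b) A b a - 2 * A a a)).
    rewrite sumrB big_split /= -mulr_sumr.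
    rewrite (exchange_big_dep xpredT) //= big1 => [|b _]; last exact: A0.
    rewrite big1 ?add0r // => a _; rewrite -[RHS](A0 a).
    by apply: eq_bigl => b; rewrite conn_sym.
  move=> a _; rewrite sumrB big_split /=; congr (_ - _).
  rewrite (bigD1 a) /=; last exact: connect0.
  rewrite eqxx mul1r big1 ?addr0 // => b /andP[_ ba].
  by rewrite eq_sym (negbTE ba) mul0r.
rewrite lerN2 ler_wpM2l //; apply: ler_sum => a _; apply: ler_sum => j _.
rewrite ler_piMr ?rate_ge0 // /f disagree_same subr0 /disagree.
by case: (_ != _).
Qed.

Hypothesis u01 : 0 < u < 1.

Lemma disagree_mean (a b : V) : a != b ->
  \sum_(x : config V) bernoulli_product u x * disagree R a b x = 2 * (u * (1 - u)).
Proof.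
move=> ab; rewrite -[LHS]/(bmean (fun=> u) (fun x => disagree R a b x)).
rewrite (eq_bmean _ (g := fun x => (x a)%:R * (~~ x b)%:R + (~~ x a)%:R * (x b)%:R)); last first.
  by move=> x; rewrite /disagree; case: (x a); case: (x b); rewrite /= ?mulr0 ?mulr1 ?addr0 ?add0r.
have dab : [disjoint [set a] & [set b]].
  by rewrite -setI_eq0; apply/eqP/setP => z; rewrite !finset.inE; case: eqP => // ->; apply/negbTE.
have dep (c : V) (h : bool -> R) : depends (fun x : {ffun V -> bool} => h (x c)) [set c].
  by move=> w w' ww'; rewrite ww' // finset.inE.
rewrite bmeanD.
rewrite (bmean_indep _ dab (dep a (fun z => z%:R)) (dep b (fun z => (~~ z)%:R))).
rewrite (bmean_indep _ dab (dep a (fun z => (~~ z)%:R)) (dep b (fun z => z%:R))).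
rewrite !(bmean_coord _ _ (fun z => z%:R)) !(bmean_coord _ _ (fun z => (~~ z)%:R)) /=.
by ring.
Qed.

Definition pairs_conn : R := #|[set q : V * V | conn g q.1 q.2 && (q.1 != q.2)]|%:R.

Lemma noncons_mean : \sum_(x : config V) bernoulli_product u x * noncons R g x =
  2 * (u * (1 - u)) * pairs_conn.
Proof.
rewrite /noncons; under eq_bigr do rewrite mulr_sumr.
rewrite exchange_big /= /pairs_conn -sum1_card natr_sum mulr_sumr.
rewrite big_mkcond [RHS]big_mkcond; apply: eq_bigr => -[a b] _ /=.
rewrite !finset.inE /=; case: ifP => //= ab; case: eqVneq => [<-|nab] /=; last first.
  by rewrite disagree_mean // mulr1.
by rewrite big1 // => x _; rewrite disagree_same mulr0.
Qed.

Lemma noncons_le (x : config V) : noncons R g x <= #|V|%:R ^+ 2.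
Proof.
apply: (@le_trans _ _ (\sum_(q : V * V) 1)).
  rewrite /noncons big_mkcond; apply: ler_sum => q _; case: ifP => // _.
  by rewrite /disagree; case: (_ != _).
by rewrite sumr_const card_prod natrM expr2.
Qed.

Context d (T : measurableType d) (P : probability T R) (X : R -> T -> config V).
Hypothesis HX : is_voter_model theta u g P X.
Variables (kappa : R) (e : rel V) (k : nat).
Hypothesis kappa0 : 0 < kappa.
Hypothesis k0 : (0 < k)%N.
Hypothesis V0 : (0 < #|V|)%N.
Hypothesis e_rate : forall i j, e i j -> kappa <= rate theta g i j.
Hypothesis e_walk : forall a b, conn g a b ->
  exists q : seq V, [/\ path e a q, (size q <= k)%N & last a q = b].

Local Notation n := (#|V|%:R : R).

Lemma mean_tau_le :
  (\int[P]_w tau_cons g X w <= (2 * (n * k%:R ^+ 2 / kappa * ln (2 * n ^+ 3)))%:E)%E.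
Proof.
have [mX cX iX [Q [Qs Qg Qm]]] := HX.
have n1 : 1 <= n by rewrite ler1n.
have n0 : 0 < n by rewrite ltr0n.
have k0R : 0 < k%:R :> R by rewrite ltr0n.
have n3 : 1 <= n ^+ 3 by rewrite exprn_ege1.
have L0 : 0 < ln (2 * n ^+ 3) by rewrite ln_gt0 //; lra.
(* Over one mesh the exponential of [noncons_decay] is 1 / (2 n^3). After j >= 1 meshes the bound is
   n^3 (2 n^3)^(-j) <= 2^(-j); j = 0 is the trivial bound by 1. *)
set D := n * k%:R ^+ 2 / kappa * ln (2 * n ^+ 3).
have D0 : 0 < D by rewrite !mulr_gt0 ?exprn_gt0 ?invr_gt0.
apply: (tau_upper mX cX D0) => j.
have jD0 : 0 <= j%:R * D by rewrite mulr_ge0 // ltW.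
case: j jD0 => [|j] jD0; first by rewrite expr0 probability_le1 //; apply: unsettled_measurable.
apply: (unsettled_le mX iX Qm jD0) => x.
apply: (le_trans (noncons_decay kappa0 e_rate e_walk Qs Qg x V0 k0 jD0)).
have -> : - (kappa / (n * k%:R ^+ 2) * (j.+1%:R * D)) = j.+1%:R * - ln (2 * n ^+ 3).
  rewrite /D; field.
  by rewrite !gt_eqF.
rewrite expRM_natl expRN lnK ?posrE; last by lra.
move: n3; set m := n ^+ 3; move: m => m m1.
have mq : m * (2 * m)^-1 = 2^-1 by field; rewrite gt_eqF // (lt_le_trans ltr01).
have m0 : 0 <= (2 * m)^-1 by rewrite invr_ge0; lra.
have m2 : (2 * m)^-1 <= 2^-1 by rewrite lef_pV2 ?posrE //; lra.
have h2 : 0 <= 2^-1 :> R by rewrite invr_ge0.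
by rewrite !exprS mulrA mq ler_wpM2l // lerXn2r.
Qed.

Lemma mean_tau_ge (B : R) : 0 < B -> rate_sum theta g <= B ->
  (((u * (1 - u)) ^+ 2 * pairs_conn ^+ 2 / (2 * B * n ^+ 2))%:E <=
   \int[P]_w tau_cons g X w)%E.
Proof.
move=> B0 HB.
have [mX cX iX [Q [Qs Qg Qm]]] := HX.
have n0 : 0 < n by rewrite ltr0n.
have uu : 0 < u * (1 - u) by case/andP: u01 => ? ?; rewrite mulr_gt0 // subr_gt0.
have p0 : 0 <= pairs_conn by [].
(* At this time the mean of [noncons] has lost at most half of its initial value 2 u (1 - u) times
   [pairs_conn]. *)
pose t := u * (1 - u) * pairs_conn / (2 * B).
have t0 : 0 <= t.
  by apply: divr_ge0; apply: mulr_ge0 => //; exact: ltW.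
have abs s x : 0 <= s -> consensus g x -> act Q (@noncons R V g) s x = 0.
  by move=> s0; apply: (consensus_absorbing kappa0 e_rate e_walk Qs Qg V0 k0 s0).
apply: (le_trans _ (tau_lower mX cX Qs Qm t0 abs)).
have H : ((u * (1 - u) * pairs_conn)%:E <= (n ^+ 2)%:E * P (unsettled g X t))%E.
  apply: (unsettled_ge mX iX Qm (f := @noncons R V g)) => //.
  - exact: noncons_le.
  - by move=> x cx; rewrite noncons_eq0.
  apply: (@le_trans _ _ (\sum_(x : config V) bernoulli_product u x *
      (noncons R g x - 2 * B * t))).
    under eq_bigr do rewrite mulrBr.
    rewrite sumrB -mulr_suml (sum_bernoulli_product mX iX) mul1r noncons_mean.
    by rewrite /t [2 * B * _]mulrC divfK ?gt_eqF ?mulr_gt0 //; lra.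
  apply: ler_sum => x _; rewrite ler_wpM2l ?(bernoulli_product_ge0 iX) //.
  apply: (act_ge Qs Qg) => // y; apply: (le_trans _ (noncons_gen_ge y)).
  by rewrite lerN2 ler_wpM2l.
have PU : P (unsettled g X t) \is a fin_num by rewrite fin_num_measure //; exact: unsettled_measurable.
move: H; rewrite -(fineK PU) -!EFinM !lee_fin => H.
rewrite -ler_pdivrMl ?exprn_gt0 // in H.
apply: (le_trans _ (ler_wpM2l t0 H)).
rewrite /t le_eqVlt; apply/orP; left; apply/eqP; field.
by rewrite !gt_eqF.
Qed.

End ConsensusBounds.

(** * Law of the random graph *)

Section LawOfGraph.
Local Open Scope classical_set_scope.
Context (R : realType) d (T : measurableType d) (P : probability T R).

(** Induction on the number of complemented events, each removed by P(X \ E) = P(X) - P(X and E). *)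
Lemma indep_cylinder (I : finType) (D : {set I}) (E : I -> set T) (q : I -> R) :
  (forall i, measurable (E i)) -> (forall i, i \in D -> P (E i) = (q i)%:E) ->
  mutually_independent P D E ->
  forall A B : {set I}, A :|: B \subset D -> [disjoint A & B]%B ->
  P ((\bigcap_(i in [set` A]) E i) `&` (\bigcap_(i in [set` B]) ~` E i)) =
  (\prod_(i in A) q i * \prod_(i in B) (1 - q i))%:E.
Proof.
move=> mE qE ind A B.
have mcap (F : I -> set T) (C : {set I}) : (forall i, measurable (F i)) ->
    measurable (\bigcap_(i in [set` C]) F i).
  by move=> mF; apply: fin_bigcap_measurable => // i _; exact: mF.
have mEC i : measurable (~` E i) by exact: measurableC.
move: {2}#|B| (erefl #|B|) => n; elim: n A B => [|n IH] A B cB sAB dAB.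
  have -> : B = finset.set0 by apply/eqP; rewrite -cards_eq0 cB.
  have -> : \bigcap_(i in [set` finset.set0]) ~` E i = setT.
    by apply/seteqP; split => // w _ i /=; rewrite finset.in_set0.
  rewrite setIT big_set0 mulr1 ind.
    rewrite -prodEFin; apply: eq_bigr => i iA; apply: qE.
    by apply: (fintype.subsetP sAB); rewrite finset.in_setU iA.
  by apply: fintype.subset_trans sAB; exact: finset.subsetUl.
have [e eB] : exists e, e \in B by apply/card_gt0P; rewrite cB.
pose B' := (B :\ e)%SET.
have cB' : #|B'| = n by have := finset.cardsD1 e B; rewrite cB eB add1n => -[].
have eA : e \notin A by rewrite (disjointFl dAB eB).
have BE : B = (e |: B')%SET by rewrite /B' finset.setD1K.
have BB' : B' \subset B by rewrite /B' finset.subD1set.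
have dAB' : [disjoint A & B']%B by apply: fintype.disjointWr dAB.
have sAB' : A :|: B' \subset D.
  by apply: fintype.subset_trans sAB; exact: finset.setUS.
have dAeB' : [disjoint (e |: A)%SET & B']%B.
  rewrite -setI_eq0 finset.setIUl finset.setU_eq0 !setI_eq0 dAB' andbT.
  by rewrite disjoints1 /B' !finset.inE eqxx.
have sAeB' : (e |: A)%SET :|: B' \subset D.
  apply: fintype.subset_trans sAB; apply/fintype.subsetP => z; rewrite !finset.inE.
  by case/orP => [/orP[/eqP ->|->]|/andP[_ ->]] //; rewrite ?eB orbT.
set X := (\bigcap_(i in [set` A]) E i) `&` (\bigcap_(i in [set` B']) ~` E i).
have mX : measurable X by apply: measurableI; exact: mcap.
have IH1 := IH A B' cB' sAB' dAB'.
have IH2 := IH (e |: A)%SET B' cB' sAeB' dAeB'.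
have E1 : (\bigcap_(i in [set` A]) E i) `&` (\bigcap_(i in [set` B]) ~` E i) = X `\` E e.
  apply/seteqP; split => w.
    move=> [wA wB]; split; last by apply: wB.
    by split => // i /= iB'; apply: wB; apply: (fintype.subsetP BB').
  move=> [[wA wB'] nwe]; split => // i /=; rewrite BE !finset.inE.
  case: eqVneq => [->|ie] /= iB; first exact: nwe.
  by apply: wB'; rewrite /= /B' !finset.inE ie.
have E2 : (\bigcap_(i in [set` (e |: A)%SET]) E i) `&` (\bigcap_(i in [set` B']) ~` E i) = X `&` E e.
  apply/seteqP; split => w.
    move=> [wA wB]; split; last by apply: wA; rewrite /= !finset.inE eqxx.
    by split => // i /= iA; apply: wA; rewrite /= !finset.inE iA orbT.
  move=> [[wA wB'] we]; split => // i /=; rewrite !finset.inE.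
  by case: eqVneq => [->|_] //= iA; exact: wA.
have H : P X = (P (X `\` E e) + P (X `&` E e))%E := measureDI P mX (mE e).
move: H; rewrite E1 -E2 [X in (_ + X)%E]IH2 [X in X = _]IH1.
have fP : P (X `\` E e) \is a fin_num by rewrite fin_num_measure //; exact: measurableD.
rewrite -(fineK fP) -EFinD => -[H]; congr (_%:E).
move: H; rewrite finset.big_setU1 //= BE finset.big_setU1 //=; last by rewrite /B' !finset.inE eqxx.
rewrite mulrCA mulrBl mul1r; lra.
Qed.

Variables (N : nat) (beta gamma : R) (G : T -> sgraph 'I_N).
Hypothesis hG : is_snr_graph beta gamma P G.

Local Notation E := ('I_N * 'I_N)%type.

Definition ordpair (i j : 'I_N) : E := if (i < j)%N then (i, j) else (j, i).

(** The coordinates (i, j) with i >= j are dummies: they are false with probability 1, and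
    [sample_of] sets them to false. *)
Definition edge_prob (e : E) : R := if (e.1 < e.2)%N then snr_prob beta gamma e.1 e.2 else 0.

Lemma ordpairC i j : ordpair i j = ordpair j i.
Proof.
rewrite /ordpair; case: (ltngtP i j) => // ij.
by congr pair; apply: val_inj.
Qed.

Lemma ordpair_inj i j k l : ordpair i j = ordpair k l ->
  (i = k /\ j = l) \/ (i = l /\ j = k).
Proof. 
by rewrite /ordpair; case: ltnP => _; case: ltnP => _ [-> ->]; auto.
Qed.

Definition edges_of (s : {ffun E -> bool}) : {ffun E -> bool} :=
  [ffun e : E => (e.1 != e.2) && s (ordpair e.1 e.2)].

Lemma edges_ofP (s : {ffun E -> bool}) : [forall i, ~~ edges_of s (i, i)] &&
  [forall i, forall j, edges_of s (i, j) == edges_of s (j, i)].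
Proof.
apply/andP; split.
  by apply/forallP => i; rewrite ffunE /= eqxx.
by apply/'forall_forallP => i j; rewrite !ffunE /= [j == i]eq_sym [ordpair j i]ordpairC.
Qed.

Definition graph_of (s : {ffun E -> bool}) : sgraph 'I_N := SGraph (edges_ofP s).

Lemma graph_ofE s i j : adjrel (graph_of s) i j = (i != j) && s (ordpair i j).
Proof. by rewrite /adjrel /= ffunE. Qed.

Definition sample_of (w : T) : {ffun E -> bool} :=
  [ffun e : E => (e.1 < e.2)%N && adjrel (G w) e.1 e.2].

Lemma sample_ofK w : graph_of (sample_of w) = G w.
Proof.
apply: val_inj; apply/ffunP => -[i j] /=; rewrite !ffunE /ordpair /=.
rewrite -[RHS]/(adjrel (G w) i j).
have /andP[/forallP irr /'forall_forallP sym] := adjP (G w).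
case: (ltngtP i j) => ij /=.
- by rewrite ij -(inj_eq val_inj) /= ltn_eqF.
- by rewrite ij -(inj_eq val_inj) /= gtn_eqF //; apply/eqP; rewrite eq_sym; exact: sym.
- have -> : i = j by exact: val_inj.
  by rewrite eqxx /=; apply/esym/negbTE/irr.
Qed.

Lemma sample_fiber s : [set w | sample_of w = s] =
  if [forall e : E, (e.1 < e.2)%N || ~~ s e] then
    (\bigcap_(e in [set` [set e : E | (e.1 < e.2)%N && s e]%SET]) edge_event G e) `&`
    (\bigcap_(e in [set` [set e : E | (e.1 < e.2)%N && ~~ s e]%SET]) ~` edge_event G e)
  else set0.
Proof.
case: ifP => [/forallP hs|/negbT/forallPn[e]]; last first.
  rewrite negb_or negbK => /andP[ne se]; apply/seteqP; split => w //= ws.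
  by move: se; rewrite -ws ffunE (negbTE ne).
apply/seteqP; split => w /=.
  move=> ws; split => e /=; rewrite finset.inE => /andP[ne se].
    by move: se; rewrite -ws ffunE ne.
  by move: se; rewrite -ws ffunE ne /= => /negP.
move=> [w1 w2]; apply/ffunP => e; rewrite ffunE; case: (boolP (s e)) => se.
  have ne : (e.1 < e.2)%N by have := hs e; rewrite se orbF.
  by rewrite ne /=; apply: w1; rewrite /= finset.inE ne.
case: (boolP (e.1 < e.2)%N) => //= ne; apply/negbTE/negP; apply: w2.
by rewrite /= finset.inE ne.
Qed.

Lemma edge_event_measurable e : measurable (edge_event G e).
Proof. by case: hG => m _ _; have := m e.1 e.2; case: e. Qed.

Lemma sample_measurable s : measurable (sample_of @^-1` [set s]).
Proof.
have -> : sample_of @^-1` [set s] = [set w | sample_of w = s] by [].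
rewrite sample_fiber; case: ifP => // _.
apply: measurableI; apply: fin_bigcap_measurable => // e _.
  exact: edge_event_measurable.
by apply: measurableC; exact: edge_event_measurable.
Qed.

Lemma sample_law s : P (sample_of @^-1` [set s]) = (bweight edge_prob s)%:E.
Proof.
have -> : sample_of @^-1` [set s] = [set w | sample_of w = s] by [].
rewrite sample_fiber; case: ifP => [/forallP hs|/negbT/forallPn[e]]; last first.
  rewrite negb_or negbK => /andP[ne se]; rewrite measure0 /bweight (bigD1 e) //= se.
  by rewrite /edge_prob (negbTE ne) mul0r.
have [_ pE ind] := hG.
rewrite (indep_cylinder (q := edge_prob) edge_event_measurable _ ind); last 3 first.
- move=> [i j]; rewrite finset.inE /= => ij; rewrite /edge_prob /= ij.
  exact: pE.
- rewrite finset.subUset; apply/andP; split; apply/fintype.subsetP => e; rewrite !finset.inE;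
    by case/andP.
- rewrite -setI_eq0; apply/eqP/setP => e; rewrite !finset.inE.
  by case: (s e); rewrite ?andbF.
congr (_%:E); rewrite /bweight [RHS](bigID (fun e : E => (e.1 < e.2)%N && s e)) /=; congr (_ * _).
  by apply: eq_big => [e|e]; rewrite ?finset.inE // => /andP[_ ->].
rewrite [RHS](bigID (fun e : E => (e.1 < e.2)%N)) /= [X in _ * X]big1 ?mulr1.
  apply: eq_big => [e|e]; rewrite ?finset.inE; first by case: (e.1 < e.2)%N; case: (s e).
  by case/andP => _ /negbTE ->.
move=> e /andP[_ ne]; have := hs e; rewrite (negbTE ne) /= => /negbTE ->.
by rewrite /edge_prob (negbTE ne) subr0.
Qed.

(** From here on, every event about the graph, measurability included, is handled through a finite
    mean over independent bits. *)
Lemma graph_law (A : pred (sgraph 'I_N)) :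
  measurable [set w | A (G w)] /\
  P [set w | A (G w)] = (bmean edge_prob (fun s => (A (graph_of s))%:R))%:E.
Proof.
have mA : measurable [set w | A (G w)].
  have -> : [set w | A (G w)] = [set w | (fun s => A (graph_of s)) (sample_of w)].
    by apply/seteqP; split => w /=; rewrite sample_ofK.
  exact: (fibers_measurable (fun s => A (graph_of s)) sample_measurable).
split => //; rewrite (measure_partition P mA sample_measurable) /bmean -sumEFin.
apply: eq_bigr => s _; case: (boolP (A (graph_of s))) => As.
  rewrite mulr1 -sample_law; congr (P _); apply/seteqP; split => w /=; first by case.
  by move=> ws; split => //; rewrite -sample_ofK ws.
rewrite mulr0 (_ : _ `&` _ = set0) ?measure0 //; apply/seteqP; split => w //= [ws].
by rewrite -sample_ofK ws (negbTE As).
Qed.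

End LawOfGraph.

(** * Short walks between connected vertices *)

Section Walks.
Variables (V : finType) (e : rel V).
Hypothesis e_sym : forall x y, e x y = e y x.

Definition walk (k : nat) (a b : V) : Prop :=
  exists q : seq V, [/\ path e a q, (size q <= k)%N & last a q = b].

Lemma walkW k k' a b : (k <= k')%N -> walk k a b -> walk k' a b.
Proof. by move=> kk [q [pq sq lq]]; exists q; split => //; exact: leq_trans kk. Qed.

Lemma walk_trans k k' a b c : walk k a b -> walk k' b c -> walk (k + k') a c.
Proof.
move=> [q [pq sq lq]] [q' [pq' sq' lq']]; exists (q ++ q').
by rewrite cat_path last_cat size_cat lq pq pq' leq_add.
Qed.

Lemma walk_sym k a b : walk k a b -> walk k b a.
Proof.
move=> [q [pq sq lq]]; exists (rev (belast a q)).
rewrite size_rev size_belast -lq; split => //.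
  by rewrite rev_path (eq_path (e' := e)).
case: q {pq sq lq} => //= x q.
by rewrite rev_cons last_rcons.
Qed.

Lemma walk1 a b : e a b -> walk 1 a b.
Proof. by move=> ab; exists [:: b]; rewrite /= ab. Qed.

Lemma walk_connect k a b : walk k a b -> connect e a b.
Proof. by move=> [q [pq _ lq]]; apply/connectP; exists q. Qed.

Lemma level_walk v r x : x \in (bfs e [set v] r).2 -> walk r v x.
Proof.
move=> /bfs_walk[s]; rewrite finset.inE => /eqP -> [q [pq sq lq]].
by exists q; rewrite sq.
Qed.

Lemma bball_walk1 v r x : x \in bball e [set v] r -> walk r v x.
Proof.
by move=> /bball_walk[s]; rewrite finset.inE => /eqP ->.
Qed.

Lemma bball_start v r : v \in bball e [set v] r.
Proof.
apply: (fintype.subsetP (bball_mono e [set v] (leq0n r))).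
by rewrite /bball /= !finset.inE eqxx.
Qed.

Lemma dead_walk v r x : (bfs e [set v] r).2 = finset.set0 -> connect e v x -> walk r v x.
Proof.
move=> dead /connectP[q pq ->]; apply: bball_walk1.
suff H z : z \in bball e [set v] r -> path e z q -> last z q \in bball e [set v] r.
  by apply: H => //; exact: bball_start.
elim: q z {pq} => [|y q IH] z //= zb /andP[zy yq].
by apply: IH => //; exact: bball_dead_closed dead zb zy.
Qed.

Variables (R : realType) (lwt : {set V} -> R).
Hypothesis lwtU : forall A B : {set V}, lwt (A :|: B) <= lwt A + lwt B.
Hypothesis lwt_empty : lwt finset.set0 = 0.

(** Pigeonhole: a ball of radius r consists of r + 1 levels. *)
Lemma bball_big_level S r (m : R) : r.+1%:R * m <= lwt (bball e S r) ->
  exists2 s, (s <= r)%N & m <= lwt (bfs e S s).2.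
Proof.
elim: r => [|r IH] h.
  exists 0%N => //; move: h; rewrite mul1r /bball => h.
  by apply: le_trans h _; apply: le_trans (lwtU _ _) _; rewrite lwt_empty add0r.
case: (lerP m (lwt (bfs e S r.+1).2)) => hm; first by exists r.+1.
have [|s sr ms] := IH; last by exists s => //; exact: leqW.
have := le_trans h (lwtU _ _); rewrite bfs_inner -natr1 mulrDl mul1r; lra.
Qed.

Variables (r : nat) (M : R) (hub : pred V).
Let m := M / r.+1%:R.
Hypothesis H1 : forall v, (bfs e [set v] r).2 = finset.set0 \/ M <= lwt (bball e [set v] r).
Hypothesis H2 : forall v, hub v -> M <= lwt (bball e [set v] r).
Hypothesis H3 : forall v1 v2 r1 r2, (r1 <= r)%N -> (r2 <= r)%N ->
  ~~ [&& [disjoint bball e [set v1] r1 & bball e [set v2] r2],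
     m <= lwt (bfs e [set v1] r1).2, m <= lwt (bfs e [set v2] r2).2 &
     ~~ [exists x in (bfs e [set v1] r1).2, exists y in (bfs e [set v2] r2).2, e x y]].

(** Each ball has a level of weight at least m. Either the balls up to these levels meet, or [H3]
    gives an edge between the two levels: at most r + 1 + r steps. *)
Lemma big_walk v1 v2 : M <= lwt (bball e [set v1] r) -> M <= lwt (bball e [set v2] r) ->
  walk r.*2.+1 v1 v2.
Proof.
have mM : r.+1%:R * m = M by rewrite /m mulrC divfK // pnatr_eq0.
rewrite -mM => /bball_big_level[r1 r1r m1] /bball_big_level[r2 r2r m2].
have := H3 v1 v2 r1r r2r; rewrite m1 m2 /= negb_and negbK => /orP[].
  rewrite -setI_eq0 => /set0Pn[z]; rewrite finset.in_setI => /andP[z1 z2].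
  apply: (@walkW (r1 + r2)); first by rewrite -addnn leqW // leq_add.
  exact: walk_trans (bball_walk1 z1) (walk_sym (bball_walk1 z2)).
move=> /existsP[x /andP[x1 /existsP[y /andP[y2 exy]]]].
apply: (@walkW (r1 + (1 + r2))); first by rewrite addnCA add1n ltnS -addnn leq_add.
apply: walk_trans (level_walk x1) _.
exact: walk_trans (walk1 exy) (walk_sym (level_walk y2)).
Qed.

Lemma connect_walk a b : connect e a b -> walk r.*2.+1 a b.
Proof.
move=> ab; have rr : (r <= r.*2.+1)%N by rewrite -addnn leqW // leq_addr.
have [da|Ma] := H1 a; first exact: walkW rr (dead_walk da ab).
have [db|Mb] := H1 b; last exact: big_walk.
apply/walk_sym/(walkW rr)/dead_walk => //.
by rewrite (sym_connect_sym e_sym).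
Qed.

(** A dropped edge joins two hubs, whose explorations are both large, so [big_walk] provides a
    detour. Dropping those edges therefore leaves the components unchanged. *)
Lemma hub_connect_walk (g : rel V) : (forall i j, g i j -> e i j || (hub i && hub j)) ->
  forall a b, connect g a b -> walk r.*2.+1 a b.
Proof.
move=> ge a b ab; apply: connect_walk; move: ab; apply: connect_sub => x y /ge/orP[exy|/andP[hx hy]].
  exact: connect1.
exact: (walk_connect (big_walk (H2 hx) (H2 hy))).
Qed.

End Walks.

(** * Vertex weights and degrees *)

Section Weights.
Variables (R : realType) (N : nat) (beta gamma : R).
Hypothesis beta0 : 0 < beta.
Hypothesis gamma0 : 0 <= gamma.
Hypothesis gamma1 : gamma <= 2^-1.
Hypothesis N0 : (0 < N)%N.

Definition vweight (i : 'I_N) : R := (N%:R / i.+1%:R) `^ gamma.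

Local Notation W := vweight.
Local Notation c := (beta / N%:R).

Let NR0 : 0 < N%:R :> R. Proof. by rewrite ltr0n. Qed.

Lemma ratio_ge1 (i : 'I_N) : 1 <= N%:R / i.+1%:R :> R.
Proof. by rewrite ler_pdivlMr ?ltr0n // mul1r ler_nat. Qed.

Lemma vweight_ge1 i : 1 <= W i.
Proof. by rewrite -(powRr0 (N%:R / i.+1%:R)) ler_powR // ratio_ge1. Qed.

Lemma snr_probE (i j : 'I_N) : snr_prob beta gamma i j = 1 - expR (- (c * W i * W j)).
Proof.
rewrite /snr_prob /W; congr (1 - expR (- _)).
have PN x : 0 < x -> x \is Num.pos by [].
rewrite !powRM ?invr_ge0 // -!powR_inv1 // -!powRrM !mulN1r powRD; last first.
  by rewrite pnatr_eq0 -lt0n N0 implybT.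
rewrite powR_inv1 // (_ : 2 * gamma = gamma + gamma); last by rewrite mulrDl mul1r.
rewrite powRD; last by rewrite pnatr_eq0 -lt0n N0 implybT.
by ring.
Qed.

Lemma edge_probE i j : i != j ->
  edge_prob beta gamma (ordpair i j) = 1 - expR (- (c * W i * W j)).
Proof.
rewrite /edge_prob /ordpair => ij; case: (ltngtP i j) => h /=.
- by rewrite h snr_probE.
- by rewrite h snr_probE mulrAC.
- by case/eqP: ij; exact: val_inj.
Qed.

Lemma edge_prob01 e : 0 <= edge_prob (N := N) beta gamma e <= 1.
Proof.
rewrite /edge_prob; case: ifP => _; last by rewrite lexx ler01.
rewrite snr_probE subr_ge0 lerBlDr lerDl expR_ge0 andbT -[leRHS]expR0 ler_expR oppr_le0.
by rewrite !mulr_ge0 ?divr_ge0 ?(ltW beta0) // (le_trans ler01) // vweight_ge1.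
Qed.

Lemma harmonic_le (n : nat) : \sum_(i < n.+1) (i.+1%:R : R)^-1 <= 1 + ln n.+1%:R.
Proof.
elim: n => [|n IH]; first by rewrite big_ord_recr big_ord0 /= add0r invr1 ln1 addr0.
rewrite big_ord_recr /=; apply: le_trans (lerD IH (lexx _)) _.
rewrite -addrA lerD2l -lerBrDl.
have n1 : 0 < n.+1%:R :> R by rewrite ltr0n.
have n2 : 0 < n.+2%:R :> R by rewrite ltr0n.
rewrite -lerN2 opprB -ln_div ?posrE //.
have -> : n.+1%:R / n.+2%:R = 1 + - n.+2%:R^-1 :> R.
  have -> : n.+1%:R = n.+2%:R - 1 :> R by rewrite -[n.+2%:R]natr1 addrK.
  by rewrite mulrBl divff ?gt_eqF // mul1r.
by apply: le_ln1Dx; rewrite ltrN2 invf_lt1 // ltr1n.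
Qed.

(** Since 2 gamma <= 1 and N / i >= 1, each square is at most N / i, which leaves a harmonic sum. *)
Lemma sum_vweight2_le : \sum_i W i ^+ 2 <= N%:R * (1 + ln N%:R).
Proof.
apply: (@le_trans _ _ (\sum_(i < N) N%:R * (i.+1%:R : R)^-1)).
  apply: ler_sum => i _; rewrite /W -powR_mulrn ?powR_ge0 // -powRrM.
  rewrite -[leRHS]powRr1 ?divr_ge0 // ler_powR ?ratio_ge1 //.
  by move: gamma1; lra.
rewrite -mulr_sumr ler_wpM2l //.
by case: N N0 => // n _; exact: harmonic_le.
Qed.

Lemma sum_vweight_le : \sum_i W i <= N%:R * (1 + ln N%:R).
Proof.
apply: le_trans sum_vweight2_le; apply: ler_sum => i _.
by rewrite expr2 ler_peMl ?vweight_ge1 // (le_trans ler01) // vweight_ge1.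
Qed.

Lemma powR_bernoulli (x s : R) : 0 <= x -> 0 < s <= 1 -> (1 + x) `^ s <= 1 + s * x.
Proof.
move=> x0 /andP[s0 s1].
have x1 : 0 <= 1 + x by rewrite addr_ge0.
move: s1; rewrite le_eqVlt => /predU1P[->|s1]; first by rewrite powRr1 // mul1r.
have s1' : 0 < 1 - s by rewrite subr_gt0.
(* Young's inequality for the product of (1 + x)^s and 1. *)
have := @conjugate_powR R ((1 + x) `^ s) 1 s^-1 (1 - s)^-1.
rewrite powR_ge0 ler01 !invr_gt0 s0 s1' !invrK => /(_ isT isT isT isT).
rewrite subrKC => /(_ erefl).
by rewrite mulr1 -powRrM mulfV ?gt_eqF // powRr1 // powR1 mul1r; lra.
Qed.

(** Comparison with the integral of x^(-s), done one term at a time with Bernoulli's inequality for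
    the primitive. *)
Lemma sum_powRN_ge (s : R) (m n : nat) : 0 <= s < 1 -> (m <= n)%N ->
  (n.+1%:R `^ (1 - s) - m.+1%:R `^ (1 - s)) / (1 - s) <=
  \sum_(m <= i < n) (i.+1%:R : R) `^ (- s).
Proof.
move=> /andP[s0 s1] mn; have s1' : 0 < 1 - s by rewrite subr_gt0.
rewrite ler_pdivrMr // -(subnKC mn); elim: (n - m)%N => [|k IH].
  by rewrite addn0 subrr big_geq // mul0r.
rewrite addnS big_nat_recr ?leq_addr //= mulrDl.
have i0 : 0 < (m + k).+1%:R :> R by rewrite ltr0n.
have step : (m + k).+2%:R `^ (1 - s) - (m + k).+1%:R `^ (1 - s) <=
    (m + k).+1%:R `^ (- s) * (1 - s) :> R.
  set y := (m + k).+1%:R in i0 *.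
  have -> : (m + k).+2%:R = y * (1 + y^-1) :> R.
    by rewrite mulrDr mulr1 mulfV ?gt_eqF // /y natr1.
  rewrite powRM ?addr_ge0 ?invr_ge0 ?(ltW i0) //.
  have B := @powR_bernoulli y^-1 (1 - s) _ _.
  have {}B : (1 + y^-1) `^ (1 - s) <= 1 + (1 - s) * y^-1.
    by apply: B; rewrite ?invr_ge0 ?(ltW i0) // s1' lerBlDr lerDl.
  apply: (@le_trans _ _ (y `^ (1 - s) * (1 + (1 - s) * y^-1) - y `^ (1 - s))).
    by rewrite lerB // ler_wpM2l // powR_ge0.
  rewrite mulrDr mulr1 addrAC subrr add0r mulrCA mulrC ler_wpM2r ?(ltW s1') //.
  rewrite -powR_inv1 ?(ltW i0) // -powRD; last by apply/implyP => _; rewrite gt_eqF.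
  by rewrite (_ : 1 - s + -1 = - s) // addrAC subrr add0r.
by move: IH step; lra.
Qed.

(** Indices beyond eps N have weight at most eps^(-gamma), and lowering the exponent from 2 gamma to
    s only decreases the terms because N / i >= 1. The 2 in [2 * eps] absorbs rounding: trunc(eps N)
    + 1 <= 2 eps N. *)
Lemma sum_vweight2_ge (s eps : R) : 0 <= s -> s < 1 -> s <= 2 * gamma -> 0 < eps < 1 ->
  1 <= eps * N%:R ->
  N%:R * (1 - (2 * eps) `^ (1 - s)) / (1 - s) <=
  \sum_(i | W i <= eps `^ (- gamma)) W i ^+ 2.
Proof.
move=> s0 s1 sg /andP[e0 e1] eN; have s1' : 0 < 1 - s by rewrite subr_gt0.
pose m := Num.trunc (eps * N%:R).
have eN0 : 0 <= eps * N%:R by rewrite mulr_ge0 // ltW.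
have mle : m%:R <= eps * N%:R :> R by rewrite truncn_le.
have mgt : eps * N%:R < m.+1%:R :> R by rewrite truncnS_gt.
have mN : (m <= N)%N.
  by rewrite -(ler_nat R) (le_trans mle) // ler_piMl // ltW.
apply: (@le_trans _ _ (\sum_(i < N | (m <= i)%N) N%:R `^ s * (i.+1%:R : R) `^ (- s))).
  rewrite -mulr_sumr -(big_mkord (fun i => (m <= i)%N) (fun i => (i.+1%:R : R) `^ (- s))).
  rewrite (_ : \sum_(0 <= i < N | (m <= i)%N) _ = \sum_(m <= i < N) (i.+1%:R : R) `^ (- s)); last first.
    by rewrite (big_nat_widenl m 0%N).
  have s01 : 0 <= s < 1 by rewrite s0.
  apply: le_trans (ler_wpM2l (powR_ge0 _ _) (sum_powRN_ge s01 mN)).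
  rewrite mulrA ler_wpM2r ?invr_ge0 ?(ltW s1') //.
  have NE : N%:R = N%:R `^ s * N%:R `^ (1 - s) :> R.
    rewrite -powRD; first by rewrite addrC subrK powRr1.
    by rewrite addrC subrK oner_eq0.
  rewrite {1}NE -mulrA ler_wpM2l ?powR_ge0 // mulrBr mulr1.
  apply: lerB.
    by rewrite ge0_ler_powR ?nnegrE ?(ltW s1') // ler_nat.
  rewrite -powRM ?mulr_ge0 ?(ltW e0) // ge0_ler_powR ?nnegrE ?(ltW s1') ?mulr_ge0 ?(ltW e0) //.
  by rewrite -natr1; move: mle eN; rewrite [eps * _]mulrC; lra.
rewrite big_mkcond [leRHS]big_mkcond; apply: ler_sum => i _.
case: ifP => mi; last by case: ifP => // _; exact: sqr_ge0.
have i0 : 0 < i.+1%:R :> R by rewrite ltr0n.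
have rle : N%:R / i.+1%:R <= eps^-1 :> R.
  rewrite ler_pdivrMr // ler_pdivlMl // (le_trans (ltW mgt)) // ler_nat ltnS.
  exact: mi.
have -> : W i <= eps `^ (- gamma).
  have -> : eps `^ (- gamma) = eps^-1 `^ gamma.
    by rewrite -[eps^-1]powR_inv1 ?(ltW e0) // -powRrM mulN1r.
  by rewrite /W ge0_ler_powR ?nnegrE ?divr_ge0 ?invr_ge0 ?(ltW e0).
have -> : N%:R `^ s * i.+1%:R `^ (- s) = (N%:R / i.+1%:R) `^ s :> R.
  by rewrite powRM ?invr_ge0 // -[i.+1%:R^-1]powR_inv1 // -powRrM mulN1r.
rewrite /W -powR_mulrn ?powR_ge0 // -powRrM.
by rewrite ler_powR ?ratio_ge1 // mulrC.
Qed.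

End Weights.

Section Degrees.
Variables (R : realType) (N : nat) (beta gamma : R).
Hypothesis beta0 : 0 < beta.
Hypothesis gamma0 : 0 <= gamma.
Hypothesis gamma1 : gamma <= 2^-1.
Hypothesis N0 : (0 < N)%N.

Local Notation W := (@vweight R N gamma).
Local Notation c := (beta / N%:R).
Local Notation EE := (bmean (edge_prob (N := N) beta gamma)).
Local Notation p01 := (edge_prob01 beta0 gamma0 N0).

Let c0 : 0 < c. Proof. by rewrite divr_gt0 // ltr0n. Qed.
Let W0 i : 0 <= W i. Proof. exact: le_trans ler01 (vweight_ge1 gamma0 i). Qed.

Let cW0 i : 0 <= c * W i. Proof. by apply: mulr_ge0 => //; exact: ltW. Qed.

Lemma degreeE s i : degree (graph_of (N := N) s) i = (\sum_(j | i != j) s (ordpair i j))%N.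
Proof.
rewrite /degree -sum1_card [LHS]big_mkcond [RHS]big_mkcond; apply: eq_bigr => j _.
by rewrite inE graph_ofE; case: eqP => //= _; case: (s _).
Qed.

Lemma edge_prob_le i j : i != j -> edge_prob beta gamma (ordpair i j) <= c * W i * W j.
Proof.
move=> ij; rewrite edge_probE // lerBlDr -lerBlDl.
have := expR_ge1Dx (- (c * W i * W j)); lra.
Qed.

Definition exp_degree (i : 'I_N) : R := c * W i * \sum_j W j.

Lemma exp_degree_ge0 i : 0 <= exp_degree i.
Proof. by apply: mulr_ge0 => //; exact: sumr_ge0. Qed.

Lemma degree_exp_moment i :
  EE (fun s => expR (degree (graph_of s) i)%:R) <= expR ((expR 1 - 1) * exp_degree i).
Proof.
have e1 : 0 <= expR 1 - 1 :> R by rewrite subr_ge0 -expR0 ler_expR.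
rewrite (eq_bmean _ (g := fun s => \prod_(j | i != j) expR (s (ordpair i j))%:R)); last first.
  by move=> s; rewrite degreeE natr_sum expR_sum.
rewrite (bmean_prod_indep _ (S := fun j => [set ordpair i j])).
- apply: (@le_trans _ _ (\prod_(j | i != j) expR ((expR 1 - 1) * (c * W i * W j)))).
    apply: ler_prod => j ij; rewrite (bmean_coord _ _ (fun b : bool => expR b%:R)) /= expR0.
    have /andP[q0 q1] := p01 (ordpair i j).
    have qle := edge_prob_le ij.
    set q := edge_prob _ _ _ in q0 q1 qle *.
    apply/andP; split; first by rewrite addr_ge0 // mulr_ge0 ?expR_ge0 // subr_ge0.
    rewrite (_ : q * expR 1 + (1 - q) * 1 = 1 + (expR 1 - 1) * q); last by ring.
    by apply: le_trans (expR_ge1Dx _) _; rewrite ler_expR ler_wpM2l.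
  rewrite -expR_sum ler_expR -!mulr_sumr /exp_degree ler_wpM2l //.
  rewrite ler_wpM2l // big_mkcond ler_sum // => j _.
  by case: ifP.
- by move=> j _ s s' ss'; rewrite ss' // finset.inE.
- move=> j k ij ik jk; rewrite disjoints1 finset.inE; apply/eqP.
  by move=> /(@ordpair_inj N)[[_ h]|[h _]]; [rewrite h eqxx in jk|rewrite h eqxx in ik].
Qed.

Lemma degree_tail i (D : R) :
  EE (fun s => (D <= (degree (graph_of s) i)%:R)%R%:R) <=
  expR ((expR 1 - 1) * exp_degree i - D).
Proof.
rewrite expRD mulrC.
apply: (@le_trans _ _ (expR (- D) * EE (fun s => expR (degree (graph_of s) i)%:R))); last first.
  by rewrite ler_wpM2l ?expR_ge0 // degree_exp_moment.
rewrite -bmeanZl; apply: (le_bmean p01) => s; case: (lerP D _) => h; last first.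
  by rewrite mulr_ge0 ?expR_ge0.
by rewrite -expRD -[leLHS]expR0 ler_expR addrC subr_ge0.
Qed.

Lemma degree_second_moment i :
  EE (fun s => (degree (graph_of s) i)%:R ^+ 2) <= exp_degree i + exp_degree i ^+ 2.
Proof.
pose Y j (s : {ffun 'I_N * 'I_N -> bool}) : R := ((i != j) && s (ordpair i j))%:R.
pose q j := c * W i * W j.
have q0 j : 0 <= q j by apply: mulr_ge0.
have qq0 j k : 0 <= q j * q k by apply: mulr_ge0.
have EY j : EE (Y j) <= q j.
  rewrite /Y; case: (eqVneq i j) => [_|ij] /=.
    by apply: le_trans (q0 j); rewrite /bmean big1 // => s _; rewrite mulr0.
  by rewrite (bmean_coord _ _ (fun b : bool => b%:R)) mulr1 mulr0 addr0 edge_prob_le.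
have Y0 j : 0 <= EE (Y j) by apply: (bmean_ge0 p01) => s; exact: ler0n.
rewrite (eq_bmean _ (g := fun s => \sum_j \sum_k Y j s * Y k s)); last first.
  move=> s; rewrite degreeE natr_sum big_mkcond expr2 big_distrlr /=.
  by apply: eq_bigr => j _; apply: eq_bigr => k _; rewrite /Y; do 2 case: eqP.
rewrite bmean_sum.
apply: (@le_trans _ _ (\sum_j (q j + \sum_k q j * q k))); last first.
  have <- : \sum_j q j = exp_degree i by rewrite /q -mulr_sumr.
  by rewrite big_split /= expr2 big_distrlr.
apply: ler_sum => j _; rewrite bmean_sum (bigD1 j) //= lerD //.
  apply: le_trans (EY j); rewrite le_eqVlt; apply/orP; left; apply/eqP.
  by apply: eq_bmean => s; rewrite /Y; case: (_ && _); rewrite ?mulr1 ?mulr0.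
rewrite [leRHS](bigD1 j) //= ler_wpDl //.
apply: ler_sum => k kj.
have [ij|ij] := eqVneq i j.
  rewrite /bmean big1 // => s _.
  by rewrite /Y {1}ij eqxx mul0r mulr0.
have [ik|ik] := eqVneq i k.
  rewrite /bmean big1 // => s _.
  by rewrite /Y -ik eqxx !mulr0.
rewrite (bmean_indep _ (S := [set ordpair i j]%SET) (S' := [set ordpair i k]%SET)).
- by apply: ler_pM.
- rewrite disjoints1 finset.inE; apply/eqP.
  by move=> /(@ordpair_inj N)[[_ h]|[h _]]; [rewrite h eqxx in kj|rewrite h eqxx in ik].
- by move=> s s' ss'; rewrite /Y ss' // finset.inE.
- by move=> s s' ss'; rewrite /Y ss' // finset.inE.
Qed.

Local Notation L := (1 + ln N%:R : R).

Lemma lnN_ge1 : 1 <= L.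
Proof. by rewrite lerDl ln_ge0 // ler1n. Qed.

Lemma exp_degree_le i : exp_degree i <= beta * L * W i.
Proof.
apply: (le_trans (ler_wpM2l (cW0 i) (sum_vweight_le gamma0 gamma1 N0))).
rewrite le_eqVlt; apply/orP; left; apply/eqP.
have : N%:R != 0 :> R by rewrite pnatr_eq0 -lt0n.
by move: (W i) (ln _) => w l n0; field.
Qed.

Lemma sum_degree2_mean :
  EE (fun s => \sum_i (degree (graph_of s) i)%:R ^+ 2) <= (beta + beta ^+ 2) * L ^+ 3 * N%:R.
Proof.
have L1 := lnN_ge1; have L0 : 0 <= L by exact: le_trans L1.
rewrite bmean_sum.
apply: (@le_trans _ _ (\sum_i (beta * L * W i ^+ 2 + (beta * L) ^+ 2 * W i ^+ 2))).
  apply: ler_sum => i _; apply: (le_trans (degree_second_moment i)); apply: lerD.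
    apply: (le_trans (exp_degree_le i)); rewrite ler_wpM2l ?mulr_ge0 ?(ltW beta0) //.
    by rewrite expr2 ler_peMl ?W0 // vweight_ge1.
  rewrite -exprMn lerXn2r ?nnegrE ?exp_degree_ge0 ?exp_degree_le //.
  by rewrite !mulr_ge0 ?(ltW beta0).
rewrite big_split /= -!mulr_sumr -mulrDl.
apply: le_trans (ler_wpM2l _ (sum_vweight2_le gamma1 N0)) _.
  by rewrite addr_ge0 ?sqr_ge0 // mulr_ge0 // ltW.
have -> : (beta + beta ^+ 2) * L ^+ 3 * N%:R =
  (beta * L ^+ 2 + (beta * L) ^+ 2) * (N%:R * L) by ring.
rewrite ler_wpM2r ?mulr_ge0 // lerD2r ler_wpM2l ?(ltW beta0) //.
by rewrite expr2 ler_peMl.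
Qed.

Lemma sum_degree2_tail (D : R) : 0 < D ->
  EE (fun s => (D <= \sum_i (degree (graph_of s) i)%:R ^+ 2)%R%:R) <=
  (beta + beta ^+ 2) * L ^+ 3 * N%:R / D.
Proof.
move=> D0; rewrite ler_pdivlMr // mulrC.
apply: le_trans sum_degree2_mean; rewrite -bmeanZl; apply: (le_bmean p01) => s.
case: (lerP D _) => [h|_]; first by rewrite mulr1.
by rewrite mulr0 sumr_ge0 // => i _; exact: sqr_ge0.
Qed.

End Degrees.

(** * Typical graphs *)

Section GoodGraph.
Variables (R : realType) (N : nat) (beta gamma : R).
Hypothesis beta0 : 0 < beta.
Hypothesis gamma0 : 0 <= gamma.
Hypothesis gamma1 : gamma <= 2^-1.
Hypothesis N0 : (0 < N)%N.

Local Notation W := (@vweight R N gamma).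
Local Notation c := (beta / N%:R).
Local Notation EE := (bmean (edge_prob (N := N) beta gamma)).
Local Notation p01 := (edge_prob01 beta0 gamma0 N0).

Variables (hub low : pred 'I_N).

Definition thin (g : sgraph 'I_N) : rel 'I_N :=
  fun i j => adjrel g i j && ~~ (hub i && hub j).

Lemma thin_sym g i j : thin g i j = thin g j i.
Proof. by rewrite /thin adjrel_sym [hub i && _]andbC. Qed.

Lemma thin_graph_of s : thin (graph_of s) = redge (@ordpair N) hub s.
Proof. by apply/funext => i; apply/funext => j; rewrite /thin /redge graph_ofE andbA. Qed.

Variables (M D Dsum : R) (r : nat) (S0 : {set 'I_N}).

Local Notation lweight := (lwt W low).
Local Notation m := (M / r.+1%:R).

Definition bad_alive (g : sgraph 'I_N) (v : 'I_N) : bool :=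
  (lweight (bball (thin g) [set v] r) < M) && ((bfs (thin g) [set v] r).2 != finset.set0).

Definition bad_start (g : sgraph 'I_N) (S : {set 'I_N}) : bool := lweight (bball (thin g) S r) < M.

Definition bad_bridge (g : sgraph 'I_N) (v1 v2 : 'I_N) (r1 r2 : nat) : bool :=
  [&& [disjoint bball (thin g) [set v1] r1 & bball (thin g) [set v2] r2],
     m <= lweight (bfs (thin g) [set v1] r1).2, m <= lweight (bfs (thin g) [set v2] r2).2 &
     ~~ [exists x in (bfs (thin g) [set v1] r1).2, exists y in (bfs (thin g) [set v2] r2).2,
          thin g x y]].

Definition degree2_sum (g : sgraph 'I_N) : R := \sum_i (degree g i)%:R ^+ 2.

(** Excluding the first, second and fourth events gives short walks; the third, a large component;
    the fifth, a lower bound on the rates along thin edges; the sixth, an upper bound on the total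
    rate. *)
Definition bad_graph (g : sgraph 'I_N) : bool :=
  [|| [exists v, bad_alive g v],
      [exists v, hub v && bad_start g [set v]],
      bad_start g S0,
      [exists v1, exists v2, exists r1 : 'I_r.+1, exists r2 : 'I_r.+1, bad_bridge g v1 v2 r1 r2],
      [exists i, ~~ hub i && (D <= (degree g i)%:R)] |
      Dsum <= degree2_sum g].

Section Probability.
Variables (t phim K a d w : R) (s q : nat).
Hypothesis low_hub : forall i, low i -> ~~ hub i.
Hypothesis low_le : forall j, low j -> W j <= phim.
Hypothesis phim0 : 0 <= phim.
Hypothesis cM : c * phim * M <= t.
Hypothesis t1 : 0 <= t <= 1.
Hypothesis HK : K <= (1 - t) ^+ 2 * (c * (\sum_(j | low j) W j ^+ 2 - phim * M)).
Hypothesis Kd : K = 1 + d.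
Hypothesis d0 : 0 <= d.
Hypothesis M1 : 1 <= M.
Hypothesis a0 : 0 <= a.
Hypothesis aphi : a * phim <= t.
Hypothesis aM : a * M <= K ^+ s.
Hypothesis rE : r = (s + q)%N.
Hypothesis q0 : (0 < q)%N.
Hypothesis w0M : 0 <= w <= M.
Hypothesis hub_w : forall i, hub i -> w <= W i.
Hypothesis S0w : w <= wt W S0.
Hypothesis S0M : lweight S0 <= M.
Hypothesis Dsum0 : 0 < Dsum.
Variable h : R.
Hypothesis nhub_h : forall i, ~~ hub i -> W i <= h.

Let c0 : 0 < c. Proof. by rewrite divr_gt0 // ltr0n. Qed.
Let W1 i : 1 <= W i. Proof. exact: vweight_ge1. Qed.
Let K1 : 1 <= K. Proof. by rewrite Kd lerDl. Qed.
Let pE i j : i != j -> edge_prob beta gamma (ordpair i j) = 1 - expR (- (c * W i * W j)).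
Proof. exact: edge_probE. Qed.

Lemma bad_alive_prob v : EE (fun x => (bad_alive (graph_of x) v)%:R) <= expR (1 - a * d * q%:R).
Proof.
have := exploration_alive p01 (@ordpair_inj N) W1 c0 pE low_hub low_le phim0 cM t1 HK
  [set v] q Kd d0 M1 a0 aphi aM.
by rewrite -rE; congr (_ <= _); apply: eq_bmean => x; rewrite /bad_alive thin_graph_of.
Qed.

Lemma bad_start_prob S : lweight S <= M -> w <= wt W S ->
  EE (fun x => (bad_start (graph_of x) S)%:R) <= expR (1 - a * w).
Proof.
move=> SM wS.
have H := exploration_heavy p01 (@ordpair_inj N) W1 c0 pE low_hub low_le phim0 cM t1 HK
  K1 a0 aphi aM w0M SM wS.
apply: le_trans H; apply: (le_bmean p01) => x; rewrite /bad_start thin_graph_of.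
case: (ltP (lweight (bball _ S r)) M) => // h1; rewrite (le_lt_trans _ h1) //.
(* [exploration_heavy] speaks of s + 1 levels, and r = s + q with q >= 1. *)
by rewrite (lwtS _ W1) // bball_mono // rE -addn1 leq_add2l.
Qed.

Lemma bad_bridge_prob v1 v2 r1 r2 :
  EE (fun x => (bad_bridge (graph_of x) v1 v2 r1 r2)%:R) <= expR (- (c * m ^+ 2)).
Proof.
have m0 : 0 <= m by rewrite divr_ge0 // (le_trans ler01).
have := no_bridge p01 (@ordpair_inj N) W1 c0 pE low_hub [set v1] [set v2] r1 r2 m0.
by congr (_ <= _); apply: eq_bmean => x; rewrite /bad_bridge thin_graph_of.
Qed.

Local Notation L := (1 + ln N%:R : R).

Lemma bad_degree_prob i :
  EE (fun x => (~~ hub i && (D <= (degree (graph_of x) i)%:R))%:R) <=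
  expR ((expR 1 - 1) * (beta * L * h) - D).
Proof.
have [hi|hi] := boolP (hub i).
  by rewrite /bmean big1 ?expR_ge0 // => x _; rewrite mulr0.
apply: (le_trans (degree_tail beta0 gamma0 N0 i D)).
have e1 : 0 <= expR 1 - 1 :> R by rewrite subr_ge0 -expR0 ler_expR.
rewrite ler_expR lerD2r ler_wpM2l //.
apply: (le_trans (exp_degree_le beta0 gamma0 gamma1 N0 i)).
rewrite ler_wpM2l ?nhub_h // mulr_ge0 ?(ltW beta0) //.
by apply: le_trans (lnN_ge1 R N0).
Qed.

Lemma boolr_or (b1 b2 : bool) : ((b1 || b2)%:R : R) <= b1%:R + b2%:R.
Proof. by case: b1; case: b2; rewrite /= ?lerDl ?addr0 ?add0r. Qed.

Lemma boolr_exists (I : finType) (P : pred I) : (([exists i, P i])%:R : R) <= \sum_i (P i)%:R.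
Proof.
case: existsP => [[i Pi]|_]; last exact: sumr_ge0.
by rewrite (bigD1 i) //= Pi lerDl sumr_ge0.
Qed.

Local Notation sample := {ffun 'I_N * 'I_N -> bool}.

Lemma union_bound (I : finType) (n : nat) (P : sample -> pred I) (b : R) : #|I| = n ->
  (forall i, EE (fun x => (P x i)%:R) <= b) -> EE (fun x => ([exists i, P x i])%:R) <= n%:R * b.
Proof.
move=> <- Pb; apply: (@le_trans _ _ (EE (fun x => \sum_i (P x i)%:R))).
  by apply: (le_bmean p01) => x; exact: boolr_exists.
rewrite bmean_sum (le_trans (ler_sum (G := fun=> b) _ _)) //.
by rewrite sumr_const mulr_natl.
Qed.

Lemma or_bound (b1 b2 : sample -> bool) (u1 u2 : R) :
  EE (fun x => (b1 x)%:R) <= u1 -> EE (fun x => (b2 x)%:R) <= u2 ->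
  EE (fun x => (b1 x || b2 x)%:R) <= u1 + u2.
Proof.
move=> h1 h2; apply: le_trans (lerD h1 h2); rewrite -bmeanD.
by apply: (le_bmean p01) => x; exact: boolr_or.
Qed.

Lemma bad_graph_prob : EE (fun x => (bad_graph (graph_of x))%:R) <=
  N%:R * expR (1 - a * d * q%:R) + (N%:R * expR (1 - a * w) + (expR (1 - a * w) +
  (N%:R * (N%:R * (r.+1%:R * (r.+1%:R * expR (- (c * m ^+ 2))))) +
  (N%:R * expR ((expR 1 - 1) * (beta * L * h) - D) +
   (beta + beta ^+ 2) * L ^+ 3 * N%:R / Dsum)))).
Proof.
rewrite /bad_graph; apply: or_bound.
  by apply: union_bound => [|v]; [exact: card_ord|exact: bad_alive_prob].
apply: or_bound.
  apply: union_bound => [|v]; first exact: card_ord.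
  have [hv|hv] := boolP (hub v); last first.
    by rewrite /bmean big1 ?expR_ge0 // => x _; rewrite mulr0.
  apply: bad_start_prob; last by rewrite /wt big_set1 hub_w.
  rewrite /lwt big_set1 /lw; case: ifP => [/low_hub|_]; first by rewrite hv.
  by rewrite (le_trans ler01).
apply: or_bound; first exact: bad_start_prob.
apply: or_bound.
  do 2 (apply: union_bound => [|?]; first exact: card_ord).
  do 2 (apply: union_bound => [|?]; first exact: card_ord).
  exact: bad_bridge_prob.
apply: or_bound; last exact: sum_degree2_tail.
by apply: union_bound => [|i]; [exact: card_ord|exact: bad_degree_prob].
Qed.

End Probability.

Section Consequences.
Variable g : sgraph 'I_N.
Hypothesis good : ~~ bad_graph g.

Let W0 i : 0 <= W i. Proof. exact: le_trans ler01 (vweight_ge1 gamma0 i). Qed.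

Lemma lweightU (A B : {set 'I_N}) : lweight (A :|: B) <= lweight A + lweight B.
Proof.
rewrite /lwt [leLHS](big_setID A) /= finset.setUK lerD2l.
rewrite [leRHS](big_setID (B :\: A)) /=.
have -> : (A :|: B) :\: A = B :&: (B :\: A).
  by apply/setP => z; rewrite !finset.inE; case: (z \in A); case: (z \in B).
by rewrite lerDl sumr_ge0 // => j _; exact: lw_ge0 (vweight_ge1 gamma0) j.
Qed.

Lemma good_walk a b : conn g a b -> walk (thin g) r.*2.+1 a b.
Proof.
move: good; rewrite /bad_graph !negb_or => /and5P[b1 b2 _ b3 _].
apply: (@hub_connect_walk _ _ (thin_sym g) _ lweight lweightU _ r M hub _ _ _ (adjrel g)).
- by rewrite /lwt finset.big_set0.
- move=> v; have := existsPn b1 v; rewrite /bad_alive negb_and negbK -leNgt => /orP[|/eqP].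
    by right.
  by left.
- by move=> v hv; have := existsPn b2 v; rewrite hv /= /bad_start -leNgt.
- move=> v1 v2 r1 r2 r1r r2r.
  have /existsPn/(_ v2)/existsPn/(_ (Ordinal (r1r : (r1 < r.+1)%N))) := existsPn b3 v1.
  by move=> /existsPn/(_ (Ordinal (r2r : (r2 < r.+1)%N))).
- by move=> i j ij; rewrite /thin ij /=; case: (_ && _).
Qed.

(** A thin edge has a non-hub endpoint, whose degree lies between 1 and D. The absolute value of
    theta covers both signs at once. *)
Lemma good_rate theta i j : thin g i j ->
  2^-1 * (D `^ (- `|theta|) * D^-1) <= rate theta g i j.
Proof.
have H x y : ~~ hub x -> adjrel g x y ->
    2^-1 * (D `^ (- `|theta|) * D^-1) <= half_rate theta g x y.
  move=> hx xy; rewrite /half_rate xy ler_wpM2l ?invr_ge0 //.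
  move: good; rewrite /bad_graph !negb_or => /and5P[_ _ _ _ /andP[/existsPn/(_ x)]].
  rewrite hx /= -ltNge => dD _.
  have d1 : 1 <= (degree g x)%:R :> R.
    by rewrite ler1n; apply/card_gt0P; exists y; rewrite inE.
  set dx := (degree g x)%:R in dD d1 *.
  have dx0 : 0 < dx by exact: lt_le_trans d1.
  have D0 : 0 < D by exact: lt_trans dD.
  apply: ler_pM; rewrite ?powR_ge0 ?invr_ge0 ?(ltW D0) //.
    apply: (@le_trans _ _ (dx `^ (- `|theta|))).
      rewrite !powRN lef_pV2 ?posrE ?powR_gt0 //.
      by rewrite ge0_ler_powR ?nnegrE ?(ltW dx0) ?(ltW D0) // ltW.
    by rewrite ler_powR // lerNl -normrN ler_norm.
  by rewrite lef_pV2 ?posrE // ltW.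
rewrite /thin negb_and => /andP[ij /orP[hi|hj]].
  by apply: (le_trans (H _ _ hi ij)); rewrite /rate lerDl half_rate_ge0.
rewrite adjrel_sym in ij.
by apply: (le_trans (H _ _ hj ij)); rewrite /rate lerDr half_rate_ge0.
Qed.

Lemma good_rate_sum theta : theta <= 2 -> rate_sum theta g <= Dsum.
Proof.
move=> th2; move: good; rewrite /bad_graph !negb_or => /and5P[_ _ _ _ /andP[_]].
rewrite -ltNge => /ltW; apply: le_trans.
have -> : rate_sum theta g = 2 * \sum_i \sum_j half_rate theta g i j.
  rewrite /rate_sum /rate; under eq_bigr do rewrite big_split /=.
  rewrite big_split /= [X in _ + X]exchange_big /=.
  by rewrite mulrDl mul1r.
rewrite mulr_sumr; apply: ler_sum => i _.
have -> : \sum_j half_rate theta g i j =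
    2^-1 * ((degree g i)%:R * ((degree g i)%:R `^ theta * (degree g i)%:R^-1)).
  rewrite /half_rate -big_mkcond /= sumr_const -[LHS]mulr_natl [LHS]mulrCA; congr (_ * (_%:R * _)).
(* Isolated vertices are treated apart: 0 to the power theta is 1 when theta = 0, but there it is
   multiplied by an empty number of neighbours. *)
rewrite mulVKf //; have [->|d0] := eqVneq (degree g i) 0%N; first by rewrite mul0r sqr_ge0.
have d1 : 1 <= (degree g i)%:R :> R by rewrite ler1n lt0n.
rewrite mulrCA mulfV ?mulr1 ?pnatr_eq0 // -powR_mulrn ?ler_powR //.
Qed.

(** Low vertices weigh at most [phim], so a ball of low weight M has at least M / phim vertices.
    They are spread over the components of the seeds, so one component C has at least Z of them, and
    it contributes |C| (|C| - 1) ordered pairs. *)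
Lemma good_pairs (phim Z : R) : (forall j, low j -> W j <= phim) -> 0 < phim -> 1 <= Z ->
  (0 < #|S0|)%N -> Z * (phim * #|S0|%:R) <= M -> Z * (Z - 1) <= pairs_conn R g.
Proof.
move=> low_le phim0 Z1 S00 ZM.
move: good; rewrite /bad_graph !negb_or => /and5P[_ _ b2 _ _].
have {b2} big : M <= lweight (bball (thin g) S0 r) by rewrite leNgt.
pose comp s := [set x | conn g s x]%SET.
have cover : lweight (bball (thin g) S0 r) <= phim * \sum_(s in S0) #|comp s|%:R.
  apply: (@le_trans _ _ (phim * #|bball (thin g) S0 r|%:R)).
    rewrite /lwt -sum1_card natr_sum mulr_sumr; apply: ler_sum => x _.
    by rewrite mulr1 /lw; case: ifP => [/low_le|_] //; exact: ltW.
  rewrite ler_wpM2l ?(ltW phim0) // -natr_sum ler_nat.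
  apply: (@leq_trans #|\bigcup_(s in S0) comp s|).
    apply/subset_leq_card/fintype.subsetP => x /bball_walk[s sS [p [pp _ lp]]].
    apply/finset.bigcupP; exists s => //; rewrite finset.inE.
    apply/connectP; exists p => //.
    by apply: sub_path pp => y z /andP[].
  elim/big_rec2: _ => [|s A n _ AB]; first by rewrite cards0.
  by apply: leq_trans (leq_card_setU _ _) _; rewrite leq_add2l.
have [s sS Zs] : exists2 s, s \in S0 & Z <= #|comp s|%:R.
  apply: contrapT => nex.
  have lt s : s \in S0 -> #|comp s|%:R < Z.
    by move=> sS; rewrite ltNge; apply/negP => h; apply: nex; exists s.
  have : \sum_(s in S0) #|comp s|%:R < \sum_(s in S0) Z.
    have [s0 s0S] : exists s0, s0 \in S0 by apply/card_gt0P.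
    rewrite (bigD1 s0) //= [ltRHS](bigD1 s0) //=; apply: ltr_leD; first exact: lt.
    by apply: ler_sum => s /andP[sS _]; apply/ltW/lt.
  rewrite sumr_const -mulr_natl => h.
  have : phim * \sum_(s in S0) #|comp s|%:R < Z * (phim * #|S0|%:R).
    by rewrite mulrCA ltr_pM2l // mulrC.
  by rewrite ltNge (le_trans ZM) // (le_trans big).
set C := comp s in Zs.
have cards : (#|C| * #|C| <= #|[set q : 'I_N * 'I_N | conn g q.1 q.2 && (q.1 != q.2)]| + #|C|)%N.
  rewrite -cardsX -(card_imset C (f := fun x => (x, x))) => [|x y [] //].
  apply: leq_trans (leq_card_setU _ _); apply/subset_leq_card/fintype.subsetP => -[x y].
  rewrite !finset.inE /= => /andP[sx sy].
  have xy : conn g x y by apply: conn_trans sy; rewrite conn_sym.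
  rewrite xy /=; case: eqVneq => //= exy.
  by apply/imsetP; exists x; rewrite ?finset.inE // exy.
have {cards} : #|C|%:R * #|C|%:R <= pairs_conn R g + #|C|%:R :> R.
  by rewrite -natrM -natrD ler_nat.
rewrite -lerBlDr => /(le_trans _); apply.
have -> : #|C|%:R * #|C|%:R - #|C|%:R = #|C|%:R * (#|C|%:R - 1) :> R by ring.
by apply: ler_pM; lra.
Qed.

End Consequences.
End GoodGraph.

(** * Mean consensus time on a typical graph *)

Section TauBounds.
Variables (R : realType) (N : nat) (beta gamma u theta : R).
Hypothesis gamma0 : 0 <= gamma.
Hypothesis N0 : (0 < N)%N.
Hypothesis u01 : 0 < u < 1.
Hypothesis theta2 : theta <= 2.
Variables (hub low : pred 'I_N) (M D Dsum : R) (r : nat) (S0 : {set 'I_N}) (g : sgraph 'I_N).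
Hypothesis good : ~~ bad_graph gamma hub low M D Dsum r S0 g.
Hypothesis D0 : 0 < D.
Hypothesis Dsum0 : 0 < Dsum.
Context d (T : measurableType d) (P : probability T R) (X : R -> T -> config 'I_N).
Hypothesis HX : is_voter_model theta u g P X.

Local Notation kappa := (2^-1 * (D `^ (- `|theta|) * D^-1)).

Let kappa0 : 0 < kappa.
Proof. by rewrite !mulr_gt0 ?invr_gt0 // powR_gt0. Qed.

Let card0 : (0 < #|'I_N|)%N. Proof. by rewrite card_ord. Qed.

Lemma good_tau_le : (\int[P]_w tau_cons g X w <=
  (2 * (N%:R * r.*2.+1%:R ^+ 2 / kappa * ln (2 * N%:R ^+ 3)))%:E)%E.
Proof.
have := mean_tau_le HX kappa0 (ltn0Sn r.*2) card0
  (good_rate good theta) (good_walk gamma0 good).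
by rewrite card_ord.
Qed.

Lemma good_tau_ge (phim Z : R) : (forall j, low j -> vweight gamma j <= phim) -> 0 < phim ->
  1 <= Z -> (0 < #|S0|)%N -> Z * (phim * #|S0|%:R) <= M ->
  (((u * (1 - u)) ^+ 2 * (Z * (Z - 1)) ^+ 2 / (2 * Dsum * N%:R ^+ 2))%:E <=
   \int[P]_w tau_cons g X w)%E.
Proof.
move=> lowphi phim0 Z1 S00 ZM.
have := mean_tau_ge u01 HX kappa0 (ltn0Sn r.*2) card0
  (good_rate good theta) (good_walk gamma0 good) Dsum0 (good_rate_sum good theta2).
rewrite card_ord; apply: le_trans; rewrite lee_fin.
have N0' : 0 < N%:R :> R by rewrite ltr0n.
rewrite ler_wpM2r ?invr_ge0 ?mulr_ge0 ?(ltW Dsum0) ?exprn_ge0 ?(ltW N0') //.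
rewrite ler_wpM2l ?sqr_ge0 // lerXn2r ?nnegrE //.
  by rewrite mulr_ge0 // ?subr_ge0 // (le_trans ler01).
exact: good_pairs good _ _ lowphi phim0 Z1 S00 ZM.
Qed.

End TauBounds.

(** * Choice of the parameters *)

Section Asymptotics.
Local Open Scope classical_set_scope.
Variable R : realType.

Lemma ln_large (A : R) : \forall N \near \oo, A <= ln N%:R.
Proof.
near=> N.
have h : (Num.trunc (expR A)).+1%:R <= N%:R :> R.
  by rewrite ler_nat; near: N; exact: nbhs_infty_ge.
rewrite -[A]expRK ler_ln ?posrE ?expR_gt0 //.
  by apply: (le_trans _ h); apply/ltW/truncnS_gt.
exact: lt_le_trans h.
Unshelve. all: by end_near.
Qed.

Lemma polylog_le (A : R) (k : nat) : \forall N \near \oo, A * (1 + ln N%:R) ^+ k <= N%:R.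
Proof.
near=> N.
have l1 : 1 <= ln N%:R :> R by near: N; exact: ln_large.
have lA : `|A| * 2 ^+ k * k.+1`!%:R <= ln N%:R :> R by near: N; exact: ln_large.
have N0 : (0 < N)%N by near: N; exact: nbhs_infty_gt.
have NR0 : 0 < N%:R :> R by rewrite ltr0n.
set l := ln N%:R in l1 lA *.
have l0 : 0 <= l by exact: le_trans l1.
have f0 : 0 < k.+1`!%:R :> R by rewrite ltr0n fact_gt0.
have e : l ^+ k.+1 / k.+1`!%:R <= N%:R :> R.
  have := expR_ge1Dxn k l0; rewrite lnK ?posrE // => h.
  by apply: le_trans h; rewrite lerDr.
apply: le_trans e; rewrite ler_pdivlMr //.
apply: (@le_trans _ _ (`|A| * (2 * l) ^+ k * k.+1`!%:R)).
  rewrite ler_wpM2r ?(ltW f0) // (le_trans (ler_wpM2r _ (ler_norm A))) //.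
    by rewrite exprn_ge0 // addr_ge0.
  rewrite ler_wpM2l // lerXn2r ?nnegrE ?mulr_ge0 ?addr_ge0 //; lra.
rewrite exprMn mulrA mulrAC exprS ler_wpM2r ?exprn_ge0 //.
Unshelve. all: by end_near.
Qed.

(* At [gamma = 1/2] the weight exponent is first lowered to [s / 2] with
   [1 - s < beta], so that a single computation covers both cases. *)
Lemma low_mass_constants (beta gamma : R) : 0 <= gamma -> gamma <= 2^-1 -> 0 < beta ->
  1 - 2 * gamma < beta ->
  exists phim sigma : R, [/\ 1 <= phim, 1 < sigma &
    \forall N \near \oo, sigma <= beta / N%:R * (\sum_(i < N | vweight gamma i <= phim)
      vweight gamma i ^+ 2)].
Proof.
move=> g0 g1 b0 bg.
have [s [s0 s1 sg sb]] : exists s, [/\ 0 <= s, s < 1, s <= 2 * gamma & 1 - s < beta].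
  have [g2|g2] := ltP (2 * gamma) 1.
    by exists (2 * gamma); split => //; rewrite mulr_ge0.
  (* Here 2 gamma = 1. The choice gives 1 - s <= beta / 2, and the maximum keeps s nonnegative when
     beta > 2. *)
  pose s : R := Num.max 0 (1 - beta / 2).
  exists s; split.
  - by rewrite /s le_max lexx.
  - by rewrite /s gt_max ltr01 ltrBlDr ltrDl divr_gt0.
  - by rewrite /s ge_max; apply/andP; split; lra.
  - have : 1 - beta / 2 <= s by rewrite /s le_max lexx orbT.
    by lra.
have s1' : 0 < 1 - s by rewrite subr_gt0.
pose rho := beta / (1 - s).
have rho1 : 1 < rho by rewrite /rho ltr_pdivlMr // mul1r.
(* The proportion of mass that may be cut off: rho (1 - y) is the midpoint of 1 and rho. [eps] below
   is then the solution of (2 eps)^(1 - s) = y. *)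
pose y : R := (1 - rho^-1) / 2.
have rhoV : 0 < rho^-1 < 1 by rewrite invr_gt0 (lt_trans ltr01) //= invf_lt1 // (lt_trans ltr01).
have y0 : 0 < y < 1 by rewrite /y; apply/andP; split; move: rhoV => /andP[]; lra.
pose eps := y `^ (1 - s)^-1 / 2.
have yp : 0 < y `^ (1 - s)^-1 by rewrite powR_gt0 //; case/andP: y0.
have yp1 : y `^ (1 - s)^-1 <= 1.
  have /andP[ya yb] := y0.
  by rewrite -[leRHS](powRr0 y) ger_powR ?ya ?(ltW yb) // invr_ge0 ltW.
have eps01 : 0 < eps < 1.
  by rewrite /eps; apply/andP; split; lra.
exists (eps `^ (- gamma)), ((rho + 1) / 2); split.
- have /andP[e0 e1] := eps01.
  by rewrite -[leLHS](powRr0 eps) ger_powR ?e0 ?(ltW e1) // oppr_le0.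
- lra.
near=> N.
have /andP[e0 e1] := eps01.
have N0 : (0 < N)%N by near: N; exact: nbhs_infty_gt.
have NR0 : 0 < N%:R :> R by rewrite ltr0n.
have eN : 1 <= eps * N%:R.
  rewrite mulrC -ler_pdivrMr // mul1r.
  have : eps^-1 * (1 + ln N%:R) ^+ 0 <= N%:R by near: N; exact: polylog_le.
  by rewrite expr0 mulr1.
apply: (le_trans _ (ler_wpM2l _ (sum_vweight2_ge g0 s0 s1 sg eps01 eN))); last first.
  by rewrite divr_ge0 // ltW.
have -> : (2 * eps) `^ (1 - s) = y.
  rewrite /eps mulrC divfK // -powRrM mulVf ?gt_eqF // powRr1 //.
  by case/andP: y0 => /ltW.
have -> : beta / N%:R * (N%:R * (1 - y) / (1 - s)) = rho * (1 - y).
  by rewrite /rho; field; rewrite !gt_eqF.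
rewrite /y (_ : rho * _ = (rho + 1) / 2) //.
by field; rewrite gt_eqF // (lt_trans ltr01).
Unshelve. all: by end_near.
Qed.

End Asymptotics.

Section Choice.
Variables (R : realType) (beta gamma phim sigma : R).
Hypothesis beta0 : 0 < beta.
Hypothesis gamma0 : 0 <= gamma.
Hypothesis gamma1 : gamma <= 2^-1.
Hypothesis phim1 : 1 <= phim.
Hypothesis sigma1 : 1 < sigma.

(* [slack] is the solution of [sigma - slack * (1 + 2 * sigma) = 1 + gain], which
   gives [1 + gain <= (1 - slack) ^+ 2 * (sigma - slack)]; see [growth_margin]. *)
Definition gain : R := (sigma - 1) / 2.
Definition slack : R := (sigma - 1) / (2 * (1 + 2 * sigma)).
Definition tilt : R := slack / phim.
(** The second term of the minimum makes [c * phim * M] at most [slack] for M = [density * N]. *)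
Definition density : R := Num.min 1 (slack / (beta * phim)).

(** Chosen so that [tilt * heavy N] is 2 ln N: failure then has probability of order N^(-2), which
    survives a union over N vertices. The 2 in [rounds_alive] has the same origin, while
    [rounds_growth] levels multiply the weight by at least N. *)
Definition heavy (N : nat) : R := 2 * ln N%:R / tilt.
Definition rounds_alive (N : nat) : nat := (Num.trunc (2 * ln N%:R / (tilt * gain))).+1.
Definition rounds_growth (N : nat) : nat := (Num.trunc (ln N%:R / ln (1 + gain))).+1.
Definition rounds (N : nat) : nat := rounds_growth N + rounds_alive N.
Definition target (N : nat) : R := density * N%:R.
(** A non-hub has mean degree at most a constant times L * heavy, of order L^2 with L = 1 + ln N;
    the final + 2 leaves a Chernoff margin of 2 ln N. The maximum with 1 makes powers of
    [max_degree] monotone in the exponent. *)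
Definition Cdeg : R := Num.max 1 ((expR 1 - 1) * beta * (2 / tilt) + 2).
Definition max_degree (N : nat) : R := Cdeg * (1 + ln N%:R) ^+ 2.
(** One logarithm above the bound on the mean, so that Markov's inequality gives probability 1 / (1
    + ln N). *)
Definition max_degree2 (N : nat) : R := (beta + beta ^+ 2) * (1 + ln N%:R) ^+ 4 * N%:R.
(* Exploring from many seeds at once succeeds with high probability, hence one
   of them lies in a component of size at least [N] over a power of [ln N]. *)
Definition seeds (N : nat) : {set 'I_N} := [set i : 'I_N | (i < (Num.trunc (heavy N)).+1)%N].
Definition Crounds : R := 2 / (tilt * gain) + (ln (1 + gain))^-1 + 3.
Definition Cseeds : R := 2 / tilt + 1.
Definition is_hub (N : nat) : pred 'I_N := fun i => heavy N < vweight gamma i.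
Definition is_low (N : nat) : pred 'I_N := fun i => vweight gamma i <= phim.

Definition bad (N : nat) : pred (sgraph 'I_N) :=
  bad_graph gamma (@is_hub N) (@is_low N) (target N) (max_degree N) (max_degree2 N)
    (rounds N) (seeds N).

Lemma gain_gt0 : 0 < gain. Proof. by rewrite divr_gt0 // subr_gt0. Qed.

Lemma slack01 : 0 < slack < 1.
Proof.
have h : 0 < 2 * (1 + 2 * sigma) by move: sigma1; lra.
rewrite /slack ltr_pdivrMr // mul1r divr_gt0 ?subr_gt0 //=.
by move: sigma1; lra.
Qed.

Lemma phim_gt0 : 0 < phim. Proof. exact: lt_le_trans phim1. Qed.

Lemma tilt_gt0 : 0 < tilt.
Proof. by case/andP: slack01 => s0 _; rewrite divr_gt0 // phim_gt0. Qed.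

Lemma tilt_le1 : tilt <= 1.
Proof.
case/andP: slack01 => s0 s1.
by rewrite ler_pdivrMr ?phim_gt0 // mul1r (le_trans (ltW s1)).
Qed.

Lemma density_gt0 : 0 < density.
Proof.
by case/andP: slack01 => s0 _; rewrite lt_min ltr01 divr_gt0 // mulr_gt0 // phim_gt0.
Qed.

Lemma density_le1 : density <= 1. Proof. by rewrite ge_min lexx. Qed.

Lemma density_slack : beta * phim * density <= slack.
Proof.
have h : 0 < beta * phim by rewrite mulr_gt0 // phim_gt0.
by rewrite mulrC -ler_pdivlMr // ge_min lexx orbT.
Qed.

Lemma ln_gain_gt0 : 0 < ln (1 + gain).
Proof. by rewrite ln_gt0 // ltrDl gain_gt0. Qed.

Lemma growth_margin (x : R) : sigma <= x + slack -> 1 + gain <= (1 - slack) ^+ 2 * x.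
Proof.
case/andP: slack01 => s0 s1 h.
have hs : slack * (1 + 2 * sigma) = gain.
  by rewrite /slack /gain; field; move: sigma1; lra.
have : (1 - 2 * slack) * (sigma - slack) <= (1 - slack) ^+ 2 * x.
  apply: (@le_trans _ _ ((1 - slack) ^+ 2 * (sigma - slack))).
    rewrite ler_wpM2r //; last by rewrite sqrrB; nra.
    by move: sigma1; lra.
  by rewrite ler_wpM2l ?sqr_ge0 //; lra.
move: hs; rewrite /gain; nra.
Qed.

Lemma Cseeds_ge1 : 1 <= Cseeds.
Proof. by rewrite /Cseeds lerDr divr_ge0 // ltW // tilt_gt0. Qed.

Section FixedSize.
Variable N : nat.
Local Notation l := (ln N%:R : R).
Local Notation L := (1 + ln N%:R : R).
Hypothesis N0 : (0 < N)%N.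
Hypothesis l1 : 1 <= l.

Let NR0 : 0 < N%:R :> R. Proof. by rewrite ltr0n. Qed.
Let l0 : 0 <= l. Proof. exact: le_trans l1. Qed.

Lemma rounds_le : (rounds N).+1%:R <= Crounds * L.
Proof.
have tg : 0 < tilt * gain by rewrite mulr_gt0 ?tilt_gt0 ?gain_gt0.
have A : 0 <= 2 * l / (tilt * gain).
  by apply: divr_ge0; [exact: mulr_ge0|exact: ltW].
have B : 0 <= l / ln (1 + gain) by rewrite divr_ge0 // ltW // ln_gain_gt0.
have [i iE A'] : exists2 i, i = (Num.trunc (2 * l / (tilt * gain)))%:R :> R &
    i <= 2 * l / (tilt * gain).
  by eexists; first by []; rewrite truncn_le.
have [j jE B'] : exists2 j, j = (Num.trunc (l / ln (1 + gain)))%:R :> R &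
    j <= l / ln (1 + gain).
  by eexists; first by []; rewrite truncn_le.
have -> : (rounds N).+1%:R = j + i + 3 :> R.
  rewrite iE jE /rounds /rounds_growth /rounds_alive addSn addnS -[_.+3]addn3 natrD natrD.
  by [].
rewrite /Crounds; set x := 2 / (tilt * gain); set y := (ln (1 + gain))^-1.
have x0 : 0 <= x by rewrite divr_ge0 // ltW.
have y0 : 0 <= y by rewrite invr_ge0 ltW // ln_gain_gt0.
have Ax : 2 * l / (tilt * gain) = x * l by rewrite /x mulrAC.
have By : l / ln (1 + gain) = y * l by rewrite mulrC.
rewrite Ax in A'; rewrite By in B'.
by move: l1 A' B' x0 y0; move: (ln N%:R) => z; nra.
Qed.

Lemma heavy_ge0 : 0 <= heavy N.
Proof. by apply: divr_ge0; [exact: mulr_ge0|exact/ltW/tilt_gt0]. Qed.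

Lemma seeds_le : (Num.trunc (heavy N)).+1%:R <= Cseeds * L.
Proof.
have h : (Num.trunc (heavy N))%:R <= heavy N :> R by rewrite truncn_le heavy_ge0.
rewrite -natr1; apply: le_trans (lerD h (lexx _)) _.
have -> : heavy N = 2 / tilt * l by rewrite /heavy mulrAC.
rewrite /Cseeds; set x := 2 / tilt; have x0 : 0 <= x by rewrite divr_ge0 // ltW // tilt_gt0.
by move: l1; nra.
Qed.

Lemma exp_small (k : nat) (x : R) : k%:R * l <= x -> expR (- x) <= (N%:R ^+ k)^-1.
Proof.
move=> kx; rewrite expRN lef_pV2 ?posrE ?expR_gt0 ?exprn_gt0 //.
by rewrite -[X in X ^+ k](@lnK R) ?posrE // -expRM_natl ler_expR.
Qed.

Hypothesis size_mass : sigma <= beta / N%:R *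
  (\sum_(i < N | vweight gamma i <= phim) vweight gamma i ^+ 2).
Hypothesis size_phim : tilt * phim <= l.
Hypothesis size_target : phim * Cseeds * L <= density * N%:R.
Hypothesis size_rounds : 4 * Crounds ^+ 2 / (beta * density ^+ 2) * L ^+ 3 <= N%:R.
Hypothesis size_rounds2 : Crounds ^+ 2 * L ^+ 2 <= N%:R.

Let L1 : 1 <= L. Proof. by rewrite lerDl. Qed.
Let L0 : 0 < L. Proof. exact: lt_le_trans L1. Qed.

Lemma seeds_card_le : ((Num.trunc (heavy N)).+1 <= N)%N.
Proof.
rewrite -(ler_nat R); apply: (le_trans seeds_le).
have CL : 0 <= Cseeds * L by rewrite mulr_ge0 ?(ltW L0) // (le_trans ler01) // Cseeds_ge1.
apply: (@le_trans _ _ (phim * Cseeds * L)); first by rewrite -mulrA ler_peMl.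
by apply: (le_trans size_target); rewrite ler_piMl ?density_le1.
Qed.

Lemma seeds_card : #|seeds N| = (Num.trunc (heavy N)).+1.
Proof.
have H := seeds_card_le; rewrite /seeds -sum1_card.
rewrite (eq_bigl (fun i : 'I_N => (i < (Num.trunc (heavy N)).+1)%N)).
  by rewrite -(big_ord_widen _ (fun=> 1%N) H) sum_nat_const card_ord muln1.
by move=> i; rewrite finset.inE.
Qed.

Lemma seeds_mass : phim * #|seeds N|%:R <= target N.
Proof.
apply: (le_trans _ size_target); rewrite seeds_card -mulrA.
by rewrite ler_wpM2l ?(ltW phim_gt0) // seeds_le.
Qed.

(** The first five terms of the union bound are at most a constant over N. They are weakened to
    multiples of 1 / L, the size of the last term, which comes from Markov's inequality. *)
Lemma bad_rare : bmean (edge_prob (N := N) beta gamma) (fun x => (bad (graph_of x))%:R) <=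
  (3 * expR 1 + 3) / L.
Proof.
have /andP[t0 t1] := slack01.
have a0 := tilt_gt0; have d0 := gain_gt0; have e0 := density_gt0.
have LN : L <= N%:R.
  have C1 := Cseeds_ge1.
  apply: (@le_trans _ _ (phim * Cseeds * L)).
    by rewrite ler_peMl ?(ltW L0) // -[leLHS]mul1r ler_pM.
  by apply: (le_trans size_target); rewrite ler_piMl ?density_le1.
have wM : heavy N <= target N.
  apply: (le_trans _ size_target).
  apply: (@le_trans _ _ (Cseeds * L)).
    by apply: (le_trans _ seeds_le); apply/ltW/truncnS_gt.
  by rewrite -mulrA ler_peMl // mulr_ge0 ?(ltW L0) // (le_trans ler01) // Cseeds_ge1.
have M1 : 1 <= target N.
  apply: (le_trans _ size_target); rewrite -[leLHS]mulr1 ler_pM //.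
  by rewrite -[leLHS]mul1r ler_pM // Cseeds_ge1.
have cM : beta / N%:R * phim * target N <= slack.
  apply: (le_trans _ density_slack); rewrite /target le_eqVlt; apply/orP; left; apply/eqP.
  by field; rewrite gt_eqF.
have D0 : 0 < max_degree2 N.
  by rewrite !mulr_gt0 ?exprn_gt0 // addr_gt0 // exprn_gt0.
have K1 : 1 < 1 + gain by rewrite ltrDl.
have aM : tilt * target N <= (1 + gain) ^+ rounds_growth N.
  apply: (@le_trans _ _ N%:R).
    rewrite /target mulrA ler_piMl // -[leRHS]mulr1 ler_pM ?(ltW a0) ?(ltW e0) ?tilt_le1 ?density_le1 //.
  have h := truncnS_gt (l / ln (1 + gain)); rewrite -/(rounds_growth N) in h.
  rewrite -[leLHS](@lnK R) ?posrE // -[X in X ^+ _](@lnK R) ?posrE ?(lt_trans ltr01) //.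
  rewrite -expRM_natl ler_expR -ler_pdivrMr ?ln_gain_gt0 //; exact: ltW.
have := @bad_graph_prob R N beta gamma beta0 gamma0 gamma1 N0 (@is_hub N) (@is_low N)
  (target N) (max_degree N) (max_degree2 N) (rounds N) (seeds N) slack phim (1 + gain)
  tilt gain (heavy N) (rounds_growth N) (rounds_alive N).
move=> H; apply: (le_trans (H _ _ _ cM _ _ _ _ M1 _ _ aM _ _ _ _ _ _ D0 (heavy N) _)) => {H}.
- move=> i li; rewrite /is_hub -leNgt; apply: (le_trans li).
  rewrite /heavy ler_pdivlMr // mulrC (le_trans size_phim) //.
  by rewrite ler_peMl // ler1n.
- by [].
- exact: ltW phim_gt0.
- by rewrite (ltW t0) (ltW t1).
- apply: growth_margin; rewrite mulrBr -addrA (le_trans size_mass) // lerDl.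
  by rewrite addrC subr_ge0 mulrA.
- by [].
- exact: ltW.
- exact: ltW.
- by rewrite /tilt divfK // gt_eqF // phim_gt0.
- by [].
- by [].
- by rewrite heavy_ge0 wM.
- by move=> i; exact: ltW.
- apply: (@le_trans _ _ (#|seeds N|%:R)).
    by rewrite seeds_card; apply/ltW/truncnS_gt.
  rewrite /wt -sum1_card natr_sum; apply: ler_sum => i _; exact: vweight_ge1.
- apply: (le_trans _ seeds_mass).
  rewrite /lwt -sum1_card natr_sum mulr_sumr; apply: ler_sum => i _; rewrite mulr1 /lw.
  by case: ifP => // _; rewrite (le_trans ler01).
- by move=> i; rewrite /is_hub -leNgt.
have NL : N%:R^-1 <= L^-1 by rewrite lef_pV2 ?posrE.
have small (x : R) : 2 * l <= x -> N%:R * expR (1 - x) <= expR 1 / L.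
  move=> hx; rewrite expRD mulrCA ler_wpM2l ?expR_ge0 //; apply: (le_trans _ NL).
  apply: (le_trans (ler_wpM2l (ltW NR0) (exp_small hx))).
  by rewrite expr2 invfM mulrA mulfV ?mul1r // gt_eqF.
have N1 : 1 <= N%:R :> R by rewrite ler1n.
have T1 : N%:R * expR (1 - tilt * gain * (rounds_alive N)%:R) <= expR 1 / L.
  have tg : 0 < tilt * gain by exact: mulr_gt0.
  apply: (small _ _); rewrite [tilt * gain * _]mulrC -ler_pdivrMr //.
  by rewrite /rounds_alive; apply/ltW/truncnS_gt.
have T2 : N%:R * expR (1 - tilt * heavy N) <= expR 1 / L.
  by apply: (small _ _); rewrite /heavy [tilt * _]mulrC divfK // gt_eqF.
have T3 : expR (1 - tilt * heavy N) <= expR 1 / L.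
  by apply: (le_trans _ T2); rewrite ler_peMl ?expR_ge0.
set r1 : R := (rounds N).+1%:R.
have r10 : 0 < r1 by rewrite ltr0n.
have r1L : r1 <= Crounds * L by exact: rounds_le.
have r2L : r1 ^+ 2 <= Crounds ^+ 2 * L ^+ 2.
  by rewrite -exprMn lerXn2r ?nnegrE ?(ltW r10) // (le_trans (ltW r10)).
have T4 : N%:R * (N%:R * (r1 * (r1 * expR (- (beta / N%:R * (target N / r1) ^+ 2))))) <= L^-1.
  (* The power 4 beats the choices of two vertices and two radii, at most N^2 r1^2 <= N^3. *)
  have E4 : expR (- (beta / N%:R * (target N / r1) ^+ 2)) <= (N%:R ^+ 4)^-1.
    apply: exp_small; rewrite /target.
    have -> : beta / N%:R * (density * N%:R / r1) ^+ 2 = beta * density ^+ 2 * N%:R / r1 ^+ 2.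
      by field; rewrite !gt_eqF.
    rewrite ler_pdivlMr ?exprn_gt0 //.
    have bf : 0 < beta * density ^+ 2 by rewrite mulr_gt0 // exprn_gt0.
    move: size_rounds; rewrite mulrAC ler_pdivrMr // => h; rewrite [leRHS]mulrC.
    apply: (le_trans _ h).
    apply: (@le_trans _ _ (4 * L * (Crounds ^+ 2 * L ^+ 2))).
      have l4 : 4 * l <= 4 * L by rewrite ler_wpM2l // lerDr.
      by apply: ler_pM => //; [exact: mulr_ge0|exact: sqr_ge0].
    by rewrite le_eqVlt; apply/orP; left; apply/eqP; ring.
  have r2N : r1 ^+ 2 <= N%:R by apply: (le_trans r2L).
  apply: (le_trans _ NL).
  rewrite (_ : _ * _ = N%:R ^+ 2 * r1 ^+ 2 * expR (- (beta / N%:R * (target N / r1) ^+ 2))); last by ring.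
  apply: (@le_trans _ _ (N%:R ^+ 2 * N%:R * (N%:R ^+ 4)^-1)).
    by apply: ler_pM; rewrite ?mulr_ge0 ?exprn_ge0 ?expR_ge0 ?(ltW r10) // ler_wpM2l ?exprn_ge0.
  by rewrite le_eqVlt; apply/orP; left; apply/eqP; field; rewrite gt_eqF.
have T5 : N%:R * expR ((expR 1 - 1) * (beta * L * heavy N) - max_degree N) <= L^-1.
  apply: (le_trans _ NL); rewrite -opprB.
  have hD : 2 * l <= max_degree N - (expR 1 - 1) * (beta * L * heavy N).
    have e1 : 0 <= expR 1 - 1 :> R by rewrite subr_ge0 -expR0 ler_expR.
    rewrite /max_degree lerBrDr.
    apply: (@le_trans _ _ (((expR 1 - 1) * beta * (2 / tilt) + 2) * L ^+ 2)); last first.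
      by rewrite ler_wpM2r ?exprn_ge0 ?(ltW L0) // le_max lexx orbT.
    have -> : heavy N = 2 / tilt * l by rewrite /heavy mulrAC.
    have x0 : 0 <= 2 / tilt by rewrite divr_ge0 // ltW.
    set x := 2 / tilt in x0 *.
    have y0 : 0 <= (expR 1 - 1) * beta * x.
      by apply: mulr_ge0 => //; apply: mulr_ge0 => //; exact: ltW.
    rewrite (_ : (expR 1 - 1) * (beta * L * (x * l)) = (expR 1 - 1) * beta * x * (L * l)); last by ring.
    set y := (_ * _ * x) in y0 *.
    have lL : l <= L by rewrite lerDr.
    have h1 : L * l <= L ^+ 2 by rewrite expr2 ler_wpM2l ?(ltW L0).
    have h2 : l <= L ^+ 2 by rewrite expr2 (le_trans lL) // ler_peMl ?(ltW L0).
    by rewrite [leLHS]addrC [leRHS]mulrDl; apply: lerD; rewrite ler_wpM2l.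
  apply: (le_trans (ler_wpM2l (ltW NR0) (exp_small hD))).
  by rewrite expr2 invfM mulrA mulfV ?mul1r // gt_eqF.
have T6 : (beta + beta ^+ 2) * L ^+ 3 * N%:R / max_degree2 N <= L^-1.
  have bb : 0 < beta + beta ^+ 2 by rewrite addr_gt0 // exprn_gt0.
  rewrite /max_degree2 le_eqVlt; apply/orP; left; apply/eqP.
  by move: bb; set b := beta + _ => bb; field; rewrite !gt_eqF.
have -> : (3 * expR 1 + 3) / L = expR 1 / L + (expR 1 / L + (expR 1 / L + (L^-1 + (L^-1 + L^-1)))).
  by field; rewrite gt_eqF.
by repeat apply: lerD.
Qed.

End FixedSize.
End Choice.

(** * Explicit powers of the logarithm *)

Section TauSize.
Variables (R : realType) (beta gamma u theta phim sigma : R).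
Hypothesis beta0 : 0 < beta.
Hypothesis gamma0 : 0 <= gamma.
Hypothesis phim1 : 1 <= phim.
Hypothesis sigma1 : 1 < sigma.
Hypothesis u01 : 0 < u < 1.
Hypothesis theta2 : theta <= 2.
Variable N : nat.
Local Notation l := (ln N%:R : R).
Local Notation L := (1 + ln N%:R : R).
Hypothesis N1 : (1 < N)%N.
Hypothesis l1 : 1 <= l.

Local Notation Cs := (Cseeds phim sigma).
Local Notation Cr := (Crounds phim sigma).
Local Notation Cd := (Cdeg beta phim sigma).
Local Notation fr := (density beta phim sigma).

Hypothesis size_target : 2 * (phim * Cs * L) <= fr * N%:R.

Variable g : sgraph 'I_N.
Hypothesis good : ~~ bad beta gamma phim sigma g.
Context d (T : measurableType d) (P : probability T R) (X : R -> T -> config 'I_N).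
Hypothesis HX : is_voter_model theta u g P X.

Let N0 : (0 < N)%N. Proof. exact: ltnW. Qed.
Let NR0 : 0 < N%:R :> R. Proof. by rewrite ltr0n. Qed.
Let L1 : 1 <= L. Proof. by rewrite lerDl (le_trans ler01). Qed.
Let L0 : 0 < L. Proof. exact: lt_le_trans L1. Qed.
Let phim0 : 0 < phim. Proof. exact: lt_le_trans phim1. Qed.

Let Cd1 : 1 <= Cd. Proof. by rewrite le_max lexx. Qed.

Lemma max_degree_ge1 : 1 <= max_degree beta phim sigma N.
Proof. by rewrite -[leLHS]mulr1 ler_pM // exprn_ege1. Qed.

Lemma max_degree2_gt0 : 0 < max_degree2 beta N.
Proof. by rewrite !mulr_gt0 ?exprn_gt0 // addr_gt0 // exprn_gt0. Qed.

(** The exponent 3 + 2 b of L is 2 for the squared walk length, 1 for the logarithm of 2 N^3, and 2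
    b for the power b of [max_degree]. *)
Lemma tau_size_le (b : nat) : `|theta| + 1 <= b%:R ->
  (\int[P]_w tau_cons g X w <=
   (64 * Cr ^+ 2 * Cd ^+ b * L ^+ (3 + 2 * b) * N%:R)%:E)%E.
Proof.
move=> hb.
have D1 := max_degree_ge1; have D0 : 0 < max_degree beta phim sigma N by exact: lt_le_trans D1.
apply: (le_trans (good_tau_le gamma0 N0 good D0 HX)); rewrite lee_fin.
set D := max_degree beta phim sigma N in D0 D1 *.
set r := rounds phim sigma N.
have hr : r.*2.+1%:R <= 2 * (Cr * L).
  have := rounds_le phim1 sigma1 l1; rewrite -/r => h.
  apply: (le_trans _ (ler_wpM2l _ h)) => //.
  by rewrite -natrM ler_nat mul2n doubleS ltnW.
have hr2 : r.*2.+1%:R ^+ 2 <= 4 * Cr ^+ 2 * L ^+ 2.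
  have -> : 4 * Cr ^+ 2 * L ^+ 2 = (2 * (Cr * L)) ^+ 2 by ring.
  by rewrite lerXn2r ?nnegrE // (le_trans _ hr).
have hk : (2^-1 * (D `^ (- `|theta|) * D^-1))^-1 <= 2 * D ^+ b.
  have -> : D `^ (- `|theta|) * D^-1 = (D `^ (`|theta| + 1))^-1.
    rewrite powRN -invfM; congr (_^-1); rewrite powRD ?powRr1 ?(ltW D0) //.
    by apply/implyP => _; rewrite gt_eqF.
  rewrite invfM !invrK ler_wpM2l // -powR_mulrn ?(ltW D0) //.
  by rewrite ler_powR.
have hDb : D ^+ b = Cd ^+ b * L ^+ (2 * b) by rewrite /D /max_degree exprMn -exprM.
have hln : ln (2 * N%:R ^+ 3) <= 4 * L.
  apply: (@le_trans _ _ (ln (N%:R ^+ 4))).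
    rewrite ler_ln ?posrE ?mulr_gt0 ?exprn_gt0 //.
    by rewrite [leRHS]exprS ler_wpM2r ?exprn_ge0 // ler_nat.
  by rewrite lnXn // -[leLHS]mulr_natl ler_wpM2l // lerDr.
have ln0 : 0 <= (ln (2 * N%:R ^+ 3) : R).
  apply: ln_ge0; rewrite -[leLHS]mulr1; apply: ler_pM => //; first by rewrite ler1n.
  by rewrite exprn_ege1 // ler1n.
apply: (@le_trans _ _ (2 * (N%:R * (4 * Cr ^+ 2 * L ^+ 2) * (2 * D ^+ b) * (4 * L)))).
  rewrite ler_wpM2l //; apply: ler_pM => //.
    rewrite mulr_ge0 ?mulr_ge0 ?exprn_ge0 ?(ltW NR0) //.
    by rewrite invr_ge0 !mulr_ge0 ?invr_ge0 ?powR_ge0 // ltW.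
  apply: ler_pM => //.
  - by rewrite invr_ge0 !mulr_ge0 ?invr_ge0 ?powR_ge0 // ltW.
  - by rewrite ler_wpM2l // ltW.
rewrite hDb le_eqVlt; apply/orP; left; apply/eqP.
rewrite exprD; ring.
Qed.

Definition Ctau : R := (u * (1 - u)) ^+ 2 * fr ^+ 4 / (8 * (beta + beta ^+ 2) * (phim * Cs) ^+ 4).

Lemma Ctau_gt0 : 0 < Ctau.
Proof.
have uu : 0 < u * (1 - u) by case/andP: u01 => ? ?; rewrite mulr_gt0 // subr_gt0.
have f0 : 0 < fr by exact: density_gt0.
have cs : 0 < phim * Cs by rewrite mulr_gt0 // (lt_le_trans ltr01) // Cseeds_ge1.
have bb : 0 < beta + beta ^+ 2 by rewrite addr_gt0 // exprn_gt0.
have n1 : 0 < (u * (1 - u)) ^+ 2 by exact: exprn_gt0.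
have n2 : 0 < fr ^+ 4 by exact: exprn_gt0.
have n3 : 0 < (phim * Cs) ^+ 4 by exact: exprn_gt0.
by apply: divr_gt0; apply: mulr_gt0 => //; exact: mulr_gt0.
Qed.

(** Of the eight powers of L, four come from Z^4, where N / L is the order of the component size Z,
    and four from [max_degree2]. *)
Lemma tau_size_ge : ((Ctau * N%:R / L ^+ 8)%:E <= \int[P]_w tau_cons g X w)%E.
Proof.
have D1 := max_degree_ge1; have D0 : 0 < max_degree beta phim sigma N by exact: lt_le_trans D1.
have f0 : 0 < fr by exact: density_gt0.
have cs : 0 < phim * Cs by rewrite mulr_gt0 // (lt_le_trans ltr01) // Cseeds_ge1.
have bb : 0 < beta + beta ^+ 2 by rewrite addr_gt0 // exprn_gt0.
pose Z := fr * N%:R / (phim * Cs * L).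
(* The factor 2 in [size_target] is there for this: it gives Z (Z - 1) >= Z^2 / 2. *)
have Z2 : 2 <= Z by rewrite /Z ler_pdivlMr // mulr_gt0.
have Z1 : 1 <= Z by lra.
have st : phim * Cs * L <= fr * N%:R.
  apply: (le_trans _ size_target); rewrite ler_peMl //; last by rewrite ler1n.
  by rewrite mulr_ge0 // ltW.
have S00 : (0 < #|seeds phim sigma N|)%N by rewrite (seeds_card phim1 sigma1 l1 st).
have ZM : Z * (phim * #|seeds phim sigma N|%:R) <= target beta phim sigma N.
  rewrite (seeds_card phim1 sigma1 l1 st).
  apply: (@le_trans _ _ (Z * (phim * (Cs * L)))).
    rewrite ler_wpM2l ?(le_trans ler01) // ler_wpM2l ?(ltW phim0) //.
    exact: seeds_le.
  have -> : phim * (Cs * L) = phim * Cs * L by rewrite mulrA.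
  by rewrite /Z divfK // gt_eqF // mulr_gt0.
have lowphi (j : 'I_N) : is_low gamma phim j -> vweight gamma j <= phim by [].
have := good_tau_ge gamma0 N0 u01 theta2 good D0 max_degree2_gt0 HX lowphi phim0 Z1 S00 ZM.
apply: le_trans; rewrite lee_fin.
have ZZ : Z ^+ 2 / 2 <= Z * (Z - 1) by nra.
apply: (@le_trans _ _ ((u * (1 - u)) ^+ 2 * (Z ^+ 2 / 2) ^+ 2 / (2 * max_degree2 beta N * N%:R ^+ 2))).
  rewrite le_eqVlt; apply/orP; left; apply/eqP.
  rewrite /Ctau /Z /max_degree2; move: bb cs L0 NR0 => /gt_eqF bb /gt_eqF cs' /gt_eqF LL /gt_eqF NN.
  move: (beta + _) bb => b0 bb; move: (phim * _) cs' => c0 cs'; move: (1 + _) LL => m LL.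
  by field; rewrite bb cs' LL NN.
have den : 0 <= (2 * max_degree2 beta N * N%:R ^+ 2)^-1.
  by rewrite invr_ge0 mulr_ge0 ?exprn_ge0 // mulr_ge0 // ltW // max_degree2_gt0.
rewrite ler_wpM2r // ler_wpM2l ?sqr_ge0 // lerXn2r ?nnegrE // ?(le_trans _ ZZ) //.
  by rewrite divr_ge0 // sqr_ge0.
by rewrite divr_ge0 // sqr_ge0.
Qed.

End TauSize.

(** * Passage to the limit *)

Local Open Scope classical_set_scope.
Local Open Scope ring_scope.

Section Sandwich.
Variables (R : realType) (beta gamma u theta phim sigma : R).
Hypothesis beta0 : 0 < beta.
Hypothesis gamma0 : 0 <= gamma.
Hypothesis gamma1 : gamma <= 2^-1.
Hypothesis phim1 : 1 <= phim.
Hypothesis sigma1 : 1 < sigma.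
Hypothesis u01 : 0 < u < 1.
Hypothesis theta2 : theta <= 2.
Variable b : nat.
Hypothesis hb : `|theta| + 1 <= b%:R.

(** The exponent 9 + 2 b exceeds both 8 and 3 + 2 b, so at least one spare power of ln N remains to
    beat the constants and to replace 1 + ln N by ln N. *)
Lemma tau_sandwich : \forall N \near \oo,
  forall (g : sgraph 'I_N) (d : measure_display) (T : measurableType d) (P : probability T R)
    (X : R -> T -> config 'I_N),
  ~~ bad beta gamma phim sigma g -> is_voter_model theta u g P X ->
  (N%:R%:E * ((ln N%:R ^+ (2 * (9 + 2 * b)))^-1)%:E <
   (\int[P]_w tau_cons g X w) * ((ln N%:R ^+ (9 + 2 * b))^-1)%:E < N%:R%:E)%E.
Proof.
pose k1 : R := 64 * Crounds phim sigma ^+ 2 * Cdeg beta phim sigma ^+ b.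
pose k2 : R := Ctau beta u phim sigma.
have f0 : 0 < density beta phim sigma by exact: density_gt0.
have k20 : 0 < k2 by exact: Ctau_gt0.
near=> N => g d T P X ngood HX.
have N1 : (1 < N)%N by near: N; exact: nbhs_infty_gt.
have l1 : 1 <= ln N%:R :> R by near: N; exact: ln_large.
have lk1 : k1 * 2 ^+ (3 + 2 * b) + 1 <= ln N%:R by near: N; exact: ln_large.
have lk2 : 2 ^+ 8 / k2 + 1 <= ln N%:R by near: N; exact: ln_large.
have tgt : 2 * (phim * Cseeds phim sigma * (1 + ln N%:R)) <= density beta phim sigma * N%:R.
  have : 2 * (phim * Cseeds phim sigma) / density beta phim sigma * (1 + ln N%:R) ^+ 1 <= N%:R.
    by near: N; exact: polylog_le.
  by rewrite expr1 mulrAC ler_pdivrMr // [N%:R * _]mulrC !mulrA.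
have NR0 : 0 < N%:R :> R by rewrite ltr0n ltnW.
have lo := tau_size_ge beta0 gamma0 phim1 sigma1 u01 theta2 N1 l1 tgt ngood HX.
have hi := tau_size_le gamma0 phim1 sigma1 N1 l1 ngood HX hb.
set l := ln N%:R in l1 lk1 lk2 lo hi *.
have l0 : 0 < l by exact: lt_le_trans l1.
have Ll : 1 + l <= 2 * l by rewrite mulr_natl mulr2n lerD2r.
have L0 : 0 < 1 + l by rewrite addr_gt0.
have ln0 n : 0 < l ^+ n by rewrite exprn_gt0.
case: (\int[P]_w tau_cons g X w)%E lo hi => [x| |]; rewrite ?lee_fin // => lo hi.
rewrite -!EFinM !lte_fin; apply/andP; split.
  have -> : l ^+ (2 * (9 + 2 * b)) = l ^+ (9 + 2 * b) * l ^+ (9 + 2 * b).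
    by rewrite -exprD addnn mul2n.
  rewrite invfM mulrA ltr_pM2r ?invr_gt0 // ltr_pdivrMr //.
  apply: (lt_le_trans _ (ler_wpM2r (ltW (ln0 _)) lo)); rewrite -/k2.
  have h8 : (1 + l) ^+ 8 <= 2 ^+ 8 * l ^+ 8.
    by rewrite -exprMn lerXn2r ?nnegrE ?(ltW L0) // mulr_ge0 // ltW.
  have hk : 2 ^+ 8 < k2 * l.
    by rewrite mulrC -ltr_pdivrMr //; apply: lt_le_trans lk2; rewrite ltrDl.
  have key : (1 + l) ^+ 8 < k2 * l ^+ (9 + 2 * b).
    apply: (le_lt_trans h8); apply: (@lt_le_trans _ _ (k2 * l * l ^+ 8)).
      by rewrite ltr_pM2r.
    rewrite -mulrA -exprS exprD ler_wpM2l ?(ltW k20) // ler_peMr ?(ltW (ln0 _)) //.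
    exact: exprn_ege1.
  by rewrite mulrAC ltr_pdivlMr ?exprn_gt0 // [k2 * _]mulrC -mulrA ltr_pM2l.
rewrite ltr_pdivrMr //; apply: (le_lt_trans hi).
rewrite [ltLHS]mulrC ltr_pM2l // -/k1.
have hL : (1 + l) ^+ (3 + 2 * b) <= 2 ^+ (3 + 2 * b) * l ^+ (3 + 2 * b).
  by rewrite -exprMn lerXn2r ?nnegrE ?(ltW L0) // mulr_ge0 // ltW.
have k10 : 0 <= k1.
  apply: mulr_ge0; first by apply: mulr_ge0 => //; exact: sqr_ge0.
  by apply: exprn_ge0; apply: (le_trans ler01); rewrite /Cdeg le_max lexx.
apply: (le_lt_trans (ler_wpM2l k10 hL)); rewrite mulrA.
rewrite (_ : (9 + 2 * b)%N = (6 + (3 + 2 * b))%N) // [ltRHS]exprD ltr_pM2r //.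
apply: (@lt_le_trans _ _ l); first by apply: lt_le_trans lk1; rewrite ltrDl.
by rewrite exprS ler_peMr ?(ltW l0) // exprn_ege1.
Unshelve. all: by end_near.
Qed.

Lemma bad_rare_near (H : \forall N \near \oo, sigma <= beta / N%:R *
    (\sum_(i < N | vweight gamma i <= phim) vweight gamma i ^+ 2)) (e : R) : 0 < e ->
  \forall N \near \oo, bmean (edge_prob (N := N) beta gamma)
    (fun x => (bad beta gamma phim sigma (graph_of x))%:R) <= e.
Proof.
move=> e0; have f0 : 0 < density beta phim sigma by exact: density_gt0.
near=> N.
have N0 : (0 < N)%N by near: N; exact: nbhs_infty_gt.
have l1 : 1 <= ln N%:R :> R by near: N; exact: ln_large.
have le : (3 * expR 1 + 3) / e <= ln N%:R by near: N; exact: ln_large.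
have lt : tilt phim sigma * phim <= ln N%:R by near: N; exact: ln_large.
have tgt : phim * Cseeds phim sigma * (1 + ln N%:R) <= density beta phim sigma * N%:R.
  have : phim * Cseeds phim sigma / density beta phim sigma * (1 + ln N%:R) ^+ 1 <= N%:R.
    by near: N; exact: polylog_le.
  by rewrite expr1 mulrAC ler_pdivrMr // [N%:R * _]mulrC.
have r3 : 4 * Crounds phim sigma ^+ 2 / (beta * density beta phim sigma ^+ 2) *
    (1 + ln N%:R) ^+ 3 <= N%:R by near: N; exact: polylog_le.
have r2 : Crounds phim sigma ^+ 2 * (1 + ln N%:R) ^+ 2 <= N%:R.
  by near: N; exact: polylog_le.
have mass : sigma <= beta / N%:R *
    (\sum_(i < N | vweight gamma i <= phim) vweight gamma i ^+ 2) by near: N.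
apply: (le_trans (bad_rare beta0 gamma0 gamma1 phim1 sigma1 N0 l1 mass lt tgt r3 r2)).
have L0 : 0 < 1 + ln N%:R :> R by rewrite addr_gt0 // (lt_le_trans ltr01).
rewrite ler_pdivrMr // [leRHS]mulrC -ler_pdivrMr //; apply: (le_trans le).
by rewrite lerDr.
Unshelve. all: by end_near.
Qed.

End Sandwich.

Theorem theorem1p5 (R : realType) (beta gamma u theta : R)
  (hgamma0 : 0 <= gamma) (hgamma1 : gamma <= 2^-1)
  (hbeta0 : 0 < beta) (hbeta : 1 - 2 * gamma < beta)
  (hu0 : 0 < u) (hu1 : u < 1) (htheta : theta <= 2)
  (* the random graphs *)
  (dG : nat -> measure_display) (TG : forall N, measurableType (dG N))
  (PG : forall N, probability (TG N) R) (G : forall N, TG N -> sgraph 'I_N)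
  (hG : forall N, is_snr_graph beta gamma (PG N) (G N))
  (* the voter model on each deterministic graph *)
  (d : forall N, sgraph 'I_N -> measure_display)
  (T : forall N (g : sgraph 'I_N), measurableType (d N g))
  (P : forall N (g : sgraph 'I_N), probability (T N g) R)
  (eta : forall N (g : sgraph 'I_N), R -> T N g -> config 'I_N)
  (heta : forall N (g : sgraph 'I_N),
      is_voter_model theta u g (P N g) (eta N g)) :
  ThetaP_log PG
    (fun N w => \int[P N (G N w)]_w' tau_cons (G N w) (eta N (G N w)) w')%E
    (fun N _ => (N%:R)%:E).
Proof.
have [phim [sigma [phim1 sigma1 mass]]] := low_mass_constants hgamma0 hgamma1 hbeta0 hbeta.
(* A natural exponent dominating |theta| + 1, the power of the maximal degree lost in the smallest
   rate. *)
pose b := (Num.trunc (`|theta| + 1)).+1.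
have hb : `|theta| + 1 <= b%:R by apply/ltW/truncnS_gt.
have u01 : 0 < u < 1 by rewrite hu0.
pose k := (9 + 2 * b)%N.
exists k%:R; first by rewrite ltr0n.
(* The sandwich depends on w only through the graph, so as a predicate on graphs it falls under
   [graph_law]. *)
pose A N (g : sgraph 'I_N) : bool :=
  `[< (N%:R%:E * ((ln N%:R `^ (2 * k%:R))^-1)%:E <
       (\int[P N g]_w' tau_cons g (eta N g) w') * ((ln N%:R `^ k%:R)^-1)%:E < N%:R%:E)%E >].
pose x N : R := bmean (edge_prob (N := N) beta gamma) (fun s => (A N (graph_of s))%:R).
have PA N : PG N [set w | A N (G N w)] = (x N)%:E by have [] := graph_law (hG N) (A N).
have -> : (fun N => PG N [set w | (N%:R%:E * ((ln N%:R `^ (2 * k%:R))^-1)%:E <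
     (\int[P N (G N w)]_w' tau_cons (G N w) (eta N (G N w)) w') *
       ((ln N%:R `^ k%:R)^-1)%:E < N%:R%:E)%E]) = (fun N => (x N)%:E).
  apply/funext => N; rewrite -PA; congr (PG N _); apply/seteqP; split => w /=.
    by move=> h; apply/asboolP.
  by move/asboolP.
apply/fine_cvgP; split; first by near=> N.
apply/cvgrPdist_le => e e0; near=> N => /=.
have N0 : (0 < N)%N by near: N; exact: nbhs_infty_gt.
have l1 : 1 <= ln N%:R :> R by near: N; exact: ln_large.
have x1 : x N <= 1 by rewrite -lee_fin -PA probability_le1 //; have [] := graph_law (hG N) (A N).
rewrite ger0_norm ?subr_ge0 // lerBlDr -lerBlDl.
have small : bmean (edge_prob (N := N) beta gamma)
    (fun s => (bad beta gamma phim sigma (graph_of s))%:R) <= e.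
  near: N; exact: bad_rare_near.
have sand : forall g : sgraph 'I_N, ~~ bad beta gamma phim sigma g -> A N g.
  have H : forall (g : sgraph 'I_N) (d : measure_display) (T : measurableType d)
      (P : probability T R) (X : R -> T -> config 'I_N),
    ~~ bad beta gamma phim sigma g -> is_voter_model theta u g P X ->
    (N%:R%:E * ((ln N%:R ^+ (2 * (9 + 2 * b)))^-1)%:E <
     (\int[P]_w tau_cons g X w) * ((ln N%:R ^+ (9 + 2 * b))^-1)%:E < N%:R%:E)%E.
    by near: N; exact: tau_sandwich.
  move=> g ngood; apply/asboolP; rewrite -natrM !powR_mulrn ?(le_trans ler01) //.
  exact: H ngood (heta N g).
apply: (@le_trans _ _ (1 - bmean (edge_prob (N := N) beta gamma)
    (fun s => (bad beta gamma phim sigma (graph_of s))%:R))); first by rewrite lerB.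
rewrite lerBlDr -[leLHS](bmean1 (edge_prob (N := N) beta gamma)) /x -bmeanD.
apply: (le_bmean (edge_prob01 hbeta0 hgamma0 N0)) => s.
case: (boolP (bad _ _ _ _ _)) => [_|/sand ->]; last by rewrite addr0.
by rewrite -[leLHS]add0r lerD.
Unshelve. all: by end_near.
Qed.
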